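(* Let $k\ge 4$ be an even integer, and let $H\subset W(k)^+$ be a subgroup such that $wHw^{-1}\cap B_{4k}=\{1\}$ for all $w\in W(k)$, where $B_{4k}=\{w\in W(k)\mid l(w)\le 4k\}$. Then $H$ acts freely on $\mathcal H(k)$ and the tesselation $\tau_H$ of $\mathcal H(k)/H$ is $2k$-regular. Moreover, the set of systoles of $\mathcal H(k)/H$ is exactly the set of curves of $\tau_H$.
   Context: A systole of a hyperbolic surface is an essential closed geodesic of minimal length (as an unparametrized, unoriented curve). Let $P$ be the unique (up to isometry) regular right-angled hyperbolic hexagon; all its sides have length $L=\operatorname{arcosh} 2$. The decorated hexagon $\mathcal P$ is $P$, oriented, with its sides indexed by $\mathbb Z/6\mathbb Z$ cyclically in anti-clockwise order; $\overline{\mathcal P}$ is the same hexagon with the opposite orientation. A standard tesselation of an oriented hyperbolic surface is a tesselation whose tiles are decorated hexagons $\mathcal P$ or $\overline{\mathcal P}$ such that tiles are glued along sides of the same index and each vertex has valence four. A curve of it is a maximal geodesic contained in its $1$-skeleton. The tesselation is $2k$-regular if every curve is a closed geodesic of length $2kL$. Let $\mathbb H$ be the hyperbolic plane and $\tau_\infty$ its standard tesselation (unique up to isometry), with a chosen tile $\tilde T$, and let $s_i$ ($i\in\mathbb Z/6\mathbb Z$) be the reflection across the line containing the side of index $i$ of $\tilde T$. The group $W(\infty)$ generated by the $s_i$ has presentation $\langle s_i \mid s_i^2=(s_is_{i+1})^2=1\ \forall i\in\mathbb Z/6\mathbb Z\rangle$. Let $N(k)$ be the normal subgroup of $W(\infty)$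 generated by all conjugates of $(s_is_{i+2})^k$, $i\in\mathbb Z/6\mathbb Z$; it acts freely on $\mathbb H$. Put $W(k)=W(\infty)/N(k)$, the Coxeter group $\langle s_i \mid s_i^2=(s_is_{i+1})^2=(s_is_{i+2})^k=1\ \forall i\in\mathbb Z/6\mathbb Z\rangle$, and $\mathcal H(k)=\mathbb H/N(k)$, with the standard tesselation $\tau_k$ induced by $\tau_\infty$; $W(k)$ acts on $\mathcal H(k)$. Let $l$ be the word length on $W(k)$ with respect to the generators $s_i$, let $\epsilon:W(k)\to\{\pm1\}$ be the homomorphism with $\epsilon(s_i)=-1$ for all $i$, and $W(k)^+=\ker\epsilon$. For a subgroup $H\subset W(k)^+$ acting freely on $\mathcal H(k)$, $\tau_H$ is the tesselation induced by $\tau_k$ on $\mathcal H(k)/H$. *)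

(* Defs.v *)
From HB Require Import structures.
From mathcomp Require Import all_boot all_order all_algebra generic_quotient.
From mathcomp Require Import all_classical all_reals all_analysis.
From mathcomp Require Import ring lra.

Set Implicit Arguments.
Unset Strict Implicit.
Unset Printing Implicit Defensive.

Import Order.TTheory GRing.Theory Num.Theory.

Local Open Scope classical_set_scope.
Local Open Scope quotient_scope.
Local Open Scope ring_scope.

Record subgroup (G : groupType) := Subgroup {
  sg_set :> set G;
  sg_1 : sg_set 1%g;
  sg_div : forall x y, sg_set x -> sg_set y -> sg_set (x / y)%g }.

Record normal_subgroup (G : groupType) := NormalSubgroup {
  ns_sg :> subgroup G;
  ns_conj : forall g x, sg_set ns_sg x -> sg_set ns_sg (g * x * g^-1)%g }.

Record action (G : groupType) (T : Type) := Action {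
  act :> G -> T -> T;
  act_1 : forall x, act 1%g x = x;
  act_M : forall g h x, act (g * h)%g x = act g (act h x) }.

Section SubgroupTheory.
Variables (G : groupType) (K : subgroup G).

Lemma sg_inv x : sg_set K x -> sg_set K x^-1%g.
Proof. by move=> Kx; rewrite -[x^-1%g]mul1g; apply: sg_div => //; exact: sg_1. Qed.

Lemma sg_mul x y : sg_set K x -> sg_set K y -> sg_set K (x * y)%g.
Proof. by move=> Kx Ky; rewrite -[y]invgK; apply: sg_div => //; exact: sg_inv. Qed.

End SubgroupTheory.

Section GeneratedSubgroup.
Variables (G : groupType) (A : set G).

Definition is_subgroup (S : set G) : Prop :=
  S 1%g /\ forall x y, S x -> S y -> S (x / y)%g.

Lemma gen_1 : smallest is_subgroup A 1%g.
Proof. by move=> S [[]]. Qed.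

Lemma gen_div x y : smallest is_subgroup A x -> smallest is_subgroup A y ->
  smallest is_subgroup A (x / y)%g.
Proof.
move=> Ax Ay S SA; have [[_ SD] _] := SA.
by apply: SD; [exact: Ax | exact: Ay].
Qed.

Definition generated : subgroup G := Subgroup gen_1 gen_div.

End GeneratedSubgroup.

Section OrbitSpace.
Variables (G : groupType) (T : choiceType) (a : action G T) (K : subgroup G).

Definition orbit_rel : rel T := fun x y => `[< exists2 g, sg_set K g & a g x = y >].

Lemma orbit_rel_refl : reflexive orbit_rel.
Proof. by move=> x; apply/asboolP; exists 1%g; [exact: sg_1 | exact: act_1]. Qed.

Lemma orbit_rel_sym : symmetric orbit_rel.
Proof.
suff H x y : orbit_rel x y -> orbit_rel y x by move=> x y; apply/idP/idP; exact: H.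
move=> /asboolP[g Kg <-]; apply/asboolP; exists g^-1%g; first exact: sg_inv.
by rewrite -act_M mulVg act_1.
Qed.

Lemma orbit_rel_trans : transitive orbit_rel.
Proof.
move=> y x z /asboolP[g Kg <-] /asboolP[h Kh <-]; apply/asboolP.
by exists (h * g)%g; [exact: sg_mul | rewrite act_M].
Qed.

Canonical orbit_equiv := EquivRel orbit_rel
  orbit_rel_refl orbit_rel_sym orbit_rel_trans.

Definition orbit_space := {eq_quot orbit_equiv}.
HB.instance Definition _ := Choice.on orbit_space.


Definition orbit (x : T) : orbit_space := \pi x.

Lemma orbitP x y : orbit x = orbit y <-> exists2 g, sg_set K g & a g x = y.
Proof.
split=> [/eqP|[g Kg gxy]].
  by rewrite /orbit eqmodE /= => /asboolP.
by apply/eqP; rewrite /orbit eqmodE /=; apply/asboolP; exists g.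
Qed.

Lemma orbit_repr (p : orbit_space) : orbit (repr p) = p.
Proof. exact: reprK. Qed.

Definition acts_freely := forall g, sg_set K g -> forall x, a g x = x -> g = 1%g.

End OrbitSpace.

Section QuotientGroup.
Variables (G : groupType) (N : normal_subgroup G).

Definition translation : action G G :=
  Action (@mul1g G) (fun g h x => esym (mulgA g h x)).

(* The right cosets N g, which are also the left cosets since N is normal. *)
Definition quotient_group := orbit_space translation N.
HB.instance Definition _ := Choice.on quotient_group.

Definition coset (g : G) : quotient_group := orbit translation N g.

Lemma cosetP g h : coset g = coset h <-> exists2 n, sg_set N n & (n * g)%g = h.
Proof. exact: orbitP. Qed.

Lemma coset_repr (p : quotient_group) : coset (repr p) = p.
Proof. exact: orbit_repr. Qed.

Definition qmul (p q : quotient_group) := coset (repr p * repr q)%g.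
Definition qinv (p : quotient_group) := coset (repr p)^-1%g.
Definition qone := coset 1%g.

Lemma qmulE g h : qmul (coset g) (coset h) = coset (g * h)%g.
Proof.
have /cosetP[m Nm Em] := coset_repr (coset g).
have /cosetP[n Nn En] := coset_repr (coset h).
apply/cosetP; exists (m * (repr (coset g) * n * (repr (coset g))^-1))%g.
  by apply: sg_mul => //; exact: ns_conj.
by rewrite -[in RHS]Em -[in RHS]En !mulgA mulgVK.
Qed.

Lemma qinvE g : qinv (coset g) = coset g^-1%g.
Proof.
have /cosetP[m Nm Em] := coset_repr (coset g).
apply/cosetP; exists ((repr (coset g))^-1 * m^-1 * (repr (coset g))^-1^-1)%g.
  by apply: ns_conj; exact: sg_inv.
by rewrite -[in RHS]Em invgM invgK -!mulgA mulgV mulg1.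
Qed.

Lemma qmulA : associative qmul.
Proof.
move=> p q r; rewrite -(coset_repr p) -(coset_repr q) -(coset_repr r).
by rewrite !qmulE mulgA.
Qed.

Lemma qmul1 : left_id qone qmul.
Proof. by move=> p; rewrite -(coset_repr p) qmulE mul1g. Qed.

Lemma qmulr1 : right_id qone qmul.
Proof. by move=> p; rewrite -(coset_repr p) qmulE mulg1. Qed.

Lemma qmulV : left_inverse qone qinv qmul.
Proof. by move=> p; rewrite -(coset_repr p) qinvE qmulE mulVg. Qed.

Lemma qmulrV : right_inverse qone qinv qmul.
Proof. by move=> p; rewrite -(coset_repr p) qinvE qmulE mulgV. Qed.

HB.instance Definition _ := isGroup.Build quotient_group
  qmulA qmul1 qmulr1 qmulV qmulrV.

Variables (T : choiceType) (a : action G T).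

Definition qact (p : quotient_group) (x : orbit_space a N) : orbit_space a N :=
  orbit a N (a (repr p) (repr x)).

Lemma qactE g x : qact (coset g) (orbit a N x) = orbit a N (a g x).
Proof.
have /cosetP[m Nm Em] := coset_repr (coset g).
have /orbitP[n Nn En] := orbit_repr (orbit a N x).
apply/orbitP; exists (m * (repr (coset g) * n * (repr (coset g))^-1))%g.
  by apply: sg_mul => //; exact: ns_conj.
by rewrite -[in RHS]Em -[in RHS]En -!act_M !mulgA mulgVK.
Qed.

Lemma qact_1 x : qact 1%g x = x.
Proof. by rewrite -(orbit_repr x) qactE act_1. Qed.

Lemma qact_M p q x : qact (p * q)%g x = qact p (qact q x).
Proof.
rewrite -(orbit_repr x) -(coset_repr p) -(coset_repr q).
by rewrite [(_ * _)%g]qmulE !qactE act_M.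
Qed.

Definition quotient_action : action quotient_group (orbit_space a N) :=
  Action qact_1 qact_M.

End QuotientGroup.

Section MetricSurface.
Variables (R : realType) (S : Type) (d : S -> S -> R).

(* Unit-speed, locally length-minimizing; only the values of c on I matter. *)
Definition geodesic (I : set R) (c : R -> S) : Prop :=
  [/\ is_interval I,
      (exists a b, [/\ I a, I b & a < b]) &
      forall t, I t -> exists2 e, 0 < e &
        forall s u, I s -> I u -> `|s - t| < e -> `|u - t| < e ->
          d (c s) (c u) = `|s - u| ].

(* A closed geodesic of length l, i.e. the loop run through by c on [0, l]. *)
Definition closed_geodesic (c : R -> S) (l : R) : Prop :=
  [/\ 0 < l, geodesic setT c & forall t, c (t + l) = c t].

(* Free homotopy of l-periodic loops to a constant loop. *)
Definition null_homotopic (c : R -> S) (l : R) : Prop :=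
  exists F : R -> R -> S,
    [/\ forall t, F 0 t = c t,
        exists p, forall t, F 1 t = p,
        forall s t, 0 <= s <= 1 -> F s (t + l) = F s t &
        forall s t, 0 <= s <= 1 -> forall e, 0 < e -> exists2 r, 0 < r &
          forall s' t', 0 <= s' <= 1 -> `|s' - s| < r -> `|t' - t| < r ->
            d (F s t) (F s' t') < e ].

(* No condition at cusps: the surfaces considered here are tiled by compact
   hexagons. *)
Definition essential_closed_geodesic (c : R -> S) (l : R) : Prop :=
  closed_geodesic c l /\ ~ null_homotopic c l.

(* The unparametrized, unoriented curve of a unit-speed path: the class of all
   its unit-speed parametrizations. *)
Definition unparam (I : set R) (c : R -> S) : set (set R * (R -> S)) :=
  [set Jc | exists (b : bool) (t0 : R),
     Jc.1 = [set t | I ((-1) ^+ b * t + t0)] /\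
     forall t, Jc.1 t -> Jc.2 t = c ((-1) ^+ b * t + t0)].

Definition systoles : set (set (set R * (R -> S))) :=
  [set C | exists c l,
    [/\ essential_closed_geodesic c l,
        (forall c' l', essential_closed_geodesic c' l' -> l <= l') &
        C = unparam setT c]].

Definition maximal_geodesic_in (K : set S) (I : set R) (c : R -> S) : Prop :=
  [/\ geodesic I c, c @` I `<=` K &
      forall J c', geodesic J c' -> c' @` J `<=` K ->
        I `<=` J -> {in I, c' =1 c} -> J `<=` I].

End MetricSurface.

(* When pr is the projection onto the orbits of a discrete group of isometries,
   this is the path metric of the quotient surface. *)
Definition quotient_dist (R : realType) (T S : Type) (d : T -> T -> R)
    (pr : T -> S) (p q : S) : R :=
  inf [set d x y | x in pr @^-1` [set p] & y in pr @^-1` [set q]].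

(* A copy of the decorated hexagon: the region it covers, its indexed sides,
   and whether it is a copy of the hexagon with the given orientation (true) or
   with the opposite one (false). *)
Record tile (S : Type) := Tile {
  tile_body : set S;
  tile_side : 'Z_6 -> set S;
  tile_orient : bool }.

Definition tesselation (S : Type) := set (tile S).

Definition map_tile (S S' : Type) (f : S -> S') (pos : bool) (t : tile S) : tile S' :=
  Tile (f @` tile_body t) (fun i => f @` tile_side t i) (pos == tile_orient t).

Definition induced (S S' : Type) (f : S -> S') (tau : tesselation S) :
  tesselation S' := [set map_tile f true t | t in tau].

Definition skeleton (S : Type) (tau : tesselation S) : set S :=
  \bigcup_(t in tau) \bigcup_(i in [set: 'Z_6]) tile_side t i.

Definition arcosh (R : realType) (x : R) : R := ln (x + Num.sqrt (x ^+ 2 - 1)).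

Section Curves.
Variables (R : realType) (S : Type) (d : S -> S -> R) (tau : tesselation S).

Definition curve (I : set R) (c : R -> S) : Prop :=
  maximal_geodesic_in d (skeleton tau) I c.

Definition curves : set (set (set R * (R -> S))) :=
  [set C | exists I c, curve I c /\ C = unparam I c].

(* The length of a curve that is a closed geodesic is its least period. *)
Definition regular (n : nat) : Prop :=
  forall I c, curve I c ->
    [/\ I = setT, closed_geodesic d c (n%:R * arcosh 2) &
        forall l, closed_geodesic d c l -> n%:R * arcosh 2 <= l].

End Curves.

Section Hyperbolic.
Variable R : realType.

Definition minkJ : 'M[R]_3 := diag_mx (\row_j (if j == 0 then -1 else 1)).

Definition mink (x y : 'cV[R]_3) : R := (x^T *m minkJ *m y) 0 0.

Lemma minkE x y :
  mink x y = - (x 0 0 * y 0 0) + x 1 0 * y 1 0 + x (2%:R : 'I_3) 0 * y (2%:R : 'I_3) 0.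
Proof.
rewrite /mink mul_mx_diag mxE !big_ord_recl big_ord0 !mxE /=.
have -> : lift ord0 ord0 = 1 :> 'I_3 by apply/val_inj.
have -> : lift ord0 (lift ord0 ord0) = 2%:R :> 'I_3 by apply/val_inj.
rewrite /=; ring.
Qed.

Definition on_sheet (x : 'cV[R]_3) : bool := (mink x x == -1) && (0 < x 0 0).

Record hplane := HPlane { hcoord :> 'cV[R]_3; _ : on_sheet hcoord }.
HB.instance Definition _ := [isSub for hcoord].
HB.instance Definition _ := [Choice of hplane by <:].

Definition hdist (x y : hplane) : R := arcosh (- mink x y).

(* Outward unit normal of the line carrying side i: these vectors satisfy
   mink v_i v_(i+1) = 0 (right angles) and mink v_i v_(i+2) = -2, so that
   consecutive vertices are at distance arcosh 2. *)
Definition side_normal (i : 'Z_6) : 'cV[R]_3 :=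
  \col_j [:: 1; Num.sqrt 2 * cos ((i : nat)%:R * pi / 3);
                Num.sqrt 2 * sin ((i : nat)%:R * pi / 3)]`_j.

(* Matrix of x |-> x - 2 (mink v x) v with v = side_normal i. *)
Definition refl (i : 'Z_6) : 'M[R]_3 :=
  1 - 2 *: (side_normal i *m ((side_normal i)^T *m minkJ)).

Lemma side_normal_unit i : mink (side_normal i) (side_normal i) = 1.
Proof.
rewrite minkE !mxE /=.
set t := _ * pi / 3; have := cos2Dsin2 t; have := sqr_sqrtr (ler0n R 2).
rewrite !expr2; move: (Num.sqrt 2) (cos t) (sin t) => q c s qq cs.
have -> : - (1 * 1) + q * c * (q * c) + q * s * (q * s)
  = - 1 + (q * q) * (c * c + s * s) by ring.
by rewrite qq cs; ring.
Qed.

Lemma refl_mulE i (x : 'cV[R]_3) :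
  refl i *m x = x - (2 * mink (side_normal i) x) *: side_normal i.
Proof.
rewrite /refl mulmxBl mul1mx -scalemxAl -!mulmxA [_^T *m (_ *m _)]mulmxA.
by rewrite [_ *m minkJ *m x]mx11_scalar mul_mx_scalar scalerA.
Qed.

Lemma minkC x y : mink x y = mink y x.
Proof. by rewrite !minkE; ring. Qed.

Lemma mink_refl i x y : mink (refl i *m x) (refl i *m y) = mink x y.
Proof.
rewrite !refl_mulE; have := side_normal_unit i.
move: (side_normal i) => v; rewrite !minkE !mxE => vv.
set a := v 0 0 in vv *; set b := v 1 0 in vv *; set c := v (2%:R) 0 in vv *.
set X := x 0 0; set Y := x 1 0; set Z := x _ 0.
set X' := y 0 0; set Y' := y 1 0; set Z' := y _ 0.
set p := - (a * X) + _ + _; set q := - (a * X') + _ + _.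
have -> : - ((X - 2 * p * a) * (X' - 2 * q * a)) + (Y - 2 * p * b) * (Y' - 2 * q * b)
    + (Z - 2 * p * c) * (Z' - 2 * q * c)
  = - (X * X') + Y * Y' + Z * Z' - 2 * p * q - 2 * q * p
    + 4 * p * q * (- (a * a) + b * b + c * c) by rewrite /p /q; ring.
by rewrite vv; ring.
Qed.

Lemma reflK i : refl i * refl i = 1.
Proof.
have vv : (side_normal i)^T *m minkJ *m side_normal i = 1%:M.
  by rewrite [LHS]mx11_scalar -/(mink _ _) side_normal_unit.
rewrite /refl; set P := side_normal i *m _.
have PP : P * P = P.
  rewrite -[P * P]/(P *m P) /P mulmxA -[_ *m _ *m side_normal i]mulmxA vv.
  by rewrite mulmx1.
rewrite mulrBl mul1r mulrBr mulr1 -scalerAl -scalerAr PP scalerA.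
by apply/matrixP => j l; rewrite !mxE; ring.
Qed.

Lemma det_refl i : \det (refl i) = -1.
Proof.
have := side_normal_unit i; rewrite minkE.
rewrite (expand_det_row _ 0) !big_ord_recl big_ord0 /cofactor.
rewrite !(expand_det_row _ 0) !big_ord_recl !big_ord0 /cofactor !det_mx11.
rewrite /refl mulmxA mul_mx_diag.
move: (side_normal i) => v; rewrite !mxE /= !big_ord1 !mxE /=.
have [w vE] : exists w : nat -> R, forall j l, v j l = w j.
  by exists (fun n => v (inord n) 0) => j l; rewrite (ord1 l) inord_val.
rewrite !vE /= /bump /=; move: (w 0%N) (w 1%N) (w 2%N) => a b c vv.
transitivity (1 - 2 * (- (a * a) + b * b + c * c)); first by ring.
by rewrite vv; ring.
Qed.

Lemma on_sheet_refl i x : on_sheet x -> on_sheet (refl i *m x).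
Proof.
move=> /andP[/eqP xx x0]; rewrite /on_sheet mink_refl xx eqxx /=.
rewrite refl_mulE !mxE; move: xx; rewrite !minkE /side_normal !mxE /=.
set t := _ * pi / 3; have := cos2Dsin2 t; have := sqr_sqrtr (ler0n R 2).
rewrite !expr2; move: (Num.sqrt 2) (cos t) (sin t) => q c s qq cs.
move: x0; move: (x 0 0) (x 1 0) (x (2%:R : 'I_3) 0) => X Y Z X0 XX.
set u := q * c * Y + q * s * Z.
have -> : X - 2 * (- (1 * X) + q * c * Y + q * s * Z) * 1 = 3 * X - 2 * u.
  by rewrite /u; ring.
have uu : u * u <= 2 * (X * X - 1).
  have -> : 2 * (X * X - 1) = u * u + 2 * (c * Z - s * Y) * (c * Z - s * Y).
    have -> : X * X - 1 = (Y * Y + Z * Z) * (c * c + s * s) by rewrite cs; lra.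
    have -> : u * u = (q * q) * (c * Y + s * Z) * (c * Y + s * Z).
      by rewrite /u; ring.
    by rewrite qq; ring.
  by rewrite lerDl -mulrA mulr_ge0 // -expr2 sqr_ge0.
rewrite subr_gt0; nra.
Qed.

(* The group generated by the reflections; since these are involutions, its
   elements are exactly the products of reflections. *)
Definition refl_word (u : seq 'Z_6) : 'M[R]_3 := \prod_(i <- u) refl i.

Record Winf := MkWinf {
  wmx :> 'M[R]_3;
  _ : `[< exists u : seq 'Z_6, wmx = refl_word u >] }.
HB.instance Definition _ := [isSub for wmx].
HB.instance Definition _ := [Choice of Winf by <:].

Lemma wmxP (w : Winf) : exists u : seq 'Z_6, wmx w = refl_word u.
Proof. by case: w => A /= /asboolP. Qed.

Lemma refl_word_rev u : refl_word (rev u) * refl_word u = 1.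
Proof.
rewrite /refl_word; elim: u => [|i u IH]; first by rewrite !big_nil mulr1.
rewrite rev_cons big_rcons big_cons /= mulrA -[X in X * _]mulrA reflK mulr1.
exact: IH.
Qed.

Lemma refl_wordV u : (refl_word u)^-1 = refl_word (rev u).
Proof.
have E := refl_word_rev u; have E' := refl_word_rev (rev u).
rewrite revK in E'.
have U : refl_word u \is a GRing.unit by apply/unitrP; exists (refl_word (rev u)).
by apply: (mulIr U); rewrite mulVr // E.
Qed.

Fact winf_1P : `[< exists u : seq 'Z_6, 1 = refl_word u >].
Proof. by apply/asboolP; exists [::]; rewrite /refl_word big_nil. Qed.

Fact winf_mulP (v w : Winf) : `[< exists u : seq 'Z_6, wmx v * wmx w = refl_word u >].
Proof.
apply/asboolP; have [u ->] := wmxP v; have [u' ->] := wmxP w.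
by exists (u ++ u'); rewrite /refl_word big_cat.
Qed.

Fact winf_invP (w : Winf) : `[< exists u : seq 'Z_6, (wmx w)^-1 = refl_word u >].
Proof.
by apply/asboolP; have [u ->] := wmxP w; exists (rev u); rewrite refl_wordV.
Qed.

Definition winf_one := MkWinf winf_1P.
Definition winf_mul v w := MkWinf (winf_mulP v w).
Definition winf_inv w := MkWinf (winf_invP w).

Lemma wmx_unit (w : Winf) : wmx w \is a GRing.unit.
Proof.
have [u ->] := wmxP w; apply/unitrP; exists (refl_word (rev u)).
by split; rewrite ?refl_word_rev //; have := refl_word_rev (rev u); rewrite revK.
Qed.

Fact winf_mulA : associative winf_mul.
Proof. by move=> u v w; apply/val_inj; rewrite /= mulrA. Qed.
Fact winf_mul1 : left_id winf_one winf_mul.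
Proof. by move=> w; apply/val_inj; rewrite /= mul1r. Qed.
Fact winf_mulr1 : right_id winf_one winf_mul.
Proof. by move=> w; apply/val_inj; rewrite /= mulr1. Qed.
Fact winf_mulV : left_inverse winf_one winf_inv winf_mul.
Proof. by move=> w; apply/val_inj; rewrite /= mulVr ?wmx_unit. Qed.
Fact winf_mulrV : right_inverse winf_one winf_inv winf_mul.
Proof. by move=> w; apply/val_inj; rewrite /= mulrV ?wmx_unit. Qed.

HB.instance Definition _ := isGroup.Build Winf
  winf_mulA winf_mul1 winf_mulr1 winf_mulV winf_mulrV.

Fact refl_winfP i : `[< exists u : seq 'Z_6, refl i = refl_word u >].
Proof. by apply/asboolP; exists [:: i]; rewrite /refl_word big_seq1. Qed.

Definition sinf (i : 'Z_6) : Winf := MkWinf (refl_winfP i).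

Fact on_sheet_winf (w : Winf) (x : hplane) : on_sheet (wmx w *m hcoord x).
Proof.
have [u ->] := wmxP w; rewrite /refl_word; elim: u => [|i u IH].
  by rewrite big_nil mul1mx; case: x.
by rewrite big_cons -mulmxA; exact: on_sheet_refl.
Qed.

Definition winf_act (w : Winf) (x : hplane) : hplane := HPlane (on_sheet_winf w x).

Fact winf_act_1 x : winf_act 1%g x = x.
Proof. by apply/val_inj; rewrite /= mul1mx. Qed.
Fact winf_act_M v w x : winf_act (v * w)%g x = winf_act v (winf_act w x).
Proof. by apply/val_inj; rewrite /= mulmxA. Qed.

Definition winf_action : action Winf hplane := Action winf_act_1 winf_act_M.

Definition hexagon : set hplane :=
  [set x | forall i, mink (side_normal i) x <= 0].

Definition hexagon_side (i : 'Z_6) : set hplane :=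
  [set x | hexagon x /\ mink (side_normal i) x = 0].

Definition tau_inf : tesselation hplane :=
  [set map_tile (winf_act w) (\det (wmx w) == 1) (Tile hexagon hexagon_side true)
  | w in [set: Winf]].

Section Level.
Variable k : nat.

Definition Nsub : subgroup Winf :=
  generated [set g | exists (i : 'Z_6) (w : Winf),
                       g = (w * (sinf i * sinf (i + 2)%R) ^+ k * w^-1)%g].

Fact Nsub_conj g x : sg_set Nsub x -> sg_set Nsub (g * x * g^-1)%g.
Proof.
move=> Nx; have := Nx [set y | sg_set Nsub (g * y * g^-1)%g]; apply; split.
  split=> /= [|y z Ny Nz]; first by rewrite mulg1 mulgV; exact: (sg_1 Nsub).
  have -> : (g * (y / z) * g^-1 = (g * y * g^-1) / (g * z * g^-1))%g.
    by rewrite !invgM !invgK !mulgA mulgVK.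
  exact: (@sg_div _ Nsub).
move=> _ [i [w ->]] /= S [_]; apply; exists i, (g * w)%g.
by rewrite invgM !mulgA.
Qed.

Definition Nk : normal_subgroup Winf := NormalSubgroup Nsub_conj.

Definition Wk : groupType := quotient_group Nk.

Definition sgen (i : 'Z_6) : Wk := coset Nk (sinf i).

Fact word_exists (w : Wk) :
  exists n, `[< exists u : seq 'Z_6, size u = n /\ w = (\prod_(i <- u) sgen i)%g >].
Proof.
have [u Eu] := wmxP (repr w); exists (size u); apply/asboolP; exists u; split=> //.
rewrite -(coset_repr w); have -> : repr w = (\prod_(i <- u) sinf i)%g.
  apply/val_inj; rewrite /= Eu /refl_word; elim: (u) => [|i v IH].
    by rewrite !big_nil.
  by rewrite !big_cons /= IH.
elim: (u) => [|i v IH]; first by rewrite !big_nil.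
by rewrite !big_cons -IH; symmetry; exact: qmulE.
Qed.

Definition wordlen (w : Wk) : nat := ex_minn (word_exists w).

Definition wball (n : nat) : set Wk := [set w | (wordlen w <= n)%N].

(* eps is the homomorphism to {1, -1} with value -1 on every generator: see
   eps_coset, eps_gen and epsM. *)
Definition eps (w : Wk) : R := \det (wmx (repr w)).

Fact det_Nsub x : sg_set Nsub x -> \det (wmx x) = 1.
Proof.
move=> Nx; apply: (Nx [set y : Winf | \det (wmx y) = 1]); split.
  split=> [|y z /= Dy Dz]; first by rewrite /= det1.
  by rewrite det_mulmx det_inv Dy Dz invr1 mulr1.
have detM (u v : Winf) : \det (wmx (u * v)%g) = \det (wmx u) * \det (wmx v).
  exact: det_mulmx.
move=> _ [i [w ->]] /=; rewrite [LHS]det_mulmx [\det (wmx w^-1)%g]det_inv.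
rewrite [X in X / _]detM mulrAC divff ?mul1r; last first.
  by rewrite -unitfE -[_ \is a _]/(wmx w \in unitmx); exact: wmx_unit.
elim: k => [|n IH]; first by rewrite /= det1.
by rewrite expgS !detM IH !det_refl mulr1 mulrNN mulr1.
Qed.

Lemma eps_coset g : eps (coset Nk g) = \det (wmx g).
Proof.
have /cosetP[m Nm Em] := coset_repr (coset Nk g).
by rewrite -[in RHS]Em [RHS]det_mulmx det_Nsub // mul1r.
Qed.

Lemma eps_gen i : eps (sgen i) = -1.
Proof. by rewrite eps_coset det_refl. Qed.

Lemma epsM v w : eps (v * w)%g = eps v * eps w.
Proof.
rewrite -(coset_repr v) -(coset_repr w) [(_ * _)%g]qmulE !eps_coset.
exact: det_mulmx.
Qed.

Definition Wplus : set Wk := [set w | eps w = 1].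

Definition Hk := orbit_space winf_action Nk.

Definition Hk_action : action Wk Hk := quotient_action Nk winf_action.

Definition Hk_dist : Hk -> Hk -> R := quotient_dist hdist (orbit winf_action Nk).

Definition tau_k : tesselation Hk := induced (orbit winf_action Nk) tau_inf.

Variable H : subgroup Wk.

Definition HkH := orbit_space Hk_action H.

Definition HkH_dist : HkH -> HkH -> R := quotient_dist Hk_dist (orbit Hk_action H).

Definition tau_H : tesselation HkH := induced (orbit Hk_action H) tau_k.

End Level.
End Hyperbolic.

Arguments Wplus R k _ : clear implicits.
Arguments wball {R k} n _.
Arguments HkH_dist {R k} H _ _.
Arguments tau_H {R k} H _.

(* Main.v *)
Require Import Defs.
From mathcomp Require Import all_boot all_order all_algebra generic_quotient.
From mathcomp Require Import all_classical all_reals all_analysis.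
From mathcomp Require Import ring lra zify.

(* The reflecting lines of W(infinity) are encoded by their unit normals, the
   walls.  They lie in a lattice on which the Minkowski form takes integral
   values and which has no isotropic vector; hence two distinct lines are either
   orthogonal or at distance at least L = arcosh 2, and among three lines
   crossing a segment two are at distance at least L.  A segment crossing
   2 j + 1 lines therefore has length at least j L.

   Let Gamma be the preimage of H in W(infinity) and g in Gamma a translation
   of length l along a geodesic c.  If g is not in N(k), then c crosses more than
   4 k lines along a period, so l >= 2 k L.  If g is in N(k), then along a period
   c crosses each class of lines modulo N(k) an even number of times, so it leaves
   a line, meets another line of the same class and comes back to a translate of
   the first: it suffices that distinct lines of the same class are at distance
   at least k L.  Consider two such lines at minimal distance D.  The product of
   the two reflections is a translation of length 2 D in N(k); minimality forces
   every line crossing its axis to be orthogonal to the axis, so that the axis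
   carries a side of the tesselation or joins the midpoints of opposite sides of
   its hexagons.  The homomorphisms from W(k) to dihedral groups, which exist
   because k is even, exclude the second case and give D >= k L in the first.

   Finally, the closed geodesics of the surface lift to translation axes of
   elements of Gamma, and are essential because Gamma acts freely. *)

Set Implicit Arguments.
Unset Strict Implicit.
Unset Printing Implicit Defensive.

Import Order.TTheory GRing.Theory Num.Theory numFieldNormedType.Exports.

Local Open Scope classical_set_scope.
Local Open Scope ring_scope.

(* [lra] fails on a context containing an equation between vectors or words. *)
Ltac vlra := repeat match goal with
  | H : @eq (matrix _ _ _) _ _ |- _ => clear H
  | H : @eq (ordinal _) _ _ |- _ => clear H
  | H : @eq (list _) _ _ |- _ => clear H
  end; lra.

(** * The Minkowski form *)

Section Minkowski.
Variable R : realType.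
Implicit Types (x y z v : 'cV[R]_3) (a b : R).

(** [N(k)] is a normal closure inside a matrix group, so constraining its elements requires
    homomorphisms out of W(k). They are built as actions of the six generators on auxiliary sets:
    signed reflections (parity of crossings), booleans (type of a wall), the real line and Z/k
    (dihedral groups). That such an action depends only on the matrix of a word is the Coxeter
    presentation of W(infinity). It is proved by geometric deletion: in a right-angled group two
    cancelling letters commute with everything that stands between them.

    Systoles must coincide with curves, so each length bound carries its equality case: length
    [2 k L] forces the axis to lie on a wall. This explains the constant [4 k]. Elements of [H]
    preserve orientation, so a reduced word longer than [4 k] crosses at least [4 k + 2] walls.
    Either one of them contains the axis, and the other [4 k + 1] crossings give length at least
    [2 k L]; or all of them cross it, and the inequality is strict. *)

Definition vol x y z : R :=
  x 0 0 * (y 1 0 * z (2%:R : 'I_3) 0 - y (2%:R : 'I_3) 0 * z 1 0)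
  - x 1 0 * (y 0 0 * z (2%:R : 'I_3) 0 - y (2%:R : 'I_3) 0 * z 0 0)
  + x (2%:R : 'I_3) 0 * (y 0 0 * z 1 0 - y 1 0 * z 0 0).

Lemma cV3_ext x y : x 0 0 = y 0 0 -> x 1 0 = y 1 0 ->
  x (2%:R : 'I_3) 0 = y (2%:R : 'I_3) 0 -> x = y.
Proof.
move=> e0 e1 e2; apply/matrixP => i j; rewrite (ord1 j).
case: i => [[|[|[|//]]]] hi.
- by rewrite (_ : Ordinal hi = 0) //; apply/val_inj.
- by rewrite (_ : Ordinal hi = 1) //; apply/val_inj.
- by rewrite (_ : Ordinal hi = 2%:R) //; apply/val_inj.
Qed.

Lemma minkDl x y z : mink (x + y) z = mink x z + mink y z.
Proof. by rewrite !minkE !mxE; ring. Qed.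
Lemma minkDr x y z : mink z (x + y) = mink z x + mink z y.
Proof. by rewrite !minkE !mxE; ring. Qed.
Lemma minkZl a x z : mink (a *: x) z = a * mink x z.
Proof. by rewrite !minkE !mxE; ring. Qed.
Lemma minkZr a x z : mink z (a *: x) = a * mink z x.
Proof. by rewrite !minkE !mxE; ring. Qed.
Lemma minkNl x z : mink (- x) z = - mink x z.
Proof. by rewrite !minkE !mxE; ring. Qed.
Lemma minkNr x z : mink z (- x) = - mink z x.
Proof. by rewrite !minkE !mxE; ring. Qed.
Lemma minkBl x y z : mink (x - y) z = mink x z - mink y z.
Proof. by rewrite minkDl minkNl. Qed.
Lemma minkBr x y z : mink z (x - y) = mink z x - mink z y.
Proof. by rewrite minkDr minkNr. Qed.

Definition mink_bilE := (minkDl, minkDr, minkBl, minkBr, minkNl, minkNr, minkZl, minkZr).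

(** [vol] is a determinant and [minkJ] has determinant -1, so a product of two determinants is minus
    a Gram determinant. *)
Lemma vol_gram x y (p q t s : 'cV[R]_3) :
  vol x p t * vol y q s =
  - (mink x y * (mink p q * mink t s - mink p s * mink t q)
     - mink x q * (mink p y * mink t s - mink p s * mink t y)
     + mink x s * (mink p y * mink t q - mink p q * mink t y)).
Proof. rewrite !minkE /vol; ring. Qed.

(** The Gram determinant is [- vol x y z ^+ 2]. Signature (2, 1) enters many later estimates through
    this inequality. *)
Lemma gram_le0 x y z :
  mink x x * (mink y y * mink z z - mink y z ^+ 2)
  - mink x y * (mink x y * mink z z - mink y z * mink x z)
  + mink x z * (mink x y * mink y z - mink y y * mink x z) <= 0.
Proof.
have := vol_gram x x y y z z; rewrite (minkC z y) (minkC y x) (minkC z x).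
move=> e; rewrite -oppr_ge0; apply: le_trans (_ : 0 <= vol x y z * vol x y z) _.
  by rewrite -expr2 sqr_ge0.
rewrite e le_eqVlt; apply/orP; left; apply/eqP; ring.
Qed.

Lemma mink_nondeg x : (forall y, mink x y = 0) -> x = 0.
Proof.
move=> h; have e (i : 'I_3) := h (delta_mx i 0).
move: (e 0) (e 1) (e 2%:R); rewrite !minkE !mxE /= => e0 e1 e2.
by apply: cV3_ext; rewrite !mxE; lra.
Qed.

Lemma sheet_sqr x : on_sheet x ->
  x 0 0 * x 0 0 = 1 + x 1 0 * x 1 0 + x (2%:R : 'I_3) 0 * x (2%:R : 'I_3) 0.
Proof. by case/andP => /eqP; rewrite minkE => e _; lra. Qed.

Lemma sheet_norm x : on_sheet x -> mink x x = -1.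
Proof. by case/andP => /eqP. Qed.

Lemma sheet_gt0 x : on_sheet x -> 0 < x 0 0.
Proof. by case/andP. Qed.

(** Reversed Cauchy-Schwarz: the spatial part of the product is strictly dominated by its temporal
    part. *)
Lemma causal_lt0 x y : mink y y <= 0 -> 0 < y 0 0 -> on_sheet x -> mink y x < 0.
Proof.
move=> yy y0 sx; have e := sheet_sqr sx; have x0 := sheet_gt0 sx.
rewrite !minkE in yy *.
move: (x 0 0) (x 1 0) (x (2%:R : 'I_3) 0) (y 0 0) (y 1 0) (y (2%:R : 'I_3) 0) e x0 yy y0
  => X Y Z A B C e X0 yy A0.
have h : (B * Y + C * Z) ^+ 2 < (A * X) ^+ 2.
  apply: le_lt_trans (_ : (B * B + C * C) * (Y * Y + Z * Z) < _).
    rewrite -subr_ge0; apply: le_trans (sqr_ge0 (B * Z - C * Y)) _.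
    by rewrite le_eqVlt; apply/orP; left; apply/eqP; ring.
  have -> : (A * X) ^+ 2 = A * A * (1 + Y * Y + Z * Z) by rewrite -e; ring.
  have h1 : 0 <= Y * Y + Z * Z by nra.
  have h2 : 0 < A * A by rewrite mulr_gt0.
  by nra.
have : `|B * Y + C * Z| < A * X.
  by rewrite -(@ltr_pXn2r _ 2) ?nnegrE ?mulr_ge0 ?(ltW A0) ?(ltW X0) // -normrX ger0_norm ?sqr_ge0.
by rewrite ltr_norml => /andP[_ ?]; lra.
Qed.

Lemma sheet_mink_le x y : on_sheet x -> on_sheet y -> mink x y <= -1.
Proof.
move=> sx sy.
have n : mink x y < 0.
  by apply: causal_lt0 => //; [rewrite sheet_norm // lerN10 | exact: sheet_gt0].
have := sheet_sqr sx; have := sheet_sqr sy; have := sheet_gt0 sx; have := sheet_gt0 sy.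
move: n; rewrite minkE.
move: (x 0 0) (x 1 0) (x (2%:R : 'I_3) 0) (y 0 0) (y 1 0) (y (2%:R : 'I_3) 0) => X Y Z A B C n A0 X0 eA eX.
have h : `|1 + Y * B + Z * C| <= X * A.
  rewrite -(@ler_pXn2r _ 2) ?nnegrE ?mulr_ge0 ?(ltW A0) ?(ltW X0) //.
  rewrite -normrX ger0_norm ?sqr_ge0 // exprMn !expr2 eX eA -subr_ge0.
  rewrite [X in 0 <= X](_ : _ = (Y - B) ^+ 2 + (Z - C) ^+ 2 + (Y * C - Z * B) ^+ 2); last by ring.
  by rewrite !addr_ge0 ?sqr_ge0.
by move: h; rewrite ler_norml => /andP[_ h]; lra.
Qed.

End Minkowski.

(** * The lattice of walls *)

Section Lattice.
Variable R : realType.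
Implicit Types (x y z v : 'cV[R]_3) (p : int * int * int).

(** Expanding [cos (3 t) = -1] gives [(c + 1) * (2 * c - 1) ^+ 2 = 0], and [c] is positive. *)
Lemma cos_pi3 : cos (pi / 3 : R) = 1 / 2.
Proof.
set t : R := pi / 3; have pi0 := pi_gt0 R.
have c0 : 0 < cos t by apply: cos_gt0_pihalf; rewrite /t; lra.
have : cos (t + t *+ 2) = -1 by rewrite -cospi; congr cos; rewrite /t; lra.
rewrite cosD sin_mulr2n cos_mulr2n; have := cos2Dsin2 t.
move: (cos t) (sin t) c0 => c s c0 cs e.
have : (c + 1) * (2 * c - 1) ^+ 2 = 0.
  have -> : (c + 1) * (2 * c - 1) ^+ 2 = c * (c ^+ 2 *+ 2 - 1) - s * ((c * s) *+ 2) + 1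
    + 2 * c * (c ^+ 2 + s ^+ 2 - 1) by ring.
  by rewrite e cs; ring.
move/eqP; rewrite mulf_eq0 expf_eq0 /= => /orP[] /eqP; lra.
Qed.

Lemma sin_pi3 : sin (pi / 3 : R) = Num.sqrt 3 / 2.
Proof.
have pi0 := pi_gt0 R; have := cos2Dsin2 (pi / 3 : R); rewrite cos_pi3 => cs.
have s0 : 0 < sin (pi / 3 : R) by apply: sin_gt0_pi; lra.
apply: (@pexpIrn _ 2) => //; rewrite ?nnegrE ?divr_ge0 ?sqrtr_ge0 ?(ltW s0) //.
rewrite exprMn sqr_sqrtr //; lra.
Qed.

(* Coordinates in which the side normals, the center of the hexagon and their
   images are integral, and the Minkowski form is the integral form zform. *)
Definition lvec p : 'cV[R]_3 :=
  \col_j [:: p.1.1%:~R; Num.sqrt 2 / 2 * (p.2 + 2 * p.1.2)%:~R;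
             Num.sqrt 2 / 2 * Num.sqrt 3 * p.2%:~R]`_j.

(** Minus a square plus the form of the hexagonal lattice A2: the spatial coordinates refer to
    [sqrt 2] times two unit vectors at angle [pi / 3]. *)
Definition zform p p' : int :=
  - (p.1.1 * p'.1.1) + 2 * p.2 * p'.2 + p.2 * p'.1.2 + p'.2 * p.1.2 + 2 * p.1.2 * p'.1.2.

Definition lsub p (c : int) p' := (p.1.1 - c * p'.1.1, p.1.2 - c * p'.1.2, p.2 - c * p'.2).

Definition lnormal (i : 'Z_6) : int * int * int :=
  nth (1, 0, 0) [:: (1, 1, 0); (1, 0, 1); (1, -1, 1); (1, -1, 0); (1, 0, -1); (1, 1, -1)] i.

Lemma mink_lvec p p' : mink (lvec p) (lvec p') = (zform p p')%:~R.
Proof.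
rewrite minkE !mxE /= /zform !rmorphD /= !rmorphN /= !rmorphM /=.
have := sqr_sqrtr (ler0n R 2); have := sqr_sqrtr (ler0n R 3).
move: p p' => [[a q] n] [[a' q'] n'] /=; rewrite -!(rmorphD, rmorphM) /=.
set s2 := Num.sqrt 2; set s3 := Num.sqrt 3; rewrite !rmorphD !rmorphM /=.
move: (a%:~R) (q%:~R) (n%:~R) (a'%:~R) (q'%:~R) (n'%:~R) => A Q N A' Q' N' e3 e2.
transitivity (- (A * A') + s2 ^+ 2 / 4 * (N + 2 * Q) * (N' + 2 * Q')
   + s2 ^+ 2 / 4 * s3 ^+ 2 * (N * N')); first by field.
by rewrite e2 e3; field.
Qed.

Lemma side_normalE i : side_normal R i = lvec (lnormal i).
Proof.
have pi0 := pi_gt0 R.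
have c2 : cos (2 * pi / 3 : R) = - (1 / 2).
  have -> : 2 * pi / 3 = (pi / 3) *+ 2 :> R by lra.
  by rewrite cos_mulr2n cos_pi3; field.
have s2 : sin (2 * pi / 3 : R) = Num.sqrt 3 / 2.
  have -> : 2 * pi / 3 = (pi / 3) *+ 2 :> R by lra.
  by rewrite sin_mulr2n cos_pi3 sin_pi3; field.
apply: cV3_ext; rewrite !mxE /=.
- by case: i => [[|[|[|[|[|[|//]]]]]]] /= _.
- case: i => [[|[|[|[|[|[|//]]]]]]] /= _.
  + by rewrite mul0r mul0r cos0; field.
  + by rewrite mul1r cos_pi3; field.
  + by rewrite c2; field.
  + by rewrite (_ : 3%:R * pi / 3 = pi) ?cospi; [by field|by lra].
  + by rewrite (_ : 4%:R * pi / 3 = pi / 3 + pi) ?cosDpi ?cos_pi3; [by field|by lra].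
  + by rewrite (_ : 5%:R * pi / 3 = 2 * pi / 3 + pi) ?cosDpi ?c2; [by field|by lra].
- case: i => [[|[|[|[|[|[|//]]]]]]] /= _.
  + by rewrite mul0r mul0r sin0; field.
  + by rewrite mul1r sin_pi3; field.
  + by rewrite s2; field.
  + by rewrite (_ : 3%:R * pi / 3 = pi) ?sinpi; [by field|by lra].
  + by rewrite (_ : 4%:R * pi / 3 = pi / 3 + pi) ?sinDpi ?sin_pi3; [by field|by lra].
  + by rewrite (_ : 5%:R * pi / 3 = 2 * pi / 3 + pi) ?sinDpi ?s2; [by field|by lra].
Qed.

Lemma lvec_sub p c p' : lvec p - c%:~R *: lvec p' = lvec (lsub p c p').
Proof.
apply: cV3_ext; rewrite !mxE /= ?(rmorphD, rmorphN, rmorphM, rmorphB) //=.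
- by ring.
- by ring.
Qed.

Lemma refl_lvec i p :
  refl R i *m lvec p = lvec (lsub p (2 * zform (lnormal i) p) (lnormal i)).
Proof.
rewrite refl_mulE side_normalE mink_lvec -lvec_sub; congr (_ - _ *: _).
by rewrite rmorphM.
Qed.

Definition basepoint : 'cV[R]_3 := lvec (1, 0, 0).

Lemma basepointE : [/\ basepoint 0 0 = 1, basepoint 1 0 = 0 & basepoint (2%:R : 'I_3) 0 = 0].
Proof. by split; rewrite !mxE /= ?mulr0. Qed.

Lemma mink_base x : mink x basepoint = - x 0 0.
Proof. by have [e0 e1 e2] := basepointE; rewrite minkE e0 e1 e2; ring. Qed.

Lemma basepoint_sheet : on_sheet basepoint.
Proof. by have [e0 e1 e2] := basepointE; rewrite /on_sheet mink_base e0 ltr01 eqxx. Qed.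

End Lattice.

Lemma int_parity (a : int) : exists b, a = 2 * b \/ a = 2 * b + 1.
Proof. by exists (a %/ 2)%Z; lia. Qed.

(* a^2 = 2 (q^2 + q n + n^2) forces a, q, n to be even, whence an infinite
   descent. *)
Lemma zform_aniso (p : int * int * int) : zform p p = 0 -> p = (0, 0, 0).
Proof.
have [m] := ubnP (`|p.1.1| + `|p.1.2| + `|p.2|)%N; elim: m p => // m IH [[a q] n] /=.
rewrite /zform /= ltnS => le e.
have [b [ab|ab]] := int_parity a; last first.
  have : 2 * (2 * b * b + 2 * b - n * n - n * q - q * q) + 1 = 0 by rewrite ab in e; lia.
  by move: (_ - _) => t; lia.
have [q' [qe|qe]] := int_parity q; have [n' [ne|ne]] := int_parity n.
- have [/eqP z|nz] := boolP ((a, q, n) == (0, 0, 0)); first by rewrite z.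
  have lt : (`|b| + `|q'| + `|n'| < m)%N by move: nz; rewrite !xpair_eqE; lia.
  have := IH (b, q', n') lt; rewrite ab qe ne => IH'.
  have /IH' : zform (b, q', n') (b, q', n') = 0.
    by rewrite ab qe ne in e; rewrite /zform /=; lia.
  by move=> [] -> -> ->; rewrite !mulr0.
- have : 2 * (b * b - 2 * q' * q' - 2 * n' * q' - q' - 2 * n' * n' - 2 * n') = 1.
    by rewrite ab qe ne in e; lia.
  by move: (_ - _) => t; lia.
- have : 2 * (b * b - 2 * q' * q' - 2 * n' * q' - n' - 2 * n' * n' - 2 * q') = 1.
    by rewrite ab qe ne in e; lia.
  by move: (_ - _) => t; lia.
- have : 2 * (b * b - 2 * q' * q' - 2 * n' * q' - 3 * n' - 2 * n' * n' - 3 * q' - 1) = 1.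
    by rewrite ab qe ne in e; lia.
  by move: (_ - _) => t; lia.
Qed.

(** The difference of the two vectors is isotropic, hence zero. Geometrically, no two distinct walls
    are asymptotic. *)
Lemma zform_unit_eq p p' : zform p p = 1 -> zform p' p' = 1 -> zform p p' = 1 -> p = p'.
Proof.
move: p p' => [[a q] n] [[a' q'] n'] e e' d.
have : zform (a - a', q - q', n - n') (a - a', q - q', n - n') = 0.
  by move: e e' d; rewrite /zform /=; lia.
by move/zform_aniso => [] h1 h2 h3; congr (_, _, _); lia.
Qed.

(** * Reflection words, walls and their orientation *)

Section Words.
Variable R : realType.
Implicit Types (x y z v r : 'cV[R]_3) (p : int * int * int) (i j : 'Z_6) (u : seq 'Z_6).

Local Notation O := (basepoint R).
Local Notation n_ i := (side_normal R i).
Local Notation s_ i := (refl R i).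

Definition wallrefl v : 'M[R]_3 := 1 - 2 *: (v *m (v^T *m minkJ R)).

Lemma wallrefl_mul v x : wallrefl v *m x = x - (2 * mink v x) *: v.
Proof.
rewrite /wallrefl mulmxBl mul1mx -scalemxAl -!mulmxA [_^T *m (_ *m _)]mulmxA.
by rewrite [_ *m minkJ R *m x]mx11_scalar mul_mx_scalar scalerA.
Qed.

Lemma wallrefl_normal i : wallrefl (n_ i) = s_ i. Proof. by []. Qed.

Lemma wallreflN v : wallrefl (- v) = wallrefl v.
Proof. by rewrite /wallrefl linearN /= mulNmx mulNmx mulmxN opprK. Qed.

Lemma mx_ext (A B : 'M[R]_3) : (forall x, A *m x = B *m x) -> A = B.
Proof.
move=> h; apply/matrixP => i j; have := h (delta_mx j 0).
rewrite -!colE => /colP/(_ i); by rewrite !mxE.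
Qed.

Lemma mink_word u x y : mink (refl_word R u *m x) (refl_word R u *m y) = mink x y.
Proof.
rewrite /refl_word; elim: u => [|i u IH]; first by rewrite big_nil !mul1mx.
by rewrite big_cons -!mulmxA mink_refl.
Qed.

Lemma mink_wmx (w : Winf R) x y : mink (wmx w *m x) (wmx w *m y) = mink x y.
Proof. by have [u ->] := wmxP w; exact: mink_word. Qed.

Lemma refl_word_cons i u : refl_word R (i :: u) = s_ i * refl_word R u.
Proof. by rewrite /refl_word big_cons. Qed.

Lemma refl_word_nil : refl_word R [::] = 1.
Proof. by rewrite /refl_word big_nil. Qed.

Lemma refl_word_cat u u' : refl_word R (u ++ u') = refl_word R u * refl_word R u'.
Proof. by rewrite /refl_word big_cat. Qed.

Lemma wallrefl_conj u v : refl_word R u * wallrefl v = wallrefl (refl_word R u *m v) * refl_word R u.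
Proof.
apply: mx_ext => x; rewrite -!mulmxA !wallrefl_mul mulmxBr -scalemxAr mink_word.
by [].
Qed.

(* The first coordinate is odd on the whole orbit, so that no wall passes through
   the center of a tile. *)
Definition latt v := exists p b, v = lvec R p /\ p.1.1 = 2 * b + 1.

Lemma latt_base : latt O.
Proof. by exists (1, 0, 0), 0. Qed.

Lemma latt_normal i : latt (n_ i).
Proof.
exists (lnormal i), 0; rewrite side_normalE; split=> //.
by case: i => [[|[|[|[|[|[|//]]]]]]].
Qed.

Lemma latt_refl i v : latt v -> latt (s_ i *m v).
Proof.
move=> [p [b [-> e]]]; rewrite refl_lvec; eexists; eexists; split; first reflexivity.
have -> : (lsub p (2 * zform (lnormal i) p) (lnormal i)).1.1
  = 2 * (b - zform (lnormal i) p) + 1; last by [].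
have h : (lnormal i).1.1 = 1 by case: (i) => [[|[|[|[|[|[|//]]]]]]].
by rewrite /lsub /= e h; lia.
Qed.

Lemma latt_word u v : latt v -> latt (refl_word R u *m v).
Proof.
move=> lv; elim: u => [|i u IH]; first by rewrite refl_word_nil mul1mx.
by rewrite refl_word_cons -mulmxA; exact: latt_refl.
Qed.

(** Walls are oriented: each line occurs with both normals [v] and [- v]. *)
Definition wall v := exists u i, v = refl_word R u *m n_ i.

Lemma wall_normal i : wall (n_ i).
Proof. by exists [::], i; rewrite refl_word_nil mul1mx. Qed.

Lemma wall_word u v : wall v -> wall (refl_word R u *m v).
Proof. by move=> [u' [i ->]]; exists (u ++ u'), i; rewrite refl_word_cat mulmxA. Qed.

Lemma wall_wmx (w : Winf R) v : wall v -> wall (wmx w *m v).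
Proof. by have [u ->] := wmxP w; exact: wall_word. Qed.

Lemma wall_refl i v : wall v -> wall (s_ i *m v).
Proof. by move/(wall_word [:: i]); rewrite refl_word_cons refl_word_nil mulr1. Qed.

Lemma refl_normal i : s_ i *m n_ i = - n_ i.
Proof. by rewrite refl_mulE side_normal_unit mulr1 scaler_nat mulr2n opprD addrA subrr add0r. Qed.

Lemma wallN v : wall v -> wall (- v).
Proof.
move=> [u [i ->]]; exists (rcons u i), i.
by rewrite -cats1 refl_word_cat refl_word_cons refl_word_nil mulr1 -mulmxA refl_normal mulmxN.
Qed.

Lemma wall_unit v : wall v -> mink v v = 1.
Proof. by move=> [u [i ->]]; rewrite mink_word side_normal_unit. Qed.

Lemma wall_latt v : wall v -> latt v.
Proof. by move=> [u [i ->]]; apply/latt_word/latt_normal. Qed.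

Lemma latt_mink v v' : latt v -> latt v' -> exists z : int, mink v v' = z%:~R.
Proof. by move=> [p [_ [-> _]]] [p' [_ [-> _]]]; rewrite mink_lvec; eexists. Qed.

Lemma wall_int v v' : wall v -> wall v' -> exists z : int, mink v v' = z%:~R.
Proof. by move=> /wall_latt lv /wall_latt; exact: latt_mink. Qed.

Lemma latt_base_odd v : latt v -> exists b : int, mink v O = (2 * b + 1)%:~R.
Proof.
move=> [p [b [-> e]]]; exists (- b - 1); rewrite mink_lvec; congr (_%:~R).
by rewrite /zform /= e; lia.
Qed.

Lemma wall_eq1 v v' : wall v -> wall v' -> mink v v' = 1 -> v = v'.
Proof.
move=> wv wv'; have := wall_unit wv; have := wall_unit wv'.
have [p [_ [-> _]]] := wall_latt wv; have [p' [_ [-> _]]] := wall_latt wv'.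
rewrite !mink_lvec => /(intr_inj (x2:=1)) e' /(intr_inj (x2:=1)) e /(intr_inj (x2:=1)) d.
by congr lvec; exact: zform_unit_eq.
Qed.

Lemma wall_eqN1 v v' : wall v -> wall v' -> mink v v' = -1 -> v = - v'.
Proof.
move=> wv wv' e; apply: wall_eq1 => //; first exact: wallN.
by rewrite minkNr e opprK.
Qed.

(** Products of walls are integers, so nothing lies strictly between 1 and [2 = ch L]; this gap
    produces the distance [L]. *)
Lemma wall_cases v v' : wall v -> wall v' ->
  [\/ v = v', v = - v', mink v v' = 0 | 2 <= `|mink v v'| ].
Proof.
move=> wv wv'; have [z e] := wall_int wv wv'.
have [z1|[z1|[z1|z2]]] : z = 1 \/ z = -1 \/ z = 0 \/ 2 <= `|z| by lia.
- by constructor 1; apply: wall_eq1 => //; rewrite e z1.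
- by constructor 2; apply: wall_eqN1 => //; rewrite e z1.
- by constructor 3; rewrite e z1.
- by constructor 4; rewrite e -intr_norm (ler_int _ 2).
Qed.

(** Normals pointing away from the base tile, like the [side_normal i]; this selects one normal per
    line. *)
Definition pos v := mink v O < 0.

Lemma pos_le v : latt v -> pos v -> mink v O <= -1.
Proof.
move=> /latt_base_odd[b]; rewrite /pos => ->.
by rewrite ltrz0 (ler_int _ _ (-1)); lia.
Qed.

Lemma npos_ge v : latt v -> ~~ pos v -> 1 <= mink v O.
Proof.
move=> /latt_base_odd[b]; rewrite /pos => ->.
by rewrite ltrz0 (ler_int _ 1); lia.
Qed.

Lemma posN v : latt v -> pos (- v) = ~~ pos v.
Proof.
move=> lv; have := pos_le lv; have := npos_ge lv; rewrite /pos minkNl oppr_lt0.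
by case: ltrP => h; case: ltrP => // h' a b; [have := b isT | have := a isT]; lra.
Qed.

Lemma normal_base i : mink (n_ i) O = -1.
Proof. by rewrite mink_base mxE. Qed.

Lemma pos_normal i : pos (n_ i).
Proof. by rewrite /pos normal_base ltrN10. Qed.

Lemma normal_mink i j : i != j ->
  [\/ mink (n_ i) (n_ j) = -3, mink (n_ i) (n_ j) = -2
    | mink (n_ i) (n_ j) = 0 /\ (j = i + 1 \/ i = j + 1)].
Proof.
rewrite !side_normalE mink_lvec.
have -> : (-3 : R) = (-3)%:~R by []. have -> : (-2 : R) = (-2)%:~R by [].
case: i => [[|[|[|[|[|[|//]]]]]] hi]; case: j => [[|[|[|[|[|[|//]]]]]] hj] // _;
  try (by constructor 1); try (by constructor 2); constructor 3; split=> //;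
  try (by left; apply/val_inj); by right; apply/val_inj.
Qed.

Lemma normal_inj i j : n_ i = n_ j -> i = j.
Proof.
move=> e; apply/eqP/negP => /negP /normal_mink; rewrite e side_normal_unit => {e}.
by case=> [h|h|[h _]]; lra.
Qed.

Lemma refl_base i : s_ i *m O = O + 2 *: n_ i.
Proof. by rewrite refl_mulE normal_base mulrN1 scaleNr opprK. Qed.

Lemma reflKv i x : s_ i *m (s_ i *m x) = x.
Proof. by rewrite mulmxA (_ : s_ i *m s_ i = 1) ?mul1mx //; exact: reflK. Qed.

Lemma mink_reflC i x y : mink (s_ i *m x) y = mink x (s_ i *m y).
Proof. by rewrite -(mink_refl i) reflKv. Qed.

(* The only wall separating O from its image by s_i is the side i. *)
Lemma pos_refl r i : wall r -> pos r -> r <> n_ i -> pos (s_ i *m r).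
Proof.
move=> wr pr ne; have [b eb] := latt_base_odd (wall_latt wr).
have [g eg] := wall_int (wall_normal i) wr.
have := gram_le0 O (n_ i) r.
rewrite (sheet_norm (basepoint_sheet R)) side_normal_unit (wall_unit wr).
rewrite !(minkC O) normal_base eb eg.
have : pos r by []. rewrite /pos mink_reflC refl_base minkDr minkZr (minkC r (n_ i)) eb eg.
move=> b0 G; rewrite ltrz0 in b0.
have {}G : - (1 - g ^+ 2) + (- 1 - g * (2 * b + 1)) - (2 * b + 1) * (g + (2 * b + 1)) * -1 * -1 <= 0 :> int.
  rewrite -(ler_int R); move: G; rewrite !(rmorphD, rmorphM, rmorphN, rmorphXn) /=.
  by move=> G; nra.
have -> : 2 * (g%:~R : R) = (2 * g)%:~R by rewrite rmorphM.
(* Were the product nonnegative, the integral Gram inequality [G] would leave only [b = -1] and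
   [g = 1], that is, [r = n_ i]. *)
rewrite -rmorphD ltrz0; have [//|h] := ltrP (2 * b + 1 + 2 * g) 0.
have b1 : b = -1 by nia.
have g1 : g = 1 by rewrite b1 in G; nia.
by case: ne; symmetry; apply: wall_eq1 => //; [exact: wall_normal | rewrite eg g1].
Qed.

End Words.

(** * Reduced words *)

Section Reduction.
Variable R : realType.
Implicit Types (x y z v r : 'cV[R]_3) (i j : 'Z_6) (u : seq 'Z_6).

Local Notation O := (basepoint R).
Local Notation n_ i := (side_normal R i).
Local Notation s_ i := (refl R i).
Local Notation rw u := (refl_word R u).

(** The walls crossed in turn by the gallery of tiles that [u] spells from the base tile, each with
    the normal pointing out of the tile being left. *)
Fixpoint crossings u : seq 'cV[R]_3 :=
  if u is i :: w then n_ i :: map (mulmx (s_ i)) (crossings w) else [::].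

(** Galleries crossing no wall twice: if wall [i] were crossed again, the rest of the gallery, moved
    back by [s_ i] to start at the base tile, would cross [n_ i]. *)
Fixpoint reduced u : bool :=
  if u is i :: w then reduced w && (n_ i \notin crossings w) else true.

Lemma crossings_wall u v : v \in crossings u -> wall v.
Proof.
elim: u v => //= i u IH v; rewrite inE => /predU1P[->|/mapP[w /IH ww ->]].
  exact: wall_normal.
exact: wall_refl.
Qed.

Lemma mem_refl_map i v (s : seq 'cV[R]_3) : (v \in map (mulmx (s_ i)) s) = (s_ i *m v \in s).
Proof.
by rewrite -{1}[v](@reflKv R i) mem_map // => a b /(congr1 (mulmx (s_ i))); rewrite !reflKv.
Qed.

Lemma crossings_cat u u' : crossings (u ++ u') = crossings u ++ map (mulmx (rw u)) (crossings u').
Proof.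
elim: u => [|i u IH] /=.
  by rewrite -[LHS]map_id; apply: eq_map => v; rewrite refl_word_nil mul1mx.
rewrite IH map_cat -map_comp; congr (_ :: _ ++ _); apply: eq_map => v /=.
by rewrite refl_word_cons mulmxA.
Qed.

Lemma reduced_cat u u' : reduced (u ++ u') -> reduced u.
Proof.
elim: u => //= i u IH /andP[/IH -> /=].
by rewrite crossings_cat mem_cat negb_or => /andP[].
Qed.

Lemma root_split u v : v \in crossings u ->
  exists u1 j u2, u = u1 ++ j :: u2 /\ v = rw u1 *m n_ j.
Proof.
elim: u v => //= i u IH v; rewrite inE => /predU1P[->|].
  by exists [::], i, u; rewrite refl_word_nil mul1mx.
rewrite mem_refl_map => /IH[u1 [j [u2 [-> e]]]].
exists (i :: u1), j, u2; split=> //.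
by rewrite refl_word_cons -mulmxA -e reflKv.
Qed.

(** Removing the first letter replaces [v] by [s_ i *m v], which is still positive by [pos_refl]. *)
Lemma reduced_neg u v : reduced u -> wall v -> pos v -> v \notin crossings u ->
  mink v (rw u *m O) < 0.
Proof.
elim: u v => [|i u IH] v /=; first by rewrite refl_word_nil mul1mx.
move=> /andP[ru ni] wv pv; rewrite inE negb_or => /andP[/eqP ne].
rewrite mem_refl_map => nr; rewrite refl_word_cons -mulmxA -mink_reflC.
by apply: IH => //; [exact: wall_refl | exact: pos_refl].
Qed.

Lemma mink_word_base u v : wall v -> exists b : int, mink v (rw u *m O) = (2 * b + 1)%:~R.
Proof.
move=> wv; rewrite -(mink_word (rev u)) mulmxA.
rewrite (_ : rw (rev u) *m rw u = 1) ?mul1mx; last exact: refl_word_rev.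
exact/latt_base_odd/latt_word/wall_latt.
Qed.

(** A crossed wall separates the two end tiles; the bound 1 comes from the oddness of products with
    tile centers. *)
Lemma reduced_pos u v : reduced u -> v \in crossings u -> pos v /\ 1 <= mink v (rw u *m O).
Proof.
elim: u v => //= i u IH v /andP[ru ni]; rewrite inE => /predU1P[->|].
  split; first exact: pos_normal.
  rewrite refl_word_cons -mulmxA -mink_reflC refl_normal minkNl.
  have := reduced_neg ru (wall_normal R i) (pos_normal R i) ni.
  have [b ->] := mink_word_base u (wall_normal R i).
  by rewrite -rmorphN ltrz0 (ler_int _ 1); lia.
rewrite mem_refl_map => h; have [p1 p2] := IH _ ru h.
have w1 := crossings_wall h; rewrite -[v](@reflKv R i); split.
  by apply: pos_refl => // e; move: ni; rewrite -e h.
by rewrite refl_word_cons -mulmxA mink_refl.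
Qed.

Lemma reduced_uniq u : reduced u -> uniq (crossings u).
Proof.
elim: u => //= i u IH /andP[ru ni]; apply/andP; split; last first.
  by rewrite map_inj_uniq ?IH // => a b /(congr1 (mulmx (s_ i))); rewrite !reflKv.
rewrite mem_refl_map refl_normal; apply/negP => h.
have [] := reduced_pos ru h; rewrite posN ?pos_normal //.
exact: latt_normal.
Qed.

Section Presentation.
Variables (X : Type) (f : 'Z_6 -> X -> X).
Hypotheses (fK : forall i (x : X), f i (f i x) = x)
  (fC : forall i (x : X), f i (f (i + 1) x) = f (i + 1) (f i x)).

(** The wall [n_ i] borders both the first and the last tile of the gallery. This forces every
    letter of [u] to be adjacent to [i], so that [i] can be moved through [u] and cancelled with
    [j]. *)
Lemma reduced_commute u i j : reduced u -> rw u *m n_ j = n_ i ->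
  forall x : X, f i (foldr f (f j x) u) = foldr f x u.
Proof.
elim: u i j => [|l u IH] i j /=.
  by rewrite refl_word_nil mul1mx => _ /normal_inj -> x.
move=> /andP[ru nl] e x.
have ei : mink (n_ i) (rw (l :: u) *m O) = -1 by rewrite -e mink_word normal_base.
have [_ el] : pos (n_ l) /\ 1 <= mink (n_ l) (rw (l :: u) *m O).
  by apply: reduced_pos; rewrite /= ?ru ?nl // mem_head.
have il : i != l by apply/eqP => il; rewrite il in ei; vlra.
(* At the center of the last tile [n_ l] takes a value at least 1 and [n_ i] the value -1, so
   [n_ i + n_ l] is nonnegative there. If [g <= -1], this sum is causal and future-directed, hence
   negative on the sheet. *)
have causal g : mink (n_ i) (n_ l) = g -> -1 < g.
  move=> eg; rewrite ltNge; apply/negP => g1.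
  have sx : on_sheet (rw (l :: u) *m O).
    exact: (on_sheet_winf (MkWinf (ssrbool.introT (asboolP _) (ex_intro _ (l :: u) erefl))) (HPlane (basepoint_sheet R))).
  have := @causal_lt0 R _ (n_ i + n_ l) _ _ sx.
  rewrite !mink_bilE !side_normal_unit (minkC (n_ l) (n_ i)) eg ei.
  have -> : (n_ i + n_ l) 0 0 = 2 by rewrite !mxE.
  move=> h; have : -1 + mink (n_ l) (rw (l :: u) *m O) < 0 by apply: h; vlra.
  by vlra.
have cil (x' : X) : f i (f l x') = f l (f i x').
  have [/causal h|/causal h|[_ [->|->]]] := normal_mink R il; [exfalso; vlra|exfalso; vlra| |].
    by rewrite fC.
  by rewrite fC.
rewrite cil; congr f; apply: IH => //.
have -> : rw u *m n_ j = s_ l *m (rw (l :: u) *m n_ j) by rewrite refl_word_cons -mulmxA reflKv.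
rewrite e refl_mulE.
have [/causal h|/causal h|[e0 _]] := normal_mink R il; [exfalso; vlra|exfalso; vlra| ].
by rewrite minkC e0 mulr0 scale0r subr0.
Qed.

(** The deletion condition: if the rest of the word already crosses wall [i], the letter [j]
    crossing it cancels with [i], in the matrices by conjugation and in the action by
    [reduced_commute]. *)
Lemma reduce u : exists u', [/\ reduced u', rw u' = rw u, (size u' <= size u)%N &
  forall x : X, foldr f x u' = foldr f x u].
Proof.
have [m] := ubnP (size u); elim: m u => // m IH [|i u]; first by exists [::].
rewrite ltnS => le; have [w [rdw ew sw fw]] := IH u le.
have [inr|nir] := boolP (n_ i \in crossings w); last first.
  exists (i :: w); split=> [/=|||x /=]; rewrite ?rdw ?fw //.
  by rewrite !refl_word_cons ew.
have [u1 [j [u2 [ew' en]]]] := root_split inr.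
have [|w' [rw' e' s' f']] := IH (u1 ++ u2).
  by rewrite size_cat; move: sw le; rewrite ew' size_cat /=; lia.
exists w'; split=> // [||x].
- rewrite e' refl_word_cons -ew ew' !refl_word_cat refl_word_cons.
  rewrite !mulrA; congr (_ * _).
  rewrite -[s_ j]wallrefl_normal -[_ * _ * _]mulrA wallrefl_conj -en wallrefl_normal.
  by rewrite mulrA reflK mul1r.
- by move: sw s'; rewrite ew' !size_cat /=; lia.
- rewrite f' /= -fw ew' !foldr_cat /= reduced_commute //.
  by apply: (@reduced_cat _ (j :: u2)); rewrite -ew'.
Qed.

Lemma foldrK u (x : X) : foldr f (foldr f x (rev u)) u = x.
Proof.
elim: u x => // i u IH x; rewrite rev_cons -cats1 foldr_cat /= IH; exact: fK.
Qed.

Lemma reduced1 u : reduced u -> rw u = 1 -> u = [::].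
Proof.
case: u => // i u ru e; have [_] := reduced_pos ru (mem_head _ _).
by rewrite e mul1mx normal_base => h; exfalso; vlra.
Qed.

(* The presentation of W(infinity): its Coxeter relations are the commutations
   of adjacent reflections. *)
Lemma presentation u u' (x : X) : rw u = rw u' -> foldr f x u = foldr f x u'.
Proof.
move=> e; have [w [rdw ew _ fw]] := reduce (rev u ++ u').
have ew1 : w = [::].
  by apply: reduced1 => //; rewrite ew refl_word_cat -e refl_word_rev.
have := fw x; rewrite ew1 foldr_cat /= => ex.
by rewrite {1}ex foldrK.
Qed.

End Presentation.

End Reduction.

(** * The tesselation of the hyperbolic plane *)

Section Chamber.
Variable R : realType.
Implicit Types (x y z v r : 'cV[R]_3) (i j : 'Z_6) (u : seq 'Z_6).

Local Notation O := (basepoint R).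
Local Notation n_ i := (side_normal R i).
Local Notation s_ i := (refl R i).
Local Notation rw u := (refl_word R u).

Definition chamber x : Prop := forall i, mink (n_ i) x <= 0.

Lemma on_sheet_word u x : on_sheet x -> on_sheet (rw u *m x).
Proof.
move=> sx; elim: u => [|i u IH]; first by rewrite refl_word_nil mul1mx.
by rewrite refl_word_cons -mulmxA; exact: on_sheet_refl.
Qed.

Lemma rw_revK u x : rw (rev u) *m (rw u *m x) = x.
Proof. by rewrite mulmxA (_ : _ *m rw u = 1) ?mul1mx //; exact: refl_word_rev. Qed.

Lemma rw_revVK u x : rw u *m (rw (rev u) *m x) = x.
Proof. by rewrite -{1}[u]revK rw_revK. Qed.

Lemma mink_revl u x y : mink (rw (rev u) *m x) y = mink x (rw u *m y).
Proof. by rewrite -(mink_word u) rw_revVK. Qed.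

(* The squares of the products of v with three consecutive side normals would
   otherwise add up to less than they do. *)
Lemma pos_obtuse v : wall v -> pos v -> exists i, 0 < mink v (n_ i).
Proof.
move=> wv pv; apply: contrapT => no.
have {}no i : mink v (n_ i) <= 0 by rewrite leNgt; apply/negP => h; apply: no; exists i.
move: (wall_unit wv) pv; rewrite /pos; have [[[a q] n] [_ [ev _]]] := wall_latt wv.
have h i : zform (a, q, n) (lnormal i) <= 0.
  by have := no i; rewrite ev side_normalE mink_lvec (ler_int _ _ 0).
rewrite ev !mink_lvec => /(intr_inj (x2:=1)); rewrite ltrz0 /zform /= => e a0.
have := h (Ordinal (isT : (0 < 6)%N)); have := h (Ordinal (isT : (1 < 6)%N)).
have := h (Ordinal (isT : (2 < 6)%N)); have := h (Ordinal (isT : (3 < 6)%N)).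
have := h (Ordinal (isT : (4 < 6)%N)); have := h (Ordinal (isT : (5 < 6)%N)).
rewrite /zform /= => h5 h4 h3 h2 h1 h0.
have k0 : (n + 2 * q) ^+ 2 <= a ^+ 2 by nia.
have k1 : (2 * n + q) ^+ 2 <= a ^+ 2 by nia.
have k2 : (n - q) ^+ 2 <= a ^+ 2 by nia.
by nia.
Qed.

Lemma meet_mink_le1 v v' x : on_sheet x -> mink v v = 1 -> mink v' v' = 1 ->
  mink v x = 0 -> mink v' x = 0 -> `|mink v v'| <= 1.
Proof.
move=> sx e e' vx vx'; have := gram_le0 x v v'.
rewrite (sheet_norm sx) e e' !(minkC x) vx vx' => h.
rewrite -(@ler_pXn2r _ 2) ?nnegrE // real_normK ?num_real // expr1n; lra.
Qed.

(** Induction on the product with the center: a positive wall that is not a side is a smaller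
    positive wall plus a positive multiple of some [n_ i], both nonpositive on the chamber. Equality
    would put [x] on two sides with product at most -2, which do not meet. *)
Lemma chamber_pos v x : wall v -> pos v -> on_sheet x -> chamber x ->
  mink v x <= 0 /\ (mink v x = 0 -> exists i, v = n_ i).
Proof.
move=> wv pv sx cx.
have [m] := ubnP `|Num.floor (mink v O)|%N; elim: m v wv pv => // m IH v wv pv.
rewrite ltnS => le; have [[i ->]|no] := pselect (exists i, v = n_ i).
  by split; [exact: cx | exists i].
have [i vi] := pos_obtuse wv pv.
have ne : v <> n_ i by move=> e; apply: no; exists i.
have vi2 : 2 <= mink v (n_ i).
  have [//|e|e|] := wall_cases wv (wall_normal R i).
  - by move: vi; rewrite e minkNl side_normal_unit; vlra.
  - by move: vi; rewrite e; vlra.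
  - by rewrite gtr0_norm.
have p' := pos_refl wv pv ne; have w' := wall_refl i wv.
have e' : s_ i *m v = v - (2 * mink v (n_ i)) *: n_ i by rewrite refl_mulE minkC.
have [|l1 l2] := IH _ w' p'.
  apply: leq_trans le; have [g eg] := wall_int wv (wall_normal R i).
  have [b eb] := latt_base_odd (wall_latt wv).
  move: p' pv; rewrite /pos e' minkBl minkZl normal_base eb eg.
  rewrite (_ : (2 * b + 1)%:~R - 2 * g%:~R * -1 = (2 * b + 1 + 2 * g)%:~R :> R); last first.
    by rewrite !rmorphD !rmorphM /=; ring.
  rewrite !ltrz0 !intrKfloor; rewrite eg (ler_int _ 2) in vi2; lia.
move: l1 l2; rewrite e' minkBl minkZl => l1 l2; have ci := cx i.
split; first by nra.
move=> v0; have n0 : mink (n_ i) x = 0 by nra.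
have [|j ej] := l2; first by rewrite v0 n0; ring.
have sj : v = s_ i *m n_ j by rewrite -ej -e' reflKv.
have ij : mink (n_ i) (n_ j) <= -2.
  by have := mink_refl i (n_ i) (n_ j); rewrite -sj refl_normal minkNl (minkC _ v) => <-; lra.
have j0 : mink (n_ j) x = 0 by rewrite -ej minkBl minkZl v0 n0; ring.
have := meet_mink_le1 sx (side_normal_unit R i) (side_normal_unit R j) n0 j0.
by rewrite ler_norml => /andP[]; vlra.
Qed.

(** A weak triangle inequality for [ch] of distances, read off a Gram determinant; it leaves
    finitely many tile centers competing to be closest to [x]. *)
Lemma base_coord_bound x y : on_sheet x -> on_sheet y -> y 0 0 <= 2 * x 0 0 * - mink y x.
Proof.
move=> sx sy; have := gram_le0 O x y.
rewrite !(sheet_norm) ?basepoint_sheet // !(minkC O) !mink_base (minkC y x).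
have := sheet_mink_le sx sy; have := sheet_mink_le sx (basepoint_sheet R).
have := sheet_mink_le sy (basepoint_sheet R); rewrite !mink_base.
move: (mink x y) (x 0 0) (y 0 0) => b a c c1 a1 b1 h; rewrite leNgt; apply/negP => h'.
have : c * (2 * a * - b) < c * c by rewrite ltr_pM2l //; lra.
by nra.
Qed.

(* Among the images of O, which are lattice points, one is closest to x. *)
Lemma tiling x : on_sheet x -> exists u, chamber (rw u *m x).
Proof.
move=> sx; set K := 2 * x 0 0 * x 0 0.
have x1 : 1 <= x 0 0 by have := sheet_mink_le sx (basepoint_sheet R); rewrite mink_base; lra.
pose M := (Num.truncn K).+1.
have KM : K < M%:R by apply: truncnS_gt; rewrite /K; nra.
(* [arg_minP] needs a finite type: lattice points in a box, with the last two coordinates shifted by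
   [M] to become natural numbers. *)
pose dec (t : 'I_M * 'I_(2 * M) * 'I_(2 * M)) : int * int * int :=
  ((t.1.1 : nat)%:Z, (t.1.2 : nat)%:Z - M%:Z, (t.2 : nat)%:Z - M%:Z).
have box u : - mink (rw u *m O) x <= x 0 0 -> exists t, rw u *m O = lvec R (dec t).
  move=> h; have sy := on_sheet_word u (basepoint_sheet R).
  have := base_coord_bound sx sy => h2.
  have {}h2 : (rw u *m O) 0 0 < M%:R by apply: le_lt_trans KM; apply: le_trans h2 _; rewrite /K; nra.
  have := sheet_norm sy; have := sheet_gt0 sy.
  have [[[a q] n] [_ [ey _]]] := latt_word u (latt_base R).
  move: h2; rewrite ey mink_lvec !mxE /= -[M%:R]/(M%:Z%:~R) ltr_int ltr0z => h2 a0.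
  rewrite -[-1 : R]/((-1)%:~R) => /intr_inj; rewrite /zform /= => e.
  have q0 : 0 <= (2 * n + q) * (2 * n + q) by rewrite -expr2 sqr_ge0.
  have n0 : 0 <= (2 * q + n) * (2 * q + n) by rewrite -expr2 sqr_ge0.
  have q1 : 3 * (q * q) <= 2 * (a * a) by lia.
  have n1 : 3 * (n * n) <= 2 * (a * a) by lia.
  have qa : `|q| <= a by nia.
  have na : `|n| <= a by nia.
  have la : (`|a| < M)%N by lia.
  have lq : (`|(q + M%:Z)%R| < 2 * M)%N by lia.
  have ln : (`|(n + M%:Z)%R| < 2 * M)%N by lia.
  exists (Ordinal la, Ordinal lq, Ordinal ln); congr lvec; rewrite /dec /=.
  by congr (_, _, _); lia.
pose P t := `[< exists u, rw u *m O = lvec R (dec t) >].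
pose F t := - mink (lvec R (dec t)) x.
have [|t0 et0] := box [::]; first by rewrite refl_word_nil mul1mx minkC mink_base opprK.
have Pt0 : P t0 by apply/asboolP; exists [::].
have [t1 /asboolP[u eu] min] := arg_minP F Pt0.
(* If [x] were beyond side [i] of the tile with closest center, the neighbour across that side would
   have a closer one. *)
exists (rev u) => i; rewrite leNgt; apply/negP => h.
have eF : F t1 = - mink (rw u *m O) x by rewrite eu.
have e0 : F t0 = x 0 0 by rewrite /F -et0 refl_word_nil mul1mx minkC mink_base opprK.
have e1 : - mink (rw (rcons u i) *m O) x < F t1.
  rewrite eF -cats1 refl_word_cat refl_word_cons refl_word_nil mulr1 -mulmxA refl_base.
  rewrite mulmxDr -scalemxAr minkDl minkZl; move: h; rewrite minkC mink_revl minkC; lra.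
have [|t et] := box (rcons u i).
  by apply: ltW; apply: (lt_le_trans e1); rewrite -e0; exact: min.
have : F t1 <= F t by apply: min; apply/asboolP; exists (rcons u i).
by rewrite {2}/F -et leNgt e1.
Qed.

End Chamber.

(** * Walls modulo N(k) *)

Section GroupAction.
Local Open Scope group_scope.
Variables (G : groupType) (a b : G) (k : nat).
Hypotheses (aa : a * a = 1) (bb : b * b = 1) (abk : (a * b) ^+ k = 1).

(** The classical action of a Coxeter generator on signed reflections: conjugate, and change the
    sign when the reflection is the generator itself. The sign then records the parity of wall
    crossings. *)
Definition flip (s : G) (te : G * bool) : G * bool :=
  (s * te.1 * s, te.2 (+) (te.1 == s)).

Lemma flipK te : flip a (flip a te) = te.
Proof.
case: te => t e; rewrite /flip /=; congr pair.
  by rewrite !mulgA aa mul1g -mulgA aa mulg1.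
suff -> : (a * t * a == a) = (t == a) by rewrite -addbA addbb addbF.
apply/eqP/eqP => [|->]; last by rewrite aa mul1g.
by move/(congr1 (fun y => a * y * a)); rewrite !mulgA aa !mul1g -mulgA aa mulg1.
Qed.

Let q := b * a.

Lemma mulq_expg m : b * (a * b) ^+ m = q ^+ m * b.
Proof.
elim: m => [|m IH]; first by rewrite !expg0 mulg1 mul1g.
by rewrite expgS mulgA [b * (a * b)]mulgA -/q -mulgA IH mulgA -expgS.
Qed.

Lemma expq_expg m : q ^+ m * (a * b) ^+ m = 1.
Proof.
elim: m => [|m IH]; first by rewrite !expg0 mulg1.
rewrite expgSr expgS /q !mulgA -[q ^+ m * b * a * a]mulgA aa mulg1.
by rewrite -[_ * b * b]mulgA bb mulg1.
Qed.

Lemma expg_expq m : (a * b) ^+ m * q ^+ m = 1.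
Proof.
elim: m => [|m IH]; first by rewrite !expg0 mulg1.
rewrite expgSr expgS /q !mulgA -[_ * b * b]mulgA bb mulg1.
by rewrite -[_ * a * a]mulgA aa mulg1.
Qed.

(** The sign counts the occurrences of [t] among the reflections [q ^+ j * b] of the dihedral group
    generated by [a] and [b]. *)
Lemma iter_flip m t e : iter m (flip a \o flip b) (t, e) =
  ((a * b) ^+ m * t * q ^+ m, e (+) odd (\sum_(0 <= j < m.*2) (t == (q ^+ j * b)%g))).
Proof.
elim: m => [|m IH]; first by rewrite !expg0 mul1g mulg1 big_geq // addbF.
rewrite iterS IH /flip /= expgS expgSr /q; congr pair; first by rewrite !mulgA.
rewrite doubleS big_nat_recr // big_nat_recr //= -!addbA !oddD !oddb; congr (_ (+) _).
rewrite -addbA; congr (_ (+) _).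
have E x : ((a * b) ^+ m * t * (b * a) ^+ m == x) = (t == q ^+ m * x * (a * b) ^+ m).
  have e1 := expq_expg m.
  have e2 := expg_expq m.
  apply/eqP/eqP => [<-|->]; first by rewrite -/q !mulgA e1 mul1g -mulgA e1 mulg1.
  by rewrite -/q !mulgA e2 mul1g -mulgA e2 mulg1.
congr (_ (+) _).
  by rewrite E -mulgA mulq_expg mulgA -expgnDr addnn.
have -> P : (b * P * b == a) = (P == b * a * b).
  apply/eqP/eqP => [<-|->]; first by rewrite !mulgA bb mul1g -mulgA bb mulg1.
  by rewrite !mulgA bb mul1g -mulgA bb mulg1.
rewrite E -/q; congr (_ == _).
transitivity (q ^+ m * q * (b * (a * b) ^+ m)); first by rewrite /q !mulgA.
by rewrite mulq_expg mulgA -expgSr -expgnDr addSn addnn.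
Qed.

(** For [m = k] the exponents run twice through [0, ..., k - 1] modulo [q ^+ k = 1], so each
    reflection is counted an even number of times. *)
Lemma iter_flip_id te : iter k (flip a \o flip b) te = te.
Proof.
case: te => t e; have qk : q ^+ k = 1.
  by rewrite -[LHS]mulg1 -abk expq_expg.
rewrite iter_flip abk qk mulg1 mul1g; congr pair.
rewrite -addnn (@big_cat_nat _ _ _ k) ?leq_addr //=.
rewrite -{2}[k]add0n big_addn addnK.
rewrite [X in (_ + X)%N](_ : _ = (\sum_(0 <= j < k) (t == (q ^+ j * b)%g))%N); last first.
  by apply: eq_bigr => j _; rewrite expgnDr qk mulg1.
by rewrite addnn odd_double addbF.
Qed.

End GroupAction.

Lemma iter_invol (X : Type) (g : X -> X) k x : (forall y, g (g y) = y) -> ~~ odd k ->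
  iter k g x = x.
Proof.
move=> gK /even_halfK <-; elim: (k./2) => // n IH.
by rewrite doubleS !iterS IH gK.
Qed.

Lemma odd_count_pair (T : eqType) (P : pred T) (s : seq T) x : uniq s -> x \in s -> P x ->
  ~~ odd (count P s) -> exists2 y, y \in s & y != x /\ P y.
Proof.
move=> us xs Px; rewrite (permP (perm_to_rem xs)) /= Px add1n oddS negbK => h.
have /hasP[y] : has P (rem x s) by rewrite has_count; case: (count _ _) h.
by rewrite mem_rem_uniq // inE => /andP[yx ys] Py; exists y.
Qed.

Lemma invol_commute (X : Type) (a b : X -> X) : (forall x, a (a x) = x) ->
  (forall x, b (b x) = x) -> (forall x, a (b (a (b x))) = x) ->
  forall x, a (b x) = b (a x).
Proof. by move=> aK bK h x; rewrite -[in RHS](h x) aK bK. Qed.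

Section Classes.
Variables (R : realType) (k : nat).
Implicit Types (x y z v r : 'cV[R]_3) (i j : 'Z_6) (u : seq 'Z_6) (g w t : Winf R).

Local Notation O := (basepoint R).
Local Notation n_ i := (side_normal R i).
Local Notation s_ i := (refl R i).
Local Notation rw u := (refl_word R u).
Local Notation N := (sg_set (Nk R k)).

Definition winf_word u : Winf R := (\prod_(i <- u) sinf R i)%g.

Lemma wmx_word u : wmx (winf_word u) = rw u.
Proof.
rewrite /winf_word; elim: u => [|i u IH]; first by rewrite big_nil refl_word_nil.
by rewrite big_cons refl_word_cons -IH.
Qed.

Lemma wmxM g w : wmx (g * w)%g = wmx g * wmx w. Proof. by []. Qed.
Lemma wmx1 : wmx (1%g : Winf R) = 1. Proof. by []. Qed.
Lemma wmx_inj g w : wmx g = wmx w -> g = w. Proof. exact: val_inj. Qed.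

Lemma winf_wordP g : exists u, g = winf_word u.
Proof. by have [u e] := wmxP g; exists u; apply: wmx_inj; rewrite wmx_word. Qed.

Lemma winf_word_cat u u' : winf_word (u ++ u') = (winf_word u * winf_word u')%g.
Proof. by apply: wmx_inj; rewrite wmxM !wmx_word refl_word_cat. Qed.

Lemma winf_word_rev u : winf_word (rev u) = (winf_word u)^-1%g.
Proof.
apply: (mulIg (winf_word u)); rewrite mulVg.
by apply: wmx_inj; rewrite wmxM !wmx_word refl_word_rev.
Qed.

Section CoxeterAction.
Variables (X : Type) (f : 'Z_6 -> X -> X).
Hypotheses (fK : forall i (x : X), f i (f i x) = x)
  (fC : forall i (x : X), f i (f (i + 1) x) = f (i + 1) (f i x))
  (fk : forall i (x : X), iter k (f i \o f (i + 2)) x = x).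

(** The universal property of W(k), stated with words. The elements all of whose words act trivially
    form a subgroup containing the generators of [N]; [presentation] makes the choice of word
    irrelevant. *)
Lemma N_acts_trivially g u (x : X) : N g -> wmx g = rw u -> foldr f x u = x.
Proof.
move=> Ng; rewrite -wmx_word => /wmx_inj eg.
apply: (Ng [set h | forall u (x : X), h = winf_word u -> foldr f x u = x]) => //; split.
  split=> [u' x'|h h' /= hh hh'].
    move/(congr1 (@wmx R)); rewrite wmx_word wmx1 => e.
    by rewrite (@presentation R _ _ fK fC u' [::] x') // -e refl_word_nil.
  move=> u' x' e; have [v ev] := winf_wordP h; have [v' ev'] := winf_wordP h'.
  rewrite (@presentation R _ _ fK fC u' (v ++ rev v') x').
    rewrite foldr_cat hh //.
    by have := foldrK fK (rev v') x'; rewrite revK (hh' v' x' ev').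
  by rewrite -!wmx_word -e winf_word_cat winf_word_rev ev ev'.
move=> _ [i [w ->]] u' x' e; have [v ev] := winf_wordP w.
pose c := flatten (nseq k [:: i; i + 2]).
rewrite (@presentation R _ _ fK fC u' (v ++ c ++ rev v) x').
  rewrite foldr_cat foldr_cat.
  suff hc (y : X) : foldr f y c = y by rewrite hc foldrK.
  rewrite -[RHS](fk i) /c; elim: (k) y => //= n IH y; by rewrite IH.
rewrite -!wmx_word -e !winf_word_cat winf_word_rev -ev; congr (wmx _); rewrite -mulgA.
congr (_ * (_ * _))%g; rewrite /c; elim: (k) => [|n IH].
  by rewrite expg0 /winf_word big_nil.
by rewrite expgS IH [RHS]/winf_word /= !big_cons -/(winf_word _) mulgA.
Qed.

End CoxeterAction.

Lemma wallreflK v : mink v v = 1 -> wallrefl v * wallrefl v = 1.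
Proof.
move=> e; apply: mx_ext => x; rewrite -mulmxA !wallrefl_mul mul1mx !mink_bilE e.
by apply: cV3_ext; rewrite !mxE; ring.
Qed.

Lemma wallrefl_word u i : wallrefl (rw u *m n_ i) = rw (u ++ i :: rev u).
Proof.
rewrite refl_word_cat refl_word_cons -wallrefl_normal mulrA wallrefl_conj -mulrA.
by rewrite (_ : rw u * rw (rev u) = 1) ?mulr1 // -{1}[u]revK refl_word_rev.
Qed.

Definition same_class v v' : Prop := exists2 g, N g & wmx g = wallrefl v * wallrefl v'.

(** [s] is the image in W(k) of the reflection in [v]. It is a relation because [wallrefl v] is only
    a matrix until an element of W(infinity) is named. *)
Definition has_class v (s : Wk R k) : Prop := exists2 t, wmx t = wallrefl v & coset (Nk R k) t = s.

Lemma wall_has_class v : wall v -> exists s, has_class v s.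
Proof.
move=> [u [i ->]]; exists (coset (Nk R k) (winf_word (u ++ i :: rev u))).
by exists (winf_word (u ++ i :: rev u)); rewrite ?wmx_word ?wallrefl_word.
Qed.

Lemma has_class_same v v' s : mink v' v' = 1 -> has_class v s -> has_class v' s -> same_class v v'.
Proof.
move=> e' [t et ct] [t' et' ct'].
have /cosetP[n Nn en] : coset (Nk R k) t' = coset (Nk R k) t by rewrite ct ct'.
exists n => //; rewrite -et -en wmxM -et' -mulrA.
by rewrite [X in _ * X](_ : _ = 1) ?mulr1 // et' wallreflK.
Qed.

Lemma cosetM g h : coset (Nk R k) (g * h)%g = (coset (Nk R k) g * coset (Nk R k) h)%g.
Proof. by symmetry; exact: qmulE. Qed.

Lemma has_class_normal i s : has_class (n_ i) s <-> s = sgen R k i.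
Proof.
split=> [[t et <-]|->]; last by exists (sinf R i).
by rewrite /sgen; congr coset; exact: wmx_inj.
Qed.

Lemma sgen_sq i : (sgen R k i * sgen R k i = 1)%g.
Proof.
rewrite -cosetM; congr coset.
by apply: wmx_inj; rewrite wmxM /= reflK.
Qed.

Lemma sgen_conjK i (x : Wk R k) : (sgen R k i * (sgen R k i * x * sgen R k i) * sgen R k i = x)%g.
Proof. by rewrite !mulgA sgen_sq mul1g -mulgA sgen_sq mulg1. Qed.

Lemma has_class_refl i v s :
  has_class (s_ i *m v) (sgen R k i * s * sgen R k i)%g <-> has_class v s.
Proof.
have E v' : wallrefl (s_ i *m v') = s_ i * wallrefl v' * s_ i.
  have := wallrefl_conj [:: i] v'; rewrite refl_word_cons refl_word_nil mulr1 => ->.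
  by rewrite -mulrA reflK mulr1.
have F v' s' : has_class v' s' -> has_class (s_ i *m v') (sgen R k i * s' * sgen R k i)%g.
  move=> [t et ct]; exists (sinf R i * t * sinf R i)%g; first by rewrite !wmxM et E.
  by rewrite -ct !cosetM.
split=> [/F|]; last exact: F.
by rewrite reflKv sgen_conjK.
Qed.

Lemma foldr_flip u (t : Wk R k) e : foldr (fun i => flip (sgen R k i)) (t, e) u =
  (let s := (\prod_(i <- u) sgen R k i * t * (\prod_(i <- u) sgen R k i)^-1)%g in
   (s, e (+) odd (count (fun v => `[< has_class v s >]) (crossings R u)))).
Proof.
elim: u => [|i u IH] /=; first by rewrite big_nil mul1g invg1 mulg1 addbF.
rewrite IH big_cons /flip /=; set W := (\prod_(j <- u) _)%g.
set s := (W * t * W^-1)%g.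
have si : ((sgen R k i)^-1 = sgen R k i)%g by apply: mulg1_eq; exact: sgen_sq.
have -> : (sgen R k i * W * t * (sgen R k i * W)^-1 = sgen R k i * s * sgen R k i)%g.
  by rewrite invgM si /s !mulgA.
congr pair; rewrite oddD oddb -addbA; congr (_ (+) _).
rewrite addbC; congr (_ (+) _).
  rewrite (_ : `[< _ >] = (s == sgen R k i)) //.
  apply/asboolP/eqP => [/has_class_normal|->].
    move/(congr1 (fun y : Wk R k => sgen R k i * y * sgen R k i)%g).
    by rewrite /= sgen_conjK sgen_sq mul1g.
  by apply/has_class_normal; rewrite sgen_sq mul1g.
congr odd; rewrite count_map; apply: eq_count => v /=.
by apply/asboolP/asboolP; rewrite has_class_refl.
Qed.

Lemma coset_winf_word u : coset (Nk R k) (winf_word u) = (\prod_(i <- u) sgen R k i)%g.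
Proof.
elim: u => [|i u IH]; first by rewrite /winf_word !big_nil.
by rewrite big_cons -IH /winf_word big_cons cosetM.
Qed.

Lemma coset_eq1 g : coset (Nk R k) g = 1%g <-> N g.
Proof.
split=> [/cosetP[n Nn e]|Ng].
  by rewrite -(mulKg n g) e mulg1; exact: sg_inv.
by apply/cosetP; exists g^-1%g; [exact: sg_inv | rewrite mulVg].
Qed.

Lemma coset_expg g n : coset (Nk R k) (g ^+ n)%g = (coset (Nk R k) g ^+ n)%g.
Proof.
elim: n => [//|n IH]; by rewrite !expgS -IH cosetM.
Qed.

Lemma sgen_rel2 i : ((sgen R k i * sgen R k (i + 2)) ^+ k = 1)%g.
Proof.
rewrite -cosetM -coset_expg.
apply/coset_eq1 => S [_]; apply; exists i, 1%g.
by rewrite mul1g invg1 mulg1.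
Qed.

Lemma refl_comm i x : s_ i *m (s_ (i + 1) *m x) = s_ (i + 1) *m (s_ i *m x).
Proof.
have e : mink (n_ i) (n_ (i + 1)) = 0.
  rewrite !side_normalE mink_lvec (_ : zform _ _ = 0) //.
  by case: i => [[|[|[|[|[|[|//]]]]]] hi].
rewrite !refl_mulE !mink_bilE (minkC (n_ (i + 1)) (n_ i)) e.
by apply: cV3_ext; rewrite !mxE; ring.
Qed.

Lemma sgen_rel1 i : ((sgen R k i * sgen R k (i + 1)) ^+ 2 = 1)%g.
Proof.
rewrite -cosetM -coset_expg; congr coset.
apply: wmx_inj; rewrite expgS expg1 !wmxM; apply: mx_ext => x.
by rewrite -!mulmxA /= refl_comm !reflKv mul1mx.
Qed.

(* A closed gallery of W(k) crosses every wall of W(k) an even number of times. *)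
Lemma N_crosses_twice g u v : N g -> wmx g = rw u -> reduced R u -> v \in crossings R u ->
  exists2 v', v' \in crossings R u & v' != v /\ same_class v v'.
Proof.
move=> Ng eg ru vu; have [s hs] := wall_has_class (crossings_wall vu).
have eW : (\prod_(i <- u) sgen R k i = 1)%g.
  by rewrite -coset_winf_word; apply/coset_eq1; rewrite (_ : winf_word u = g) //; apply: wmx_inj; rewrite wmx_word.
pose f i := flip (sgen R k i).
have fK i (te : Wk R k * bool) : f i (f i te) = te by exact/flipK/sgen_sq.
have fC i (te : Wk R k * bool) : f i (f (i + 1) te) = f (i + 1) (f i te).
  have h (y : Wk R k * bool) : f i (f (i + 1) (f i (f (i + 1) y))) = y.
    exact: (@iter_flip_id _ _ _ 2 (sgen_sq i) (sgen_sq (i + 1)) (sgen_rel1 i)).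
  exact: invol_commute (fK i) (fK (i + 1)) h te.
have fk i (te : Wk R k * bool) : iter k (f i \o f (i + 2)) te = te.
  exact: (iter_flip_id (sgen_sq i) (sgen_sq (i + 2)) (sgen_rel2 i)).
have := N_acts_trivially fK fC fk (s, false) Ng eg.
rewrite foldr_flip eW mul1g invg1 mulg1 /= => -[].
move=> /negbT ev; have [v' v'u [ne /asboolP hv']] := odd_count_pair (reduced_uniq ru) vu (P := fun v => `[< has_class v s >]) (asboolT hs) ev.
exists v' => //; split=> //; apply: has_class_same hs hv'.
exact/wall_unit/(crossings_wall v'u).
Qed.

End Classes.

(** * Walls along geodesics *)

Section HyperbolicFunctions.
Variable R : realType.
Implicit Types (s t z : R).

Definition ch t : R := (expR t + expR (- t)) / 2.
Definition sh t : R := (expR t - expR (- t)) / 2.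

Lemma ch2_sh2 t : ch t ^+ 2 - sh t ^+ 2 = 1.
Proof.
transitivity (expR t * expR (- t)); last by rewrite -expRD subrr expR0.
by rewrite /ch /sh; field.
Qed.

Lemma chD s t : ch (s + t) = ch s * ch t + sh s * sh t.
Proof. by rewrite /ch /sh opprD !expRD; field. Qed.

Lemma shD s t : sh (s + t) = sh s * ch t + ch s * sh t.
Proof. by rewrite /ch /sh opprD !expRD; field. Qed.

Lemma chN t : ch (- t) = ch t. Proof. by rewrite /ch opprK addrC. Qed.
Lemma shN t : sh (- t) = - sh t. Proof. by rewrite /sh opprK; field. Qed.
Lemma ch0 : ch 0 = 1. Proof. by rewrite /ch oppr0 expR0; field. Qed.
Lemma sh0 : sh 0 = 0. Proof. by rewrite /sh oppr0 expR0; field. Qed.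

Lemma chB s t : ch (s - t) = ch s * ch t - sh s * sh t.
Proof. by rewrite chD chN shN mulrN. Qed.

Lemma shB s t : sh (s - t) = sh s * ch t - ch s * sh t.
Proof. by rewrite shD chN shN mulrN. Qed.

Lemma ch_norm t : ch `|t| = ch t.
Proof. by case: (ger0P t); rewrite ?chN. Qed.

Lemma ch_gt1 t : t != 0 -> 1 < ch t.
Proof.
move=> t0; have e0 := expR_gt0 t; rewrite -subr_gt0.
have -> : ch t - 1 = (expR t - 1) ^+ 2 / (2 * expR t).
  by rewrite /ch expRN; field; rewrite gt_eqF.
apply: divr_gt0; last by rewrite mulr_gt0.
rewrite exprn_even_gt0 //= subr_eq0.
by rewrite -(@expR0 R) (inj_eq (@expR_inj R)).
Qed.

Lemma ch_ge1 t : 1 <= ch t.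
Proof. by have [->|/ch_gt1/ltW//] := eqVneq t 0; rewrite ch0. Qed.

Lemma sh_gt0 t : 0 < t -> 0 < sh t.
Proof.
by move=> t0; rewrite divr_gt0 // subr_gt0 ltr_expR; lra.
Qed.

Lemma sh_neq0 t : t != 0 -> sh t != 0.
Proof.
move=> t0; apply/eqP => e; have := ch2_sh2 t; have := ch_gt1 t0; rewrite e.
nra.
Qed.

Lemma ltr_ch s t : 0 <= s -> s < t -> ch s < ch t.
Proof.
move=> s0 st; have -> : t = s + (t - s) by ring.
rewrite chD; have c1 : 1 < ch (t - s) by apply: ch_gt1; rewrite subr_eq0 gt_eqF.
have h1 : 0 <= sh s by move: s0; rewrite le_eqVlt => /predU1P[<-|/sh_gt0/ltW//]; rewrite sh0.
have h2 : 0 < sh (t - s) by apply: sh_gt0; lra.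
have := ch_ge1 s; nra.
Qed.

Lemma ch_le_norm s t : ch s <= ch t -> `|s| <= `|t|.
Proof.
move=> h; rewrite leNgt; apply/negP => /(ltr_ch (normr_ge0 t)).
by rewrite !ch_norm ltNge h.
Qed.

Lemma ler_ch s t : `|s| <= `|t| -> ch s <= ch t.
Proof.
rewrite le_eqVlt => /predU1P[e|/(ltr_ch (normr_ge0 s))/ltW]; last by rewrite !ch_norm.
by rewrite -ch_norm e ch_norm.
Qed.

Lemma arcosh_ch t : arcosh (ch t) = `|t|.
Proof.
wlog t0 : t / 0 <= t.
  move=> h; have [/h //|t0] := lerP 0 t.
  by rewrite -chN h ?normrN ?ltr0_norm ?ger0_norm; lra.
rewrite /arcosh (_ : ch t ^+ 2 - 1 = sh t ^+ 2); last by rewrite -(ch2_sh2 t); ring.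
have h1 : 0 <= sh t by move: t0; rewrite le_eqVlt => /predU1P[<-|/sh_gt0/ltW//]; rewrite sh0.
rewrite sqrtr_sqr !ger0_norm // (_ : ch t + sh t = expR t) ?expRK //.
by rewrite /ch /sh; field.
Qed.

Lemma ch_arcosh z : 1 <= z -> ch (arcosh z) = z.
Proof.
move=> z1; have h : 0 <= z ^+ 2 - 1 by nra.
have := sqr_sqrtr h; have := sqrtr_ge0 (z ^+ 2 - 1).
rewrite /arcosh; set s := Num.sqrt _ => s0 ss.
have p : 0 < z + s by lra.
rewrite /ch expRN lnK ?posrE //.
have -> : (z + s)^-1 = z - s.
  apply: (mulfI (lt0r_neq0 p)); rewrite divff ?lt0r_neq0 //.
  by move: ss; rewrite !expr2 => ss; lra.
by field.
Qed.

Lemma arcosh_ge0 z : 1 <= z -> 0 <= arcosh z.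
Proof. by move=> /ch_arcosh <-; rewrite arcosh_ch. Qed.

Definition hexlen : R := arcosh 2.

Lemma ch_hexlen : ch hexlen = 2.
Proof. by rewrite ch_arcosh //; lra. Qed.

Lemma hexlen_gt0 : 0 < hexlen.
Proof.
have h : 0 <= hexlen by apply: arcosh_ge0; lra.
rewrite lt_neqAle h andbT; apply/negP => /eqP e.
by have := ch_hexlen; rewrite -e ch0; lra.
Qed.

End HyperbolicFunctions.

Section Frames.
Variable R : realType.
Implicit Types (v x y : 'cV[R]_3) (s t : R).

(** A point with a unit tangent vector, standing for the complete unit-speed geodesic [geo], of
    velocity [gdir]. *)
Record frame := Frame {
  fpt : 'cV[R]_3; fdir : 'cV[R]_3;
  frameP : [/\ on_sheet fpt, mink fdir fdir = 1 & mink fpt fdir = 0] }.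

Implicit Types F : frame.

Definition geo F t := ch t *: fpt F + sh t *: fdir F.
Definition gdir F t := sh t *: fpt F + ch t *: fdir F.
(** The product with a unit normal of the plane of the geodesic, written as a determinant; for a
    wall crossing the geodesic it vanishes exactly at a right angle. *)
Definition ncomp F v := vol v (fpt F) (fdir F).
Definition cross F v t := mink v (geo F t) = 0.
Definition contains F v := mink v (fpt F) = 0 /\ mink v (fdir F) = 0.

Lemma geo0 F : geo F 0 = fpt F.
Proof. by rewrite /geo ch0 sh0 scale1r scale0r addr0. Qed.

Lemma mink_geo F s t : mink (geo F s) (geo F t) = - ch (t - s).
Proof.
have [/sheet_norm pp dd pd] := frameP F.
by rewrite /geo !mink_bilE pp dd (minkC (fdir F)) pd chB; ring.
Qed.

Lemma mink_geo_gdir F s t : mink (geo F s) (gdir F t) = sh (s - t).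
Proof.
have [/sheet_norm pp dd pd] := frameP F.
by rewrite /geo /gdir !mink_bilE pp dd (minkC (fdir F)) pd shB; ring.
Qed.

Lemma mink_gdir F s t : mink (gdir F s) (gdir F t) = ch (t - s).
Proof.
have [/sheet_norm pp dd pd] := frameP F.
by rewrite /gdir !mink_bilE pp dd (minkC (fdir F)) pd chB; ring.
Qed.

Lemma same_sheet x y : on_sheet x -> mink y y = -1 -> mink y x < 0 -> on_sheet y.
Proof.
move=> sx yy yx; rewrite /on_sheet yy eqxx /= ltNge; apply/negP => y0.
have y0' : y 0 0 != 0.
  by apply/eqP => e; move: yy; rewrite minkE e; nra.
have : mink (- y) x < 0.
  by apply: causal_lt0 => //; rewrite ?minkNl ?minkNr ?yy ?mxE; [lra | rewrite oppr_gt0 lt_neqAle y0' y0].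
by rewrite minkNl; lra.
Qed.

Lemma geo_sheet F t : on_sheet (geo F t).
Proof.
have [sp _ _] := frameP F; apply: (same_sheet sp).
  by rewrite mink_geo subrr ch0.
by rewrite -(geo0 F) mink_geo sub0r chN; have := ch_ge1 t; lra.
Qed.

(** Expansion in the orthonormal frame at time [t]: [geo F t] has norm -1, and the normal component
    does not depend on [t]. *)
Lemma parseval F t x y : mink x y = ncomp F x * ncomp F y
  + mink x (gdir F t) * mink y (gdir F t) - mink x (geo F t) * mink y (geo F t).
Proof.
have [/sheet_norm pp dd pd] := frameP F.
rewrite /ncomp vol_gram pp dd (minkC (fdir F) (fpt F)) pd.
rewrite /geo /gdir !mink_bilE (minkC (fpt F) y) (minkC (fdir F) y).
have c := ch2_sh2 t.
have -> : forall a b c d : R, (sh t * a + ch t * b) * (sh t * c + ch t * d)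
  = (ch t * a + sh t * b) * (ch t * c + sh t * d) + (ch t ^+ 2 - sh t ^+ 2) * (b * d - a * c).
  by move=> *; ring.
rewrite c; ring.
Qed.

Lemma containsP F t v : contains F v <-> mink v (geo F t) = 0 /\ mink v (gdir F t) = 0.
Proof.
rewrite /contains /geo /gdir !mink_bilE; split=> [[-> ->]|]; first by split; ring.
have := ch2_sh2 t; move: (mink v (fpt F)) (mink v (fdir F)) => a b c [e1 e2]; split.
  rewrite -[LHS]mul1r -c.
  transitivity (ch t * (ch t * a + sh t * b) - sh t * (sh t * a + ch t * b)); first by ring.
  by rewrite e1 e2; ring.
rewrite -[LHS]mul1r -c.
transitivity (ch t * (sh t * a + ch t * b) - sh t * (ch t * a + sh t * b)); first by ring.
by rewrite e1 e2; ring.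
Qed.

Lemma gdirE F s t : gdir F s = ch (s - t) *: gdir F t + sh (s - t) *: geo F t.
Proof.
rewrite -{1}(subrK t s) /gdir /geo (shD (s - t) t) (chD (s - t) t).
by apply: cV3_ext; rewrite !mxE; ring.
Qed.

Lemma geoE F s t : geo F s = ch (s - t) *: geo F t + sh (s - t) *: gdir F t.
Proof.
rewrite -{1}(subrK t s) /gdir /geo (shD (s - t) t) (chD (s - t) t).
by apply: cV3_ext; rewrite !mxE; ring.
Qed.

Lemma cross_contains F v s t : cross F v s -> cross F v t -> s <> t -> contains F v.
Proof.
rewrite /cross => e1; rewrite (geoE F t s) minkDr !minkZr e1 mulr0 add0r => /eqP.
rewrite mulf_eq0 => /orP[/eqP e st|/eqP e2 _]; last by apply/(containsP F s).
suff : sh (t - s) != 0 by rewrite e eqxx.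
by apply: sh_neq0; rewrite subr_eq0; apply/eqP => ts; apply: st.
Qed.

Lemma cross_mink F v v' s t : cross F v s -> cross F v' t ->
  mink v v' = ncomp F v * ncomp F v'
    + mink v (gdir F s) * mink v' (gdir F t) * ch (t - s).
Proof.
rewrite /cross => e1 e2; rewrite (parseval F s) e1 mul0r subr0 [X in mink v' X](gdirE F s t).
rewrite (minkDr _ _ v') !(minkZr _ _ v') e2 mulr0 addr0 -(opprB t s) chN; ring.
Qed.

Lemma cross_unit F v s : mink v v = 1 -> cross F v s ->
  ncomp F v ^+ 2 + mink v (gdir F s) ^+ 2 = 1.
Proof. by move=> vv cs; have := cross_mink cs cs; rewrite vv subrr ch0 mulr1 !expr2. Qed.

(** A bound on the product with an extra term measuring how far [v'] is from being orthogonal to the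
    geodesic, so that equality in [cross_le] forces right angles. *)
Lemma cross_sqr F v v' s t : mink v v = 1 -> mink v' v' = 1 -> cross F v s -> cross F v' t ->
  mink v v' ^+ 2 + (ch (t - s) ^+ 2 - 1) * ncomp F v' ^+ 2 <= ch (t - s) ^+ 2.
Proof.
move=> vv vv' cs ct; rewrite (cross_mink cs ct).
have := cross_unit vv cs; have := cross_unit vv' ct.
move: (ncomp F v) (ncomp F v') (mink v _) (mink v' _) (ch _) => n n' T T' c e' e.
rewrite -subr_ge0.
have {e'}e' : n' ^+ 2 = 1 - T' ^+ 2 by lra.
have -> : c ^+ 2 - ((n * n' + T * T' * c) ^+ 2 + (c ^+ 2 - 1) * n' ^+ 2)
    = (n * T' * c - T * n') ^+ 2
      + (1 - (n ^+ 2 + T ^+ 2)) * (n' ^+ 2 + T' ^+ 2 * c ^+ 2)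
      + (1 - T' ^+ 2 - n' ^+ 2) * c ^+ 2 by ring.
by rewrite e e' !subrr !mul0r !addr0 sqr_ge0.
Qed.

Lemma cross_le F v v' s t : mink v v = 1 -> mink v' v' = 1 -> cross F v s -> cross F v' t ->
  `|mink v v'| <= ch (t - s).
Proof.
move=> vv vv' cs ct; have := cross_sqr vv vv' cs ct; have c1 := ch_ge1 (t - s) => h.
rewrite -(@ler_pXn2r _ 2) ?nnegrE //; last by lra.
rewrite real_normK ?num_real //; apply: le_trans h.
by rewrite lerDl mulr_ge0 ?sqr_ge0 // subr_ge0 exprn_ege1.
Qed.

Lemma cross_perp F v v' s t : mink v v = 1 -> mink v' v' = 1 -> cross F v s -> cross F v' t ->
  s <> t -> ch (t - s) <= `|mink v v'| -> ncomp F v = 0 /\ ncomp F v' = 0.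
Proof.
move=> vv vv' cs ct st le.
have c1 : 1 < ch (t - s) by apply: ch_gt1; rewrite subr_eq0; apply/eqP => e; apply: st.
have sq : ch (t - s) ^+ 2 <= mink v v' ^+ 2.
  by rewrite -(real_normK (num_real (mink v v'))) ler_pXn2r ?nnegrE //; lra.
have aux n : mink v v' ^+ 2 + (ch (t - s) ^+ 2 - 1) * n ^+ 2 <= ch (t - s) ^+ 2 -> n = 0.
  have c2 : 0 < ch (t - s) ^+ 2 - 1 by rewrite subr_gt0 exprn_egt1.
  move=> h; apply/eqP; rewrite -sqrf_eq0 eq_le sqr_ge0 andbT -(pmulr_rle0 _ c2); lra.
have := cross_sqr vv' vv ct cs; rewrite (minkC v') -(opprB t s) chN => /aux.
by have /aux := cross_sqr vv vv' cs ct.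
Qed.

Lemma continuous_cross F v : continuous (fun t : R => mink v (geo F t)).
Proof.
move=> t.
have -> : (fun t : R => mink v (geo F t)) =
  (fun t => (expR t + expR (- t)) / 2 * mink v (fpt F) + (expR t - expR (- t)) / 2 * mink v (fdir F)).
  by apply/funext => u; rewrite /geo !mink_bilE.
have cN : {for t, continuous (fun t : R => expR (- t))}.
  apply: (@continuous_comp _ _ _ (fun t : R => - t) (@expR R)); first exact: opp_continuous.
  exact: continuous_expR.
have cE : {for t, continuous (@expR R)} by exact: continuous_expR.
apply: cvgD; (apply: cvgM; last exact: cvg_cst); (apply: cvgM; last exact: cvg_cst).
  exact: cvgD.
exact: cvgB.
Qed.

Lemma cross_ivt F v s t : s <= t -> mink v (geo F s) * mink v (geo F t) <= 0 ->
  exists r, [/\ s <= r, r <= t & cross F v r].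
Proof.
move=> st h; have [||r] := @IVT R (fun t : R => mink v (geo F t)) s t 0 st.
- by apply: continuous_subspaceT => r; exact: continuous_cross.
- rewrite ge_min le_max; move: h; move: (mink v _) (mink v _) => a b h.
  by have [a0|a0] := lerP a 0; have [b0|b0] := lerP b 0; rewrite ?orbT //=; nra.
by rewrite in_itv /= => /andP[sr rt] e; exists r.
Qed.

End Frames.

Section WallsAlongGeodesics.
Variable R : realType.
Implicit Types (v x y : 'cV[R]_3) (s t : R) (F : frame R) (u : seq 'Z_6).

Local Notation O := (basepoint R).
Local Notation rw u := (refl_word R u).
Local Notation L := (hexlen R).

Definition apart v v' := v <> v' /\ v <> - v'.

Lemma wall_apart v v' : wall v -> wall v' -> apart v v' -> mink v v' = 0 \/ 2 <= `|mink v v'|.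
Proof. by move=> wv wv' [a b]; have [//|//|e|e] := wall_cases wv wv'; [left|right]. Qed.

(* Three pairwise orthogonal spacelike vectors do not fit in signature (2, 1). *)
Lemma three_apart v1 v2 v3 : wall v1 -> wall v2 -> wall v3 ->
  apart v1 v2 -> apart v1 v3 -> apart v2 v3 ->
  [\/ 2 <= `|mink v1 v2|, 2 <= `|mink v1 v3| | 2 <= `|mink v2 v3| ].
Proof.
move=> w1 w2 w3 a12 a13 a23.
have [e12|] := wall_apart w1 w2 a12; last by constructor 1.
have [e13|] := wall_apart w1 w3 a13; last by constructor 2.
have [e23|] := wall_apart w2 w3 a23; last by constructor 3.
have := gram_le0 v1 v2 v3; rewrite !wall_unit // e12 e13 e23; vlra.
Qed.

(** [cross] alone holds at all times for a wall containing the geodesic; a genuine crossing happens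
    at a single time. *)
Definition crosses F v t := [/\ wall v, cross F v t & ~ contains F v].

Lemma containsN F v : contains F (- v) <-> contains F v.
Proof.
rewrite /contains !minkNl; split=> -[/eqP + /eqP +].
  by rewrite !oppr_eq0 => /eqP ? /eqP.
by move=> /eqP -> /eqP ->; rewrite oppr0.
Qed.

Lemma crossN F v t : cross F (- v) t <-> cross F v t.
Proof.
by rewrite /cross minkNl; split=> [/eqP|->]; rewrite ?oppr0 // oppr_eq0 => /eqP.
Qed.

Lemma crossesN F v t : crosses F (- v) t <-> crosses F v t.
Proof.
split=> -[w c n]; split; try exact/crossN; try by move/containsN.
  by rewrite -[v]opprK; exact: wallN.
exact: wallN.
Qed.

Lemma crosses_uniq F v s t : crosses F v s -> cross F v t -> s = t.
Proof.
by move=> [_ cs n] ct; apply: contrapT => st; apply: n; exact: cross_contains cs ct st.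
Qed.

Lemma crosses_apart F v v' s t : crosses F v s -> crosses F v' t -> s <> t -> apart v v'.
Proof.
move=> ts tt st; split=> e; rewrite e in ts; apply: st; first by case: tt => _ /(crosses_uniq ts).
by case: tt => _ c _; apply: (crosses_uniq ts); apply/crossN.
Qed.

Lemma cross_wall_le F v v' s t : wall v -> wall v' -> cross F v s -> cross F v' t ->
  `|mink v v'| <= ch (t - s).
Proof. by move=> /wall_unit w /wall_unit w'; exact: cross_le. Qed.

Lemma cross_apart_dist F v v' s t : wall v -> wall v' -> cross F v s -> cross F v' t ->
  2 <= `|mink v v'| -> L <= `|t - s|.
Proof.
move=> w w' cs ct h; have := cross_wall_le w w' cs ct => h'.
have /ch_le_norm : ch L <= ch (t - s) by rewrite ch_hexlen; lra.
by rewrite ger0_norm // ltW // hexlen_gt0.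
Qed.

Lemma three_cross F v1 v2 v3 t1 t2 t3 : wall v1 -> wall v2 -> wall v3 ->
  cross F v1 t1 -> cross F v2 t2 -> cross F v3 t3 ->
  apart v1 v2 -> apart v1 v3 -> apart v2 v3 -> t1 <= t2 -> t2 <= t3 -> L <= t3 - t1.
Proof.
move=> w1 w2 w3 c1 c2 c3 a12 a13 a23 t12 t23.
have [h|h|h] := three_apart w1 w2 w3 a12 a13 a23.
- by have := cross_apart_dist w1 w2 c1 c2 h; rewrite ger0_norm; lra.
- by have := cross_apart_dist w1 w3 c1 c3 h; rewrite ger0_norm; lra.
- by have := cross_apart_dist w2 w3 c2 c3 h; rewrite ger0_norm; lra.
Qed.

Definition generic F t := forall v, wall v -> cross F v t -> contains F v.

(** By [three_cross], three times within [L / 2] of each other cannot all be crossing times; this is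
    what [d <= L / 4] arranges. *)
Lemma generic_exists F a b : a < b -> exists t, [/\ a < t, t < b & generic F t].
Proof.
move=> ab; have L0 := hexlen_gt0 R.
pose d := Num.min ((b - a) / 4) (L / 4).
have d0 : 0 < d by rewrite lt_min; apply/andP; split; lra.
have [d1 d2] : d <= (b - a) / 4 /\ d <= L / 4 by rewrite !ge_min !lexx orbT.
have alt t : generic F t \/ exists v, crosses F v t.
  have [g|g] := pselect (generic F t); [by left | right].
  by move: g => /existsNP[v /not_implyP[w /not_implyP[c n]]]; exists v.
have [g|[v1 h1]] := alt (a + d); first by exists (a + d); split=> //; lra.
have [g|[v2 h2]] := alt (a + 2 * d); first by exists (a + 2 * d); split=> //; lra.
have [g|[v3 h3]] := alt (a + 3 * d); first by exists (a + 3 * d); split=> //; lra.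
have [w1 c1 _] := h1; have [w2 c2 _] := h2; have [w3 c3 _] := h3.
have a12 : apart v1 v2 by apply: crosses_apart h1 h2 _ => e; lra.
have a13 : apart v1 v3 by apply: crosses_apart h1 h3 _ => e; lra.
have a23 : apart v2 v3 by apply: crosses_apart h2 h3 _ => e; lra.
have h : L <= a + 3 * d - (a + d) by apply: (three_cross w1 w2 w3 c1 c2 c3 a12 a13 a23); lra.
lra.
Qed.

Implicit Type l : seq ('cV[R]_3 * R).

Definition crossing_list F l := [/\ uniq l, sorted (fun p q => p.2 <= q.2) l,
  forall p, p \in l -> crosses F p.1 p.2 &
  forall p q, p \in l -> q \in l -> p <> q -> apart p.1 q.1].

Lemma crossing_list_behead F p l : crossing_list F (p :: l) -> crossing_list F l.
Proof.
move=> [/= /andP[_ u] /path_sorted s t a]; split=> // [q ql|q r ql rl]; first by apply: t; rewrite inE ql orbT.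
by apply: a; rewrite inE ?ql ?rl orbT.
Qed.

Lemma crossing_list_head F p l : crossing_list F (p :: l) -> forall q, q \in l -> p.2 <= q.2.
Proof.
move=> [_ /= s _ _] q ql.
have tr : transitive (fun p q : 'cV[R]_3 * R => p.2 <= q.2) by move=> ? ? ?; exact: le_trans.
by have /allP/(_ q ql) := order_path_min tr s.
Qed.

Lemma crossing_list_len F j : forall l a b, crossing_list F l ->
  (forall p, p \in l -> a <= p.2 <= b) -> (j.*2 < size l)%N -> a + j%:R * L <= b.
Proof.
elim: j => [|j IH] l a b cl bd sz.
  case: l bd sz {cl} => // p l bd _; have := bd p (mem_head _ _); lra.
case: l cl bd sz => [|p1 [|p2 [|p3 l]]] cl bd; rewrite /= doubleS ?ltnS // => sz.
have [_ _ tr ap] := cl; have cl2 := crossing_list_behead cl; have cl3 := crossing_list_behead cl2.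
have m1 : p1 \in [:: p1, p2, p3 & l] by rewrite mem_head.
have m2 : p2 \in [:: p1, p2, p3 & l] by rewrite !inE eqxx orbT.
have m3 : p3 \in [:: p1, p2, p3 & l] by rewrite !inE eqxx !orbT.
have [[w1 c1 _] [w2 c2 _] [w3 c3 _]] := And3 (tr _ m1) (tr _ m2) (tr _ m3).
have [/= /and3P[]] := cl; rewrite !inE !negb_or => /and3P[n12 n13 _] /andP[n23 _] _ _ _ _.
have l12 : p1.2 <= p2.2 by apply: (crossing_list_head cl); rewrite mem_head.
have l23 : p2.2 <= p3.2 by apply: (crossing_list_head cl2); rewrite mem_head.
have := three_cross w1 w2 w3 c1 c2 c3 (ap _ _ m1 m2 (elimN eqP n12))
  (ap _ _ m1 m3 (elimN eqP n13)) (ap _ _ m2 m3 (elimN eqP n23)) l12 l23.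
have h : p3.2 + j%:R * L <= b.
  apply: (IH (p3 :: l)) => // p pl.
  have := bd p; rewrite !inE; move: pl; rewrite inE => /predU1P[->|pl].
    by rewrite eqxx !orbT lexx => /(_ isT)/andP[].
  rewrite pl !orbT => /(_ isT)/andP[_ ->]; rewrite andbT.
  exact: (crossing_list_head cl3).
have := bd p1 m1; rewrite -natr1 mulrDl mul1r; lra.
Qed.

(** One crossing more than [crossing_list_len] needs. Equality would put the first two crossings at
    [a] and the third at [a + L]; then one of the first two is perpendicular to the geodesic and the
    other, orthogonal to it at the same point, contains the geodesic. *)
Lemma crossing_list_len_strict F j l a b : crossing_list F l ->
  (forall p, p \in l -> a <= p.2 <= b) -> (j.+1.*2.+1 < size l)%N -> a + j.+1%:R * L < b.
Proof.
move=> cl bd; case: l cl bd => [|p1 [|p2 [|p3 l]]] cl bd; rewrite /= doubleS ?ltnS // => sz.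
rewrite ltNge; apply/negP => ba; have L0 := hexlen_gt0 R.
have [_ _ tr ap] := cl; have cl2 := crossing_list_behead cl; have cl3 := crossing_list_behead cl2.
have m1 : p1 \in [:: p1, p2, p3 & l] by rewrite mem_head.
have m2 : p2 \in [:: p1, p2, p3 & l] by rewrite !inE eqxx orbT.
have m3 : p3 \in [:: p1, p2, p3 & l] by rewrite !inE eqxx !orbT.
have [t1 t2] := conj (tr _ m1) (tr _ m2).
have [[w1 c1 _] [w2 c2 _] [w3 c3 _]] := And3 (tr _ m1) (tr _ m2) (tr _ m3).
have [/= /and3P[]] := cl; rewrite !inE !negb_or => /and3P[n12 n13 _] /andP[n23 _] _ _ _ _.
have a12 := ap _ _ m1 m2 (elimN eqP n12).
have a13 := ap _ _ m1 m3 (elimN eqP n13).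
have a23 := ap _ _ m2 m3 (elimN eqP n23).
have l12 : p1.2 <= p2.2 by apply: (crossing_list_head cl); rewrite mem_head.
have l23 : p2.2 <= p3.2 by apply: (crossing_list_head cl2); rewrite mem_head.
have bd2 p : p \in [:: p2, p3 & l] -> p2.2 <= p.2 <= b.
  move=> pl; have /andP[_ ->] := bd p (mem_behead (s := p1 :: _) pl); rewrite andbT.
  by move: pl; rewrite inE => /predU1P[->//|]; exact: (crossing_list_head cl2).
have bd3 p : p \in p3 :: l -> p3.2 <= p.2 <= b.
  move=> pl; have /andP[_ ->] := bd2 p (mem_behead (s := p2 :: _) pl); rewrite andbT.
  by move: pl; rewrite inE => /predU1P[->//|]; exact: (crossing_list_head cl3).
have h2 := crossing_list_len (j := j.+1) cl2 bd2; have h3 := crossing_list_len (j := j) cl3 bd3.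
rewrite /= doubleS !ltnS in h2; rewrite /= ltnS in h3.
have {}h2 := h2 sz; have {}h3 := h3 (ltnW sz).
have h13 := three_cross w1 w2 w3 c1 c2 c3 a12 a13 a23 l12 l23.
move: h2 h3 ba (bd p1 m1); rewrite -natr1 mulrDl mul1r => h2 h3 ba /andP[ap1 _].
have e1 : p1.2 = a by lra.
have e2 : p2.2 = a by lra.
have e3 : p3.2 - a = L by lra.
rewrite e1 in c1; rewrite e2 in c2.
have e12 : mink p1.1 p2.1 = 0.
  by have [//|] := wall_apart w1 w2 a12; have := cross_wall_le w1 w2 c1 c2; rewrite subrr ch0; lra.
have perp v v' : wall v -> wall v' -> cross F v a -> cross F v' a -> mink v v' = 0 ->
    2 <= `|mink v p3.1| -> contains F v'.
  move=> w w' c c' e h.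
  have [||n0 _] := cross_perp (wall_unit w) (wall_unit w3) c c3; [lra|by rewrite e3 ch_hexlen|].
  have := cross_unit (wall_unit w) c; have := cross_mink c c'.
  rewrite n0 mul0r add0r subrr ch0 mulr1 expr0n add0r e => /esym/eqP.
  rewrite mulf_eq0 => /orP[/eqP->|/eqP h0 _]; first by rewrite expr0n => /eqP; rewrite eq_sym oner_eq0.
  exact/(containsP F a).
have [_ _ n1] := t1; have [_ _ n2] := t2.
have [h|h|h] := three_apart w1 w2 w3 a12 a13 a23; first by move: h; rewrite e12 normr0; lra.
- exact: n2 (perp _ _ w1 w2 c1 c2 e12 h).
- by apply: n1 (perp _ _ w2 w1 c2 c1 _ h); rewrite minkC.
Qed.

End WallsAlongGeodesics.

(** * Walls separating a point from its image *)

Section Separation.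
Variables (R : realType) (k : nat).
Implicit Types (v x y : 'cV[R]_3) (s t : R) (F : frame R) (u : seq 'Z_6) (g : Winf R).

Local Notation O := (basepoint R).
Local Notation rw u := (refl_word R u).
Local Notation N := (sg_set (Nk R k)).

Lemma rwVK u : rw u * rw (rev u) = 1.
Proof. by rewrite -{1}[u]revK; exact: refl_word_rev. Qed.

Lemma pos_chamber v y : wall v -> on_sheet y -> chamber y -> mink v y < 0 -> pos v.
Proof.
move=> wv sy cy vy; have [//|np] := boolP (pos v).
have [] := chamber_pos (wallN wv) _ sy cy; first by rewrite posN //; exact: wall_latt.
by rewrite minkNl; vlra.
Qed.

(** Moving the tile of [x] to the base tile conjugates [g] into [rw w], whose reduced gallery lists
    the walls between the two tiles. The inequalities are weak because [x] may lie on the boundary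
    of its tile. *)
Lemma sep_walls g x : on_sheet x -> exists u w,
  [/\ reduced R w, rw w = rw (rev u) * wmx g * rw u,
    forall v, v \in crossings R w ->
      [/\ wall (rw u *m v), mink (rw u *m v) x <= 0 & 0 <= mink (rw u *m v) (wmx g *m x)] &
    forall v, wall v -> mink v x < 0 -> 0 < mink v (wmx g *m x) ->
      exists2 v', v' \in crossings R w & v = rw u *m v'].
Proof.
move=> sx; have [u' cx] := tiling sx; set u := rev u'.
have ru : rev u = u' by rewrite /u revK.
have [g' eg] := winf_wordP g.
(* Only the matrix part of [reduce] matters here, so a trivial action is supplied. *)
have [w [rdw ew _ _]] := @reduce R unit (fun _ => id) (fun _ _ => erefl) (fun _ _ => erefl) (u' ++ g' ++ u).
exists u, w; have sy := on_sheet_word u' sx.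
have ew' : rw w = rw (rev u) * wmx g * rw u.
  by rewrite ew !refl_word_cat eg wmx_word mulrA ru.
have egx v : mink (rw u *m v) (wmx g *m x) = mink v (rw w *m (rw u' *m x)).
  rewrite ew' minkC -mink_revl minkC; congr mink.
  by rewrite -!mulmxA /u rw_revK.
have ex v : mink (rw u *m v) x = mink v (rw u' *m x).
  by rewrite minkC -mink_revl minkC ru.
have wwx v : mink v (rw w *m (rw u' *m x)) = mink (rw (rev w) *m v) (rw u' *m x).
  by rewrite mink_revl.
split=> // [v vw|V wV].
  have wv := crossings_wall vw; have [pv nv] := reduced_pos rdw vw.
  split; [exact: wall_word | by rewrite ex; have [] := chamber_pos wv pv sy cx |].
  rewrite egx wwx -oppr_le0 -minkNl.
  have w1 := wall_word (rev w) wv.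
  have [] // := chamber_pos (wallN w1) _ sy cx.
  by rewrite /pos minkNl mink_revl; vlra.
have eV : V = rw u *m (rw u' *m V) by rewrite /u rw_revK.
rewrite {1 2}eV ex egx; set v := rw u' *m V => v1 v2; have wv : wall v by exact: wall_word.
have pv := pos_chamber wv sy cx v1.
exists v => //; apply: contrapT => /negP nv.
have := reduced_neg rdw wv pv nv; rewrite -mink_revl => p1.
have [] := chamber_pos (wall_word (rev w) wv) p1 sy cx.
by rewrite -wwx; vlra.
Qed.

Lemma pos_apart v v' : latt v -> pos v -> pos v' -> v <> v' -> apart v v'.
Proof. by move=> lv p p' ne; split=> // e; move: p'; rewrite (_ : v' = - v) ?posN ?p // e opprK. Qed.

Lemma apart_word u v v' : apart v v' -> apart (rw u *m v) (rw u *m v').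
Proof.
have inj (a b : 'cV[R]_3) : rw u *m a = rw u *m b -> a = b.
  by move/(congr1 (mulmx (rw (rev u)))); rewrite !rw_revK.
by move=> [a b]; split=> [/inj //|]; rewrite -mulmxN => /inj.
Qed.

Lemma wallrefl_word_conj u v : wallrefl (rw u *m v) = rw u * wallrefl v * rw (rev u).
Proof. by rewrite wallrefl_conj -mulrA rwVK mulr1. Qed.

Lemma wallrefl_winf v : wall v -> exists t : Winf R, wmx t = wallrefl v.
Proof.
by move=> [u [i ->]]; exists (winf_word R (u ++ i :: rev u)); rewrite wmx_word wallrefl_word.
Qed.

Lemma same_class_word u v v' : same_class k v v' -> same_class k (rw u *m v) (rw u *m v').
Proof.
move=> [n Nn en]; exists (winf_word R u * n * (winf_word R u)^-1)%g; first exact: ns_conj.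
rewrite !wmxM en -winf_word_rev !wmx_word !wallrefl_word_conj !mulrA; congr (_ * _).
by rewrite -!mulrA (mulrA (rw (rev u)) (rw u)) refl_word_rev mul1r !mulrA.
Qed.

Lemma same_classNl v v' : same_class k v v' -> same_class k (- v) v'.
Proof. by move=> [n Nn en]; exists n; rewrite ?wallreflN. Qed.

Lemma same_classNr v v' : same_class k v v' -> same_class k v (- v').
Proof. by move=> [n Nn en]; exists n; rewrite ?wallreflN. Qed.

Lemma same_class_trans v1 v2 v3 : mink v2 v2 = 1 ->
  same_class k v1 v2 -> same_class k v2 v3 -> same_class k v1 v3.
Proof.
move=> e [n Nn en] [m Nm em]; exists (n * m)%g; first exact: sg_mul.
by rewrite wmxM en em -mulrA (mulrA (wallrefl v2)) wallreflK // mul1r.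
Qed.

Lemma same_class_sym v v' : mink v v = 1 -> mink v' v' = 1 -> same_class k v v' -> same_class k v' v.
Proof.
move=> e e' [n Nn en]; exists n^-1%g; first exact: sg_inv.
have : wmx (n^-1 * n)%g = 1 by rewrite mulVg.
rewrite wmxM en => h; have := congr1 (fun M => M * wallrefl v' * wallrefl v) h.
rewrite /= mul1r => <-; rewrite -!mulrA (mulrA (wallrefl v') (wallrefl v')) wallreflK //.
by rewrite mul1r wallreflK // mulr1.
Qed.

Lemma same_class_N g v : N g -> wall v -> same_class k v (wmx g *m v).
Proof.
move=> Ng wv; have [t et] := wallrefl_winf wv; have [u eu] := winf_wordP g.
exists (t * g * t^-1 * g^-1)%g.
  by apply: sg_mul; [exact: ns_conj | exact: sg_inv].
have etV : t^-1%g = t.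
  apply: mulg1_eq; apply: wmx_inj; rewrite wmxM et wallreflK //; exact: wall_unit.
by rewrite etV !wmxM et eu -winf_word_rev !wmx_word wallrefl_word_conj !mulrA.
Qed.

Lemma N_sep_pair g x v : N g -> on_sheet x -> wall v -> mink v x < 0 -> 0 < mink v (wmx g *m x) ->
  exists v', [/\ wall v', apart v v', same_class k v v', mink v' x <= 0
    & 0 <= mink v' (wmx g *m x)].
Proof.
move=> Ng sx wv v1 v2; have [u [w [rdw ew wk st]]] := sep_walls g sx.
have [v0 v0w ev] := st v wv v1 v2.
pose g' := ((winf_word R u)^-1 * g * (winf_word R u)^-1^-1)%g.
have Ng' : N g' by exact: ns_conj.
have eg' : wmx g' = rw w by rewrite ew /g' invgK -winf_word_rev !wmxM !wmx_word.
have [v' v'w [ne sc]] := N_crosses_twice Ng' eg' rdw v0w.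
have [w' m1 m2] := wk _ v'w; exists (rw u *m v'); split=> //; rewrite ev.
  apply: apart_word; have [p0 _] := reduced_pos rdw v0w; have [p' _] := reduced_pos rdw v'w.
  apply: pos_apart => //; first exact/wall_latt/(crossings_wall v0w).
  by move=> e; move: ne; rewrite e eqxx.
exact: same_class_word.
Qed.

Lemma wmx_mulKV g x : wmx g *m (wmx g^-1%g *m x) = x.
Proof.
rewrite mulmxA (_ : wmx g *m wmx g^-1%g = 1) ?mul1mx //.
by have := wmxM g (g^-1)%g; rewrite mulgV.
Qed.

Lemma containsE F v : contains F v <-> forall t, cross F v t.
Proof.
split=> [c t|c]; first by case/(containsP F t): c.
by apply: (cross_contains (c 0) (c 1)) => /eqP; rewrite eq_sym oner_eq0.
Qed.

Section Translation.
Variables (F : frame R) (g : Winf R) (l : R).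
Hypothesis trans : forall t, wmx g *m geo F t = geo F (t + l).

Lemma cross_trans v t : cross F (wmx g *m v) (t + l) <-> cross F v t.
Proof. by rewrite /cross -trans mink_wmx. Qed.

Lemma contains_trans v : contains F (wmx g *m v) <-> contains F v.
Proof.
rewrite !containsE; split=> c t; first exact/cross_trans.
by rewrite -(subrK l t); exact/cross_trans.
Qed.

Lemma crosses_trans v t : crosses F v t -> crosses F (wmx g *m v) (t + l).
Proof.
move=> [w c n]; split; [exact: wall_wmx | exact/cross_trans | by move/contains_trans].
Qed.

Lemma generic_trans t : generic F t -> generic F (t + l).
Proof.
move=> ge v wv; have e : v = wmx g *m (wmx g^-1%g *m v).
  by rewrite wmx_mulKV.
rewrite e => /cross_trans c; apply/contains_trans; apply: ge => //; exact: wall_wmx.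
Qed.

Hypothesis l0 : 0 < l.

(* Going once along its axis, one leaves the wall v, meets another wall v' of its
   class, and comes back to an image of v. *)
Lemma N_translation_pair D0 v s : N g -> 0 < D0 ->
  (forall v v', wall v -> wall v' -> apart v v' -> same_class k v v' -> ch D0 <= `|mink v v'|) ->
  crosses F v s ->
  exists v' s', [/\ same_class k v v', apart v v', crosses F v' s', D0 <= `|s' - s|
    & `|s' - s| <= l - D0].
Proof.
move=> Ng D00 far tv.
have c0 : 1 < ch D0 by apply: ch_gt1; rewrite gt_eqF.
(* The period starts at a generic time before [s], so that [v'] is met strictly inside it. *)
have [t0 [t0a t0b ge0]] : exists t0, [/\ s - l < t0, t0 < s & generic F t0].
  by apply: generic_exists; rewrite ltrBlDr ltrDl.
have ge1 := generic_trans ge0.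
wlog pT : v tv / 0 < mink v (gdir F s).
  move=> h; have [_ cs nc] := tv; have [T0|T0|T0] := ltrgtP (mink v (gdir F s)) 0.
  - have [|v' [s' [sc [a1 a2] ? ? ?]]] := h _ ((crossesN F v s).2 tv).
      by rewrite minkNl oppr_gt0.
    exists v', s'; split=> //; first by rewrite -[v]opprK; exact: same_classNl.
    by split=> e; [apply: a2 | apply: a1]; rewrite e ?opprK.
  - exact: h.
  - by case: nc; apply/(containsP F s).
have [wv cs nc] := tv.
have val t : mink v (geo F t) = sh (t - s) * mink v (gdir F s).
  by rewrite (geoE F t s) minkDr !minkZr cs mulr0 add0r.
have sx := geo_sheet F t0.
have v1 : mink v (geo F t0) < 0.
  by rewrite val pmulr_llt0 // -(opprB s) shN oppr_lt0; apply: sh_gt0; lra.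
have v2 : 0 < mink v (wmx g *m geo F t0).
  by rewrite trans val mulr_gt0 //; apply: sh_gt0; lra.
have [v' [wv' ap sc m1 m2]] := N_sep_pair Ng sx wv v1 v2.
have fvv' := far _ _ wv wv' ap sc.
have nc' : ~ contains F v'.
  move=> c'; have c's : cross F v' s by exact: (containsE F v').1 c' s.
  have := cross_wall_le wv wv' cs c's; rewrite subrr ch0; vlra.
rewrite trans in m2.
have [|s' [s'a s'b cs']] := @cross_ivt _ F v' t0 (t0 + l) _ (mulr_le0_ge0 m1 m2); first by lra.
have s't0 : s' <> t0 by move=> e; apply: nc'; apply: ge0 => //; rewrite -e.
have s't1 : s' <> t0 + l by move=> e; apply: nc'; apply: ge1 => //; rewrite -e.
have dist a b p q : wall a -> wall b -> apart a b -> same_class k a b -> cross F a p ->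
    cross F b q -> D0 <= `|q - p|.
  move=> wa wb ab sab ca cb; have h1 := far _ _ wa wb ab sab.
  have /ch_le_norm := le_trans h1 (cross_wall_le wa wb ca cb).
  by rewrite gtr0_norm.
have tv' : crosses F v' s' by [].
exists v', s'; split=> //; first exact: dist wv wv' ap sc cs cs'.
have u' := wall_unit wv'; have u := wall_unit wv.
(* If [v'] is met after [v], it is compared with the image of [v], crossed at [s + l]; otherwise [v]
   is compared with the image of [v'], crossed at [s' + l]. *)
have [ss|ss] := ltrP s s'.
  have t2 := crosses_trans tv; have [w2 c2 _] := t2.
  have a2 : apart v' (wmx g *m v).
    by apply: crosses_apart tv' t2 _ => e; lra.
  have sc2 := same_class_trans u (same_class_sym u u' sc) (same_class_N Ng wv).
  by have := dist _ _ _ _ wv' w2 a2 sc2 cs' c2; rewrite !gtr0_norm; lra.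
have t2 := crosses_trans tv'; have [w2 c2 _] := t2.
have a2 : apart v (wmx g *m v') by apply: crosses_apart tv t2 _ => e; lra.
have sc2 := same_class_trans u' sc (same_class_N Ng wv').
have := dist _ _ _ _ wv w2 a2 sc2 cs c2.
have s't : t0 < s' by rewrite lt_neqAle s'a andbT eq_sym; exact/eqP.
have e1 : 0 < s' + l - s by lra.
by rewrite (gtr0_norm e1); lra.
Qed.

End Translation.

End Separation.

(** * Common perpendiculars of walls *)

Section CommonPerpendicular.
Variable R : realType.
Implicit Types (v x y r : 'cV[R]_3) (s t : R) (F : frame R) (u : seq 'Z_6) (i j l m : 'Z_6).

Local Notation O := (basepoint R).
Local Notation rw u := (refl_word R u).
Local Notation n_ i := (side_normal R i).
Local Notation L := (hexlen R).

Lemma fmap_subproof u F : [/\ on_sheet (rw u *m fpt F), mink (rw u *m fdir F) (rw u *m fdir F) = 1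
  & mink (rw u *m fpt F) (rw u *m fdir F) = 0].
Proof. by have [a b c] := frameP F; rewrite !mink_word; split=> //; exact: on_sheet_word. Qed.

Definition fmap u F := Frame (fmap_subproof u F).

Lemma geo_fmap u F t : geo (fmap u F) t = rw u *m geo F t.
Proof. by rewrite /geo /= mulmxDr -!scalemxAr. Qed.

Lemma gdir_fmap u F t : gdir (fmap u F) t = rw u *m gdir F t.
Proof. by rewrite /gdir /= mulmxDr -!scalemxAr. Qed.

Lemma cross_fmap u F v t : cross (fmap u F) (rw u *m v) t <-> cross F v t.
Proof. by rewrite /cross geo_fmap mink_word. Qed.

Lemma contains_fmap u F v : contains (fmap u F) (rw u *m v) <-> contains F v.
Proof. by rewrite /contains /= !mink_word. Qed.

Lemma ncomp_sqr F v t : ncomp F v ^+ 2 =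
  mink v v - mink v (gdir F t) ^+ 2 + mink v (geo F t) ^+ 2.
Proof. by rewrite (parseval F t v v); ring. Qed.

Lemma ncomp0_fmap u F v : ncomp F v = 0 -> ncomp (fmap u F) (rw u *m v) = 0.
Proof.
move=> e; apply/eqP; rewrite -sqrf_eq0 (ncomp_sqr _ _ 0) gdir_fmap geo_fmap !mink_word.
by rewrite -ncomp_sqr e expr0n.
Qed.

Lemma perp_gdir F v t : ncomp F v = 0 -> cross F v t -> v = mink v (gdir F t) *: gdir F t.
Proof.
move=> n0 ct; apply/eqP; rewrite -subr_eq0; apply/eqP/mink_nondeg => y.
by rewrite minkBl minkZl (parseval F t v) n0 ct !mul0r add0r subr0 (minkC y) subrr.
Qed.

Lemma perp_dir_sqr F v t : mink v v = 1 -> ncomp F v = 0 -> cross F v t ->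
  mink v (gdir F t) ^+ 2 = 1.
Proof. by move=> vv n0 ct; have := cross_unit vv ct; rewrite n0 expr0n add0r. Qed.

Lemma wallrefl_geo F v s t : mink v v = 1 -> ncomp F v = 0 -> cross F v s ->
  wallrefl v *m geo F t = geo F (2 * s - t).
Proof.
move=> vv n0 cs; have T1 := perp_dir_sqr vv n0 cs.
rewrite wallrefl_mul (perp_gdir n0 cs); move: (mink v _) T1 => T T1.
rewrite minkZl minkC mink_geo_gdir (geoE F (2 * s - t) s) (geoE F t s).
rewrite (_ : 2 * s - t - s = - (t - s)) ?chN ?shN; last by ring.
move: (geo F s) (gdir F s) => p d; apply: cV3_ext; rewrite !mxE.
all: set a := p _ _; set b := d _ _; set c := ch _; set h := sh _.
all: transitivity (c * a + h * b - 2 * T ^+ 2 * h * b); [by ring|by rewrite T1; ring].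
Qed.

Lemma geo_inj F s t : geo F s = geo F t -> s = t.
Proof.
move=> e; have := mink_geo F s t; rewrite e mink_geo subrr ch0 => /esym h.
apply/eqP; rewrite eq_sym -subr_eq0; apply/negPn/negP => /ch_gt1; lra.
Qed.

Lemma cross_val F v s t : cross F v s -> mink v (geo F t) = sh (t - s) * mink v (gdir F s).
Proof. by move=> cs; rewrite (geoE F t s) minkDr !minkZr cs mulr0 add0r. Qed.

(** Here [T ^+ 2 - P ^+ 2 = 1], so [T] and [P] are, up to sign, [ch a] and [sh a]; the crossing time
    is [a] or [- a]. *)
Lemma perp_cross_exists F v : mink v v = 1 -> ncomp F v = 0 -> exists t, cross F v t.
Proof.
move=> vv n0; have := ncomp_sqr F v 0; rewrite vv n0 expr0n /= => e.
set T := mink v (gdir F 0) in e *; set P := mink v (geo F 0) in e *.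
have T1 : 1 <= `|T|.
  rewrite -(@ler_pXn2r _ 2) ?nnegrE // real_normK ?num_real // expr1n.
  by have := sqr_ge0 P; lra.
set a := arcosh `|T|; have ca : ch a = `|T| by exact: ch_arcosh.
have sa : sh a = `|P|.
  have a0 : 0 <= a by exact: arcosh_ge0.
  have s0 : 0 <= sh a by move: a0; rewrite le_eqVlt => /predU1P[<-|/sh_gt0/ltW//]; rewrite sh0.
  apply: (@pexpIrn _ 2) => //; rewrite ?nnegrE // real_normK ?num_real //.
  by have := ch2_sh2 a; rewrite ca real_normK ?num_real //; lra.
have val t : mink v (geo F t) = ch t * P + sh t * T.
  by rewrite (geoE F t 0) subr0 minkDr !minkZr.
have [h|h] := lerP 0 (P * T).
  exists (- a); rewrite /cross val chN shN ca sa.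
  have [P0|P0] := lerP 0 P; have [T0|T0] := lerP 0 T; rewrite ?(ger0_norm P0) ?(ger0_norm T0) ?(ltr0_norm P0) ?(ltr0_norm T0); nra.
exists a; rewrite /cross val ca sa.
have [P0|P0] := lerP 0 P; have [T0|T0] := lerP 0 T; rewrite ?(ger0_norm P0) ?(ger0_norm T0) ?(ltr0_norm P0) ?(ltr0_norm T0); nra.
Qed.

Lemma contains_gdir F v s t : mink v (gdir F s) = 0 -> mink v (gdir F t) = 0 -> s <> t ->
  contains F v.
Proof.
move=> es et st; apply/(containsP F t); split=> //.
have := es; rewrite (gdirE F s t) minkDr !minkZr et mulr0 add0r => /eqP.
rewrite mulf_eq0 => /orP[/eqP e|/eqP //].
suff : sh (s - t) != 0 by rewrite e eqxx.
by apply: sh_neq0; rewrite subr_eq0; apply/eqP.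
Qed.

Lemma contains_perp F v r t : contains F v -> ncomp F r = 0 -> mink v r = 0.
Proof.
move=> /(containsP F 0)[e1 e2] n0.
by rewrite (parseval F 0) e1 e2 n0; ring.
Qed.

Lemma contains_ncomp F v : mink v v = 1 -> contains F v -> ncomp F v ^+ 2 = 1.
Proof. by move=> vv /(containsP F 0)[e1 e2]; rewrite (ncomp_sqr F v 0) vv e1 e2; ring. Qed.

(** The plane spanned by [r] and [r'] cuts the sheet in the common perpendicular, which has [r] and
    [r'], up to sign, as tangent vectors at its feet. *)
Lemma common_perp r r' : mink r r = 1 -> mink r' r' = 1 -> 2 <= `|mink r r'| ->
  exists F D, [/\ 0 < D, ch D = `|mink r r'|, cross F r 0, cross F r' D
    & ncomp F r = 0 /\ ncomp F r' = 0].
Proof.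
move=> rr rr'; wlog M2 : r' rr' / 2 <= mink r r'.
  move=> h hM; have := hM; rewrite ler_normr => /orP[M2|]; first exact: h.
  rewrite -minkNr => M2; have [||F [D [D0 e c c' [n n']]]] := h _ _ M2.
  - by rewrite minkNl minkNr opprK.
  - by rewrite minkNr normrN.
  exists F, D; split=> //; first by rewrite e minkNr normrN.
    exact/crossN.
  split=> //; move: n'; rewrite /ncomp /vol !mxE => n'; rewrite -[RHS]oppr0 -[in RHS]n'; ring.
move=> _; rewrite ger0_norm; last by lra.
set M := mink r r' in M2 *; pose D := arcosh M.
have eD : ch D = M by apply: ch_arcosh; lra.
have D0 : 0 < D.
  have : 0 <= D by apply: arcosh_ge0; lra.
  by rewrite le_eqVlt => /predU1P[e|//]; move: eD; rewrite -e ch0; lra.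
have S0 := sh_gt0 D0; have cs := ch2_sh2 D; rewrite eD in cs.
(* The foot on [r], up to sign: the part of [r'] orthogonal to [r], normalized to norm -1. *)
pose p := (sh D)^-1 *: (r' - M *: r).
have pp : mink p p = -1.
  rewrite /p !mink_bilE rr rr' (minkC r' r) -/M.
  transitivity ((sh D)^-1 ^+ 2 * (1 - M ^+ 2)); first by ring.
  have -> : 1 - M ^+ 2 = - sh D ^+ 2 by lra.
  by rewrite mulrN -exprMn mulVf ?expr1n // gt_eqF.
have pr : mink p r = 0 by rewrite /p !mink_bilE rr (minkC r') -/M; ring.
have er' : r' = sh D *: p + M *: r.
  by rewrite /p scalerA mulfV ?gt_eqF // scale1r subrK.
have key F : gdir F 0 = r \/ gdir F 0 = - r -> gdir F D = r' \/ gdir F D = - r' ->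
    [/\ cross F r 0, cross F r' D & ncomp F r = 0 /\ ncomp F r' = 0].
  have cg t : mink (gdir F t) (geo F t) = 0 by rewrite minkC mink_geo_gdir subrr sh0.
  have ng t : ncomp F (gdir F t) = 0.
    by apply/eqP; rewrite -sqrf_eq0 (ncomp_sqr F _ t) cg mink_gdir subrr ch0; apply/eqP; ring.
  have ng' v : ncomp F (- v) = - ncomp F v by rewrite /ncomp /vol !mxE; ring.
  have aux v t : gdir F t = v \/ gdir F t = - v -> cross F v t /\ ncomp F v = 0.
    case=> e; first by rewrite -e; split; [exact: cg | exact: ng].
    rewrite -[v]opprK -e ng' ng oppr0; split=> //.
    by rewrite /cross minkNl cg oppr0.
  by move=> /aux[c n] /aux[c' n'].
have [sp|sp] : on_sheet p \/ on_sheet (- p).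
  rewrite /on_sheet minkNl minkNr opprK pp eqxx /= [(- p) 0 0]mxE oppr_gt0.
  have : p 0 0 != 0 by apply/eqP => e; move: pp; rewrite minkE e; nra.
  by rewrite neq_lt => /orP[h|h]; [right|left].
- pose F := Frame (And3 sp rr pr); exists F, D.
  have [] := key F; last by move=> c c' n; split.
    by left; rewrite /gdir /= sh0 ch0 scale0r add0r scale1r.
  by left; rewrite /gdir /= eD -er'.
- have rrN : mink (- r) (- r) = 1 by rewrite minkNl minkNr opprK.
  have prN : mink (- p) (- r) = 0 by rewrite minkNl minkNr opprK.
  pose F := Frame (And3 sp rrN prN); exists F, D.
  have [] := key F; last by move=> c c' n; split.
    by right; rewrite /gdir /= sh0 ch0 scale0r add0r scale1r.
  by right; rewrite /gdir /= eD !scalerN -opprD -er'.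
Qed.

Lemma meeting_point r r' : mink r r = 1 -> mink r' r' = 1 -> mink r r' = 0 ->
  exists z, [/\ on_sheet z, mink r z = 0 & mink r' z = 0].
Proof.
move=> rr rr' e.
(* the Lorentzian cross product *)
pose z : 'cV[R]_3 := \col_a [:: - (r 1 0 * r' (2%:R : 'I_3) 0 - r (2%:R : 'I_3) 0 * r' 1 0);
   - (r 0 0 * r' (2%:R : 'I_3) 0 - r (2%:R : 'I_3) 0 * r' 0 0);
   r 0 0 * r' 1 0 - r 1 0 * r' 0 0]`_a.
have zz : mink z z = -1.
  transitivity (mink r r' ^+ 2 - mink r r * mink r' r'); last by rewrite rr rr' e; ring.
  by rewrite !minkE !mxE /=; ring.
have rz : mink r z = 0 by rewrite minkE !mxE /=; ring.
have r'z : mink r' z = 0 by rewrite minkE !mxE /=; ring.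
have [sp|sp] : on_sheet z \/ on_sheet (- z).
  rewrite /on_sheet minkNl minkNr opprK zz eqxx /= [(- z) 0 0]mxE oppr_gt0.
  have : z 0 0 != 0 by apply/eqP => e'; move: zz; rewrite minkE e'; nra.
  by rewrite neq_lt => /orP[h|h]; [right|left].
- by exists z.
- by exists (- z); rewrite !minkNr rz r'z oppr0.
Qed.

End CommonPerpendicular.

(** * Distance of the walls of a class *)

Section Types.
Variables (R : realType) (k : nat).
Hypothesis k_even : ~~ odd k.
Implicit Types (v x y r : 'cV[R]_3) (u : seq 'Z_6) (i j l m : 'Z_6).

Local Notation O := (basepoint R).
Local Notation rw u := (refl_word R u).
Local Notation n_ i := (side_normal R i).

Lemma foldr_xor i (b : bool) u :
  foldr (fun j c => (j == i) (+) c) b u = odd (count_mem i u) (+) b.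
Proof. by elim: u => //= j u ->; rewrite oddD oddb addbA. Qed.

(* For even k the parity of the number of occurrences of s_i in a word is
   an invariant of its class in W(k). *)
Lemma same_class_type u u' i j : same_class k (rw u *m n_ i) (rw u' *m n_ j) -> i = j.
Proof.
move=> [g Ng eg]; rewrite !wallrefl_word -refl_word_cat in eg.
pose f l c := (l == i) (+) c.
have fK l c : f l (f l c) = c by rewrite /f addbA addbb.
have fC l c : f l (f (l + 1) c) = f (l + 1) (f l c) by rewrite /f addbCA.
have fk l c : iter k (f l \o f (l + 2)) c = c.
  by apply: iter_invol => // d; rewrite /= /f !addbA; case: (l == i); case: (_ == i); rewrite ?addbb.
have := N_acts_trivially fK fC fk false Ng eg.
rewrite foldr_xor addbF !count_cat /= !count_rev !oddD !oddb eqxx.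
case: eqVneq => [->|ji] //=; by do 2!case: (odd _).
Qed.

(** Orthogonal walls meet; with the meeting point moved into the base tile they become sides, of
    equal index by [same_class_type], so they were the same line. *)
Lemma same_class_meet r r' : wall r -> wall r' -> apart r r' -> same_class k r r' ->
  mink r r' <> 0.
Proof.
move=> wr wr' ap sc e; have [z [sz rz r'z]] := meeting_point (wall_unit wr) (wall_unit wr') e.
have [u cz] := tiling sz; have szu := on_sheet_word u sz.
have simple v : wall v -> mink v z = 0 -> exists i, rw u *m v = n_ i \/ rw u *m v = - n_ i.
  move=> wv vz; have wuv := wall_word u wv.
  have [p|np] := boolP (pos (rw u *m v)).
    have [_] := chamber_pos wuv p szu cz; rewrite mink_word => /(_ vz)[i ->].
    by exists i; left.
  have p : pos (- (rw u *m v)) by rewrite posN //; exact: wall_latt.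
  have [_] := chamber_pos (wallN wuv) p szu cz.
  rewrite minkNl mink_word vz oppr0 => /(_ erefl)[i ei].
  by exists i; right; rewrite -ei opprK.
have [i ei] := simple r wr rz; have [j ej] := simple r' wr' r'z.
have {}sc := same_class_word u sc.
have [a1 a2] := apart_word u ap.
have {}sc : same_class k (n_ i) (n_ j).
  case: ei sc => ->; case: ej => ->; first by [].
  - by move=> /same_classNr; rewrite opprK.
  - by move=> /same_classNl; rewrite opprK.
  - by move=> /same_classNl/same_classNr; rewrite !opprK.
have ij : i = j.
  by apply: (@same_class_type [::] [::]); rewrite !refl_word_nil !mul1mx.
by case: ei a1 a2 => ->; case: ej => ->; rewrite ij ?opprK.
Qed.

Lemma same_class_ge2 r r' : wall r -> wall r' -> apart r r' -> same_class k r r' ->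
  2 <= `|mink r r'|.
Proof.
by move=> wr wr' ap sc; have [/(same_class_meet wr wr' ap sc)|] := wall_apart wr wr' ap.
Qed.

End Types.

(** * Dihedral groups acting along an axis *)

Section Dihedral.
Variable R : realType.
Implicit Types (v x y r q : 'cV[R]_3) (s t : R) (u w : seq 'Z_6) (i j l m : 'Z_6).

Local Notation rw u := (refl_word R u).
Local Notation n_ i := (side_normal R i).

Section Fold.
Variables (i j : 'Z_6) (ti tj : R).

(** How letters act on the parameter of an axis perpendicular to sides [i] and [j] at times [ti] and
    [tj]; the other letters act trivially, so that the action can be tested against the relations of
    W(k). *)
Definition line_refl l (t : R) : R :=
  if l == i then 2 * ti - t else if l == j then 2 * tj - t else t.

Lemma line_reflK l t : line_refl l (line_refl l t) = t.
Proof. by rewrite /line_refl; case: (l == i); case: (l == j); ring. Qed.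

Hypotheses (ij : i != j) (lt : tj < ti).

Lemma fold_interval t : exists2 u, all (pred2 i j) u & tj <= foldr line_refl t u <= ti.
Proof.
pose E := ti - tj; have E0 : 0 < E by rewrite subr_gt0.
have [n] : exists n : nat, tj - n%:R * E <= t <= ti + n%:R * E.
  pose n := (Num.truncn (`|t - tj| / E)).+1; exists n.
  have : `|t - tj| / E < n%:R by exact: truncnS_gt.
  rewrite ltr_pdivrMr // ltr_norml => /andP[h1 h2].
  by apply/andP; split; rewrite /E in E0 h1 h2 *; lra.
elim: n t => [|n IH] t; first by rewrite mul0r subr0 addr0; exists [::].
rewrite -natr1 mulrDl mul1r => /andP[h1 h2].
have nE : 0 <= n%:R * E by rewrite mulr_ge0 // ltW.
have [h|h] := lerP t ti; last first.
  have [|u au hu] := IH (2 * ti - t); first by rewrite /E in E0 h1 h2 nE *; apply/andP; split; lra.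
  exists (rcons u i); first by rewrite all_rcons /= eqxx au.
  by rewrite -cats1 foldr_cat /= (_ : line_refl i t = 2 * ti - t) // /line_refl eqxx.
have [h'|h'] := lerP tj t; first by exists [::]; rewrite //= h' h.
have [|u au hu] := IH (2 * tj - t); first by rewrite /E in E0 h1 h2 nE *; apply/andP; split; lra.
exists (rcons u j); first by rewrite all_rcons /= eqxx orbT au.
by rewrite -cats1 foldr_cat /= (_ : line_refl j t = 2 * tj - t) // /line_refl eqxx eq_sym (negbTE ij).
Qed.

Variable F : frame R.
Hypotheses (ci : cross F (n_ i) ti) (cj : cross F (n_ j) tj)
  (ni : ncomp F (n_ i) = 0) (nj : ncomp F (n_ j) = 0).

Lemma line_refl_geo u t : all (pred2 i j) u ->
  rw u *m geo F t = geo F (foldr line_refl t u).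
Proof.
elim: u => [|l u IH] /=; first by rewrite refl_word_nil mul1mx.
move=> /andP[lij /IH e]; rewrite refl_word_cons -mulmxA e.
case/orP: lij => /eqP ->; rewrite -wallrefl_normal /line_refl eqxx.
  by rewrite (wallrefl_geo _ (side_normal_unit R i) ni ci).
by rewrite eq_sym (negbTE ij) (wallrefl_geo _ (side_normal_unit R j) nj cj).
Qed.

Hypothesis cham : forall t, tj <= t <= ti -> chamber (geo F t) /\
  forall l, cross F (n_ l) t -> [\/ l = i, l = j | contains F (n_ l)].

(** Folding the crossing time into [[tj, ti]] carries [q] to a wall meeting the base tile there,
    hence to side [i] or [j]; conjugating back gives a word in these two letters. *)
Lemma crosses_dihedral q s : crosses F q s ->
  exists2 u, all (pred2 i j) u & wallrefl q = rw u.
Proof.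
move=> [wq cq nq]; have [u au hu] := fold_interval s.
have [ch only] := cham hu.
have cq' : cross F (rw u *m q) (foldr line_refl s u).
  by rewrite /cross -line_refl_geo // mink_word.
have nq' : ~ contains F (rw u *m q).
  move=> c; apply: nq; apply/containsE => t.
  by rewrite /cross -(mink_word u) line_refl_geo //; exact: (containsE _ _).1 c _.
have wq' := wall_word u wq.
have sg := geo_sheet F (foldr line_refl s u).
have [l [el cl ncl]] : exists l, [/\ wallrefl (rw u *m q) = refl R l,
    cross F (n_ l) (foldr line_refl s u) & ~ contains F (n_ l)].
  have [p|np] := boolP (pos (rw u *m q)).
    have [_ /(_ cq')[l e]] := chamber_pos wq' p sg ch.
    by exists l; rewrite -[refl R l]wallrefl_normal -e.
  have p : pos (- (rw u *m q)) by rewrite posN //; exact: wall_latt.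
  have [_] := chamber_pos (wallN wq') p sg ch.
  rewrite minkNl cq' oppr0 => /(_ erefl)[l e]; exists l.
  rewrite -[refl R l]wallrefl_normal -e; split; [by rewrite wallreflN | exact/crossN |].
  by move/containsN.
exists (rev u ++ l :: u).
  rewrite all_cat all_rev au /= au andbT /=.
  by have [->|->|//] := only l cl; rewrite /= ?eqxx ?orbT.
rewrite refl_word_cat refl_word_cons -el wallrefl_word_conj !mulrA.
rewrite refl_word_rev mul1r -!mulrA (_ : rw (rev u) * rw u = 1) ?mulr1 //.
exact: refl_word_rev.
Qed.

End Fold.
End Dihedral.

Lemma z6_neq (i : 'Z_6) : [/\ i + 1 != i, i + 2 != i, i + 3 != i, i + 4 != i & i + 5 != i].
Proof. by case: i => [[|[|[|[|[|[|//]]]]]] hi]. Qed.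

Section PairActions.
Variables (X : Type) (f : 'Z_6 -> X -> X) (i j : 'Z_6).
Hypotheses (fK : forall l (x : X), f l (f l x) = x)
  (f1 : forall l (x : X), l != i -> l != j -> f l x = x).

Lemma pair_action_comm : j != i + 1 -> i != j + 1 -> forall l x,
  f l (f (l + 1) x) = f (l + 1) (f l x).
Proof.
move=> ni nj l x.
have [li|li] := eqVneq l i.
  by rewrite li !(f1 (l := i + 1)) // ?(eq_sym _ j) //; have [] := z6_neq i.
have [lj|lj] := eqVneq l j; last by rewrite !(f1 (l := l)).
by rewrite lj !(f1 (l := j + 1)) // ?(eq_sym _ i) //; have [] := z6_neq j.
Qed.

(** When one of the two letters acts trivially, the relation asks that the [k]-th power of an
    involution be trivial: evenness of [k]. *)
Lemma pair_action_rel k : ~~ odd k -> forall l, (l != i) && (l != j) || (l + 2 != i) && (l + 2 != j) ->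
  forall x, iter k (f l \o f (l + 2)) x = x.
Proof.
move=> ke l h x; apply: iter_invol => // y /=.
by case/orP: h => /andP[a b]; rewrite !(f1 _ a b) fK.
Qed.

End PairActions.

Section MinimalPair.
Variables (R : realType) (k : nat).
Hypotheses (k_even : ~~ odd k) (k_gt1 : (1 < k)%N).
Implicit Types (v x y r q : 'cV[R]_3) (s t : R) (u w : seq 'Z_6) (i j l m : 'Z_6) (F : frame R).

Local Notation rw u := (refl_word R u).
Local Notation n_ i := (side_normal R i).
Local Notation L := (hexlen R).
Local Notation N := (sg_set (Nk R k)).

Lemma sh_le0 t : sh t <= 0 -> t <= 0.
Proof. by move=> h; rewrite leNgt; apply/negP => /sh_gt0; rewrite ltNge h. Qed.

Lemma sh_ge0 t : 0 <= t -> 0 <= sh t.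
Proof. by rewrite le_eqVlt => /predU1P[<-|/sh_gt0/ltW//]; rewrite sh0. Qed.

Lemma interval_chamber F t1 i j ti tj : chamber (geo F t1) ->
  cross F (n_ i) ti -> cross F (n_ j) tj -> tj < ti ->
  mink (n_ i) (gdir F ti) * mink (n_ j) (gdir F tj) < 0 ->
  (forall m, m != i -> m != j -> contains F (n_ m) \/ forall t, ~ cross F (n_ m) t) ->
  forall t, tj <= t <= ti -> chamber (geo F t) /\
    forall l, cross F (n_ l) t -> [\/ l = i, l = j | contains F (n_ l)].
Proof.
move=> ch1 ci cj lt TT oth t /andP[tjt tti].
(* The opposite sign pattern would give both [t1 <= tj] and [ti <= t1]. *)
have Ti : 0 < mink (n_ i) (gdir F ti).
  rewrite ltNge; apply/negP => Ti0.
  have Ti1 : mink (n_ i) (gdir F ti) < 0.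
    by rewrite lt_neqAle Ti0 andbT; apply/eqP => e; rewrite e mul0r ltxx in TT.
  have Tj0 : 0 < mink (n_ j) (gdir F tj) by rewrite nmulr_rlt0 in TT.
  have := ch1 j; rewrite (cross_val _ cj) pmulr_lle0 // => /sh_le0 h1.
  have := ch1 i; rewrite (cross_val _ ci) nmulr_lle0 // -oppr_le0 -shN opprB => /sh_le0 h2.
  lra.
have Tj : mink (n_ j) (gdir F tj) < 0 by rewrite pmulr_rlt0 in TT.
split=> [m|l cl].
  have [->|mi] := eqVneq m i.
    rewrite (cross_val _ ci) pmulr_lle0 // -opprB shN oppr_le0.
    by apply: sh_ge0; lra.
  have [->|mj] := eqVneq m j.
    by rewrite (cross_val _ cj) nmulr_lle0 //; apply: sh_ge0; lra.
  have [c|nc] := oth m mi mj; first by rewrite ((containsE _ _).1 c t).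
  rewrite leNgt; apply/negP => pm; have nm := ch1 m.
  have [tt|tt] := lerP t1 t.
    have [|z [_ _ cz]] := @cross_ivt _ F (n_ m) t1 t tt; last exact: nc cz.
    by rewrite mulr_le0_ge0 // ltW.
  have [|z [_ _ cz]] := @cross_ivt _ F (n_ m) t t1 (ltW tt); last exact: nc cz.
  by rewrite mulr_ge0_le0 // ltW.
have [->|li] := eqVneq l i; first by constructor 1.
have [->|lj] := eqVneq l j; first by constructor 2.
by have [c|nc] := oth l li lj; [constructor 3 | case: (nc _ cl)].
Qed.

Lemma dihedral_pair F r r' i j ti tj D :
  same_class k r r' -> crosses F r 0 -> crosses F r' D -> ncomp F r = 0 -> ncomp F r' = 0 ->
  i != j -> tj < ti -> cross F (n_ i) ti -> cross F (n_ j) tj ->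
  ncomp F (n_ i) = 0 -> ncomp F (n_ j) = 0 ->
  (forall t, tj <= t <= ti -> chamber (geo F t) /\
    forall l, cross F (n_ l) t -> [\/ l = i, l = j | contains F (n_ l)]) ->
  exists g w, [/\ N g, wmx g = rw w, all (pred2 i j) w &
    forall t, foldr (line_refl i j ti tj) t w = t - 2 * D].
Proof.
move=> [g Ng eg] cr cr' nr nr' ij lt ci cj ni nj cham.
have [w aw ew] := crosses_dihedral ij lt ci cj ni nj cham cr.
have [w' aw' ew'] := crosses_dihedral ij lt ci cj ni nj cham cr'.
exists g, (w ++ w'); rewrite refl_word_cat -ew -ew' all_cat aw aw'; split=> // t.
apply: (@geo_inj _ F); rewrite -(line_refl_geo ij ci cj ni nj) ?all_cat ?aw ?aw' //.
rewrite refl_word_cat -ew -ew' -mulmxA.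
have [wr c0 _] := cr; have [wr' cD _] := cr'.
rewrite (wallrefl_geo _ (wall_unit wr') nr' cD) (wallrefl_geo _ (wall_unit wr) nr c0).
by congr geo; ring.
Qed.

(** No relation of W(k) links opposite sides, so the infinite dihedral action on the line factors
    through W(k), and [N] cannot translate. *)
Lemma opposite_sides_free i j ti tj g w D : i = j + 3 -> N g -> wmx g = rw w ->
  (forall t, foldr (line_refl i j ti tj) t w = t - 2 * D) -> D = 0.
Proof.
move=> ij Ng eg h.
have f1 l t : l != i -> l != j -> line_refl i j ti tj l t = t.
  by rewrite /line_refl => /negbTE-> /negbTE->.
have fK := @line_reflK R i j ti tj.
have fC := pair_action_comm f1.
have [] : [/\ j != i + 1, i != j + 1 &
    forall l, (l != i) && (l != j) || (l + 2 != i) && (l + 2 != j)].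
  rewrite ij; split; try by case: (j) => [[|[|[|[|[|[|//]]]]]] hi].
  by case: (j) => [[|[|[|[|[|[|//]]]]]] hi] [[|[|[|[|[|[|//]]]]]] hl].
move=> /fC /[apply] {}fC /(_ _)/(pair_action_rel fK f1 k_even) fk.
by have := N_acts_trivially fK fC fk 0 Ng eg; rewrite h; lra.
Qed.

(** The image of [line_refl] modulo [k]: the translation by [2 * (ti - tj)] becomes adding 1. *)
Definition zk_refl i j l (x : 'Z_k) : 'Z_k := if l == i then 1 - x else if l == j then - x else x.

Lemma fold_affine i j ti tj w : exists (b : bool) (m : int),
  (forall t, foldr (line_refl i j ti tj) t w = tj + (-1) ^+ b * (t - tj) + 2 * (ti - tj) * m%:~R) /\
  (forall x : 'Z_k, foldr (zk_refl i j) x w = (-1) ^+ b * x + m%:~R).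
Proof.
elim: w => [|l w [b [m [h1 h2]]]].
  by exists false, 0; split=> t /=; rewrite expr0 mulr0z !mul1r; ring.
have [li|li] := eqVneq l i.
  exists (~~ b), (1 - m); split=> t /=; rewrite ?h1 ?h2 /line_refl /zk_refl li eqxx signrN rmorphB /=; ring.
have [lj|lj] := eqVneq l j; last first.
  by exists b, m; split=> t /=; rewrite ?h1 ?h2 /line_refl /zk_refl (negbTE li) (negbTE lj).
exists (~~ b), (- m); split=> t /=; rewrite ?h1 ?h2 /line_refl /zk_refl (negbTE li) lj eqxx signrN rmorphN /=; ring.
Qed.

(** The action on Z/k satisfies the relations of W(k), so the word translates by [m] units with [k]
    dividing [m]; as [D = L |m|] is positive, it is at least [k L]. *)
Lemma even_sides_order i j ti tj g w D : i = j + 2 -> N g -> wmx g = rw w -> 0 < D ->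
  (forall t, foldr (line_refl i j ti tj) t w = t - 2 * D) -> `|ti - tj| = L -> k%:R * L <= D.
Proof.
move=> ij Ng eg D0 h EL; have [b [m [h1 h2]]] := fold_affine i j ti tj w.
have f1 l (x : 'Z_k) : l != i -> l != j -> zk_refl i j l x = x.
  by rewrite /zk_refl => /negbTE-> /negbTE->.
have fK l (x : 'Z_k) : zk_refl i j l (zk_refl i j l x) = x.
  by rewrite /zk_refl; case: (l == i); case: (l == j); rewrite ?subKr ?opprK.
have fC := pair_action_comm f1.
have [] : [/\ j != i + 1, i != j + 1 &
    forall l, l != j -> (l != i) && (l != j) || (l + 2 != i) && (l + 2 != j)].
  rewrite ij; split; try by case: (j) => [[|[|[|[|[|[|//]]]]]] hi].
  by case: (j) => [[|[|[|[|[|[|//]]]]]] hi] [[|[|[|[|[|[|//]]]]]] hl].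
move=> /fC /[apply] {}fC h3.
have fk l (x : 'Z_k) : iter k (zk_refl i j l \o zk_refl i j (l + 2)) x = x.
  have [->|/h3] := eqVneq l j; last by move/(pair_action_rel fK f1 k_even).
  have e (y : 'Z_k) : (zk_refl i j j \o zk_refl i j (j + 2)) y = y - 1.
    rewrite /= /zk_refl -ij eqxx ij; have [_ /negbTE n2 _ _ _] := z6_neq j.
    by rewrite eq_sym n2 eqxx; ring.
  have e' n : iter n (zk_refl i j j \o zk_refl i j (j + 2)) x = x - n%:R.
    by elim: n => [|n IH]; rewrite ?subr0 // iterS IH e -natr1; ring.
  rewrite e' (_ : k%:R = 0 :> 'Z_k) ?subr0 //; exact: pchar_Zp.
have := N_acts_trivially fK fC fk 0 Ng eg; rewrite h2 mulr0 add0r => m0.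
have := h tj; rewrite h1 subrr mulr0 addr0 => e.
have {}e : (ti - tj) * m%:~R = - D by lra.
have {}e : L * `|m|%:~R = D.
  by rewrite -EL intr_norm -normrM e normrN gtr0_norm.
have km : (k %| `|m|)%N.
  have {}m0 : (`|m|%N)%:R = 0 :> 'Z_k.
    by move: m0; case: (m) => n //=; rewrite NegzE rmorphN /= => /eqP; rewrite oppr_eq0 => /eqP.
  by have := congr1 val m0; rewrite /= val_Zp_nat // => /eqP.
have mk : (k <= `|m|)%N.
  apply: dvdn_leq => //; rewrite absz_gt0; apply/eqP => m00.
  by move: D0; rewrite -e m00 normr0 mulr0 ltxx.
rewrite -e mulrC ler_pM2l ?hexlen_gt0 //.
by rewrite -[`|m|]abszE -[X in _ <= X]/((`|m|%N)%:R) ler_nat.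
Qed.

End MinimalPair.

Lemma z6_add33 (i : 'Z_6) : i + 3 + 3 = i.
Proof. by apply/val_inj; case: i => [[|[|[|[|[|[|//]]]]]] hi]. Qed.

Lemma z6_add321 (i : 'Z_6) : i + 3 + 2 + 1 = i.
Proof. by apply/val_inj; case: i => [[|[|[|[|[|[|//]]]]]] hi]. Qed.

Lemma z6_add11 (i : 'Z_6) : i + 1 + 1 = i + 2.
Proof. by apply/val_inj; case: i => [[|[|[|[|[|[|//]]]]]] hi]. Qed.

Lemma z6_sub2 (i j : 'Z_6) : i + 2 = j + 3 -> i = j + 1.
Proof.
have e : j + 3 = j + 1 + 2 by apply/val_inj; case: j => [[|[|[|[|[|[|//]]]]]] hj].
by rewrite e => /addIr.
Qed.

(** * Minimal distance within a class *)

Section ClassDistance.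
Variables (R : realType) (k : nat).
Hypotheses (k_even : ~~ odd k) (k_gt1 : (1 < k)%N).
Implicit Types (v x y r q : 'cV[R]_3) (s t : R) (u w : seq 'Z_6) (i j l m : 'Z_6) (F : frame R).

Local Notation rw u := (refl_word R u).
Local Notation n_ i := (side_normal R i).
Local Notation L := (hexlen R).
Local Notation N := (sg_set (Nk R k)).

Lemma normal_table i j : i != j ->
  [\/ mink (n_ i) (n_ j) = -3 /\ i = j + 3,
      mink (n_ i) (n_ j) = -2 /\ (i = j + 2 \/ j = i + 2)
    | mink (n_ i) (n_ j) = 0 /\ (j = i + 1 \/ i = j + 1)].
Proof.
rewrite !side_normalE mink_lvec.
have -> : (-3 : R) = (-3)%:~R by []. have -> : (-2 : R) = (-2)%:~R by [].
case: i => [[|[|[|[|[|[|//]]]]]] hi]; case: j => [[|[|[|[|[|[|//]]]]]] hj] // _;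
  first [by constructor 1; split=> //; apply/val_inj
        |by constructor 2; split=> //; (left + right); apply/val_inj
        |by constructor 3; split=> //; (left + right); apply/val_inj].
Qed.

Lemma normal_perp i : mink (n_ i) (n_ (i + 1)) = 0.
Proof.
rewrite !side_normalE mink_lvec (_ : zform _ _ = 0) //.
by case: i => [[|[|[|[|[|[|//]]]]]] hi].
Qed.

Lemma normal_mink2 i : mink (n_ (i + 2)) (n_ i) = -2.
Proof.
rewrite !side_normalE mink_lvec (_ : zform _ _ = -2) //.
by case: i => [[|[|[|[|[|[|//]]]]]] hi].
Qed.

Lemma crosses_fmap u F v t : crosses (fmap u F) (rw u *m v) t <-> crosses F v t.
Proof.
split=> -[w c n]; split.
- by rewrite -(rw_revK u v); exact: wall_word.
- exact/(cross_fmap u).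
- by move/(contains_fmap u).
- exact: wall_word.
- exact/cross_fmap.
- by move/contains_fmap.
Qed.

Lemma line_refl_swap i j ti tj w t : i != j ->
  foldr (line_refl i j ti tj) t w = foldr (line_refl j i tj ti) t w.
Proof.
move=> ij; elim: w => //= l w ->; rewrite /line_refl.
by have [->|//] := eqVneq l i; rewrite (negbTE ij).
Qed.

Lemma opposite_perp F v v' s t : mink v v = 1 -> mink v' v' = 1 -> ncomp F v = 0 -> ncomp F v' = 0 ->
  cross F v s -> cross F v' t -> mink v v' < 0 ->
  mink v (gdir F s) * mink v' (gdir F t) = -1 /\ ch (t - s) = - mink v v'.
Proof.
move=> vv vv' n n' cs ct; rewrite (cross_mink cs ct) n mul0r add0r.
have := perp_dir_sqr vv n cs; have := perp_dir_sqr vv' n' ct; have := ch_ge1 (t - s).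
move: (mink v _) (mink v' _) (ch _) => T T' c c1 e' e h.
have TT : T * T' < 0 by move: h; rewrite pmulr_llt0 //; lra.
have : (T * T') ^+ 2 = 1 by rewrite exprMn e e' mulr1.
move/eqP; rewrite sqrf_eq1 => /orP[/eqP h1|/eqP h1]; first by lra.
by rewrite h1; split=> //; ring.
Qed.

Lemma chamber_contains F v t : wall v -> contains F v -> chamber (geo F t) ->
  exists l, contains F (n_ l).
Proof.
move=> wv cv ch; have sg := geo_sheet F t; have ct := (containsE _ _).1 cv t.
have [p|np] := boolP (pos v).
  by have [_ /(_ ct)[l e]] := chamber_pos wv p sg ch; exists l; rewrite -e.
have p : pos (- v) by rewrite posN //; exact: wall_latt.
have [_] := chamber_pos (wallN wv) p sg ch; rewrite minkNl ct oppr0 => /(_ erefl)[l e].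
by exists l; rewrite -e; exact/containsN.
Qed.

(** Along the line of side [j + 1], the two neighbouring sides are perpendicular to it at the ends
    of that side, and their product -2 gives the distance [L]. *)
Lemma wall_sides F j : contains F (n_ (j + 1)) -> exists ti tj,
  [/\ cross F (n_ (j + 2)) ti, cross F (n_ j) tj,
    ncomp F (n_ (j + 2)) = 0 /\ ncomp F (n_ j) = 0,
    mink (n_ (j + 2)) (gdir F ti) * mink (n_ j) (gdir F tj) = -1 & `|ti - tj| = L].
Proof.
move=> cl; have Nl := contains_ncomp (side_normal_unit R _) cl.
have n0 v : mink (n_ (j + 1)) v = 0 -> ncomp F v = 0.
  have [e1 e2] := (containsP F 0 _).1 cl.
  rewrite (parseval F 0) e1 e2 !mul0r addr0 subr0 => /eqP; rewrite mulf_eq0 => /orP[/eqP e|/eqP //].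
  by move: Nl; rewrite e expr0n => /eqP; rewrite eq_sym oner_eq0.
have ni : ncomp F (n_ (j + 2)) = 0 by apply: n0; rewrite -z6_add11 normal_perp.
have nj : ncomp F (n_ j) = 0 by apply: n0; rewrite minkC normal_perp.
have [ti ci] := perp_cross_exists (side_normal_unit R (j + 2)) ni.
have [tj cj] := perp_cross_exists (side_normal_unit R j) nj.
have [|TT e2] := opposite_perp (side_normal_unit R _) (side_normal_unit R j) ni nj ci cj.
  by rewrite normal_mink2; lra.
rewrite normal_mink2 opprK in e2.
by exists ti, tj; split=> //; rewrite distrC -arcosh_ch e2.
Qed.

(* Here the walls orthogonal to the axis are the images of two sides of a hexagon
   by a dihedral group, which maps to the dihedral group of order 2k. *)
Lemma pair_on_wall F r r' D l t : same_class k r r' -> crosses F r 0 -> crosses F r' D ->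
  ncomp F r = 0 -> ncomp F r' = 0 -> 0 < D -> chamber (geo F t) -> contains F (n_ l) ->
  k%:R * L <= D.
Proof.
move=> sc cr cr' nr nr' D0 ch cl.
have Nl := contains_ncomp (side_normal_unit R l) cl.
have ml v : mink (n_ l) v = ncomp F (n_ l) * ncomp F v.
  have [e1 e2] := (containsP F 0 _).1 cl.
  by rewrite (parseval F 0) e1 e2; ring.
pose j := l - 1; pose i := j + 2.
have lj : l = j + 1 by rewrite /j subrK.
have li : l + 1 = i by rewrite lj z6_add11.
have [|ti [tj [ci cj [ni nj] TT EL]]] := @wall_sides F j; first by rewrite -lj.
have ij : i != j by have [] := z6_neq j.
(* A side other than [l] and its neighbours has product at most -2 with [n_ l], so its [ncomp] is
   too large for a crossing. *)
have oth m : m != i -> m != j -> contains F (n_ m) \/ forall s, ~ cross F (n_ m) s.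
  move=> mi mj; have [->|ml'] := eqVneq m l; first by left.
  right=> s cs; have := cross_unit (side_normal_unit R m) cs.
  have h : ncomp F (n_ m) ^+ 2 = mink (n_ l) (n_ m) ^+ 2 by rewrite ml exprMn Nl mul1r.
  rewrite h; have := sqr_ge0 (mink (n_ m) (gdir F s)).
  rewrite eq_sym in ml'; have [[-> _]|[-> _]|[_ [e|e]]] := normal_table ml'; try lra.
  - by move: mi; rewrite e li eqxx.
  - by move: mj; rewrite /j e addrK eqxx.
have TTN : mink (n_ i) (gdir F ti) * mink (n_ j) (gdir F tj) < 0 by rewrite TT; lra.
have [lt|lt|e] := ltrgtP tj ti; last by move: EL; rewrite e subrr normr0; have := hexlen_gt0 R; lra.
  have [g [w [Ng eg _ h]]] := dihedral_pair sc cr cr' nr nr' ij lt ci cj ni nj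
    (interval_chamber ch ci cj lt TTN oth).
  exact: (even_sides_order k_even k_gt1 erefl Ng eg D0 h EL).
rewrite mulrC in TTN; rewrite eq_sym in ij.
have oth' m : m != j -> m != i -> contains F (n_ m) \/ forall s, ~ cross F (n_ m) s.
  by move=> mj mi; exact: oth.
have [g [w [Ng eg _ h]]] := dihedral_pair sc cr cr' nr nr' ij lt cj ci nj ni
  (interval_chamber ch cj ci lt TTN oth').
apply: (even_sides_order k_even k_gt1 (i := i) (j := j) (ti := ti) (tj := tj) erefl Ng eg D0 _ EL).
by move=> s; rewrite line_refl_swap 1?eq_sym.
Qed.

(* Here the axis joins opposite sides i and i + 3 of the hexagon, and the group
   generated by s_i and s_(i+3) is infinite in W(k). *)
Lemma pair_off_walls F r r' D t : same_class k r r' -> crosses F r 0 -> crosses F r' D ->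
  0 < t -> t < D -> chamber (geo F t) -> generic F t -> (forall v, wall v -> ~ contains F v) ->
  (forall v s, crosses F v s -> ncomp F v = 0) -> False.
Proof.
move=> sc cr cr' t0 tD ch ge nc perp.
have neg m : mink (n_ m) (geo F t) < 0.
  rewrite lt_neqAle ch andbT; apply/eqP => e.
  by apply: (nc (n_ m) (wall_normal R m)); apply: ge => //; exact: wall_normal.
have trans m s : cross F (n_ m) s -> crosses F (n_ m) s.
  by move=> c; split=> //; [exact: wall_normal | apply/nc/wall_normal].
(* Between the interior point at time [t] and any crossed wall the axis meets a side of the base
   tile. *)
have exit q s : crosses F q s -> s != t ->
    exists m z, [/\ cross F (n_ m) z, Num.min s t <= z & z <= Num.max s t].
  move=> [wq cq _] st; apply: contrapT => no.
  have ch' : chamber (geo F s).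
    move=> m; rewrite leNgt; apply/negP => h; apply: no.
    have [ts|ts] := lerP t s.
      have [|z [z1 z2 cz]] := @cross_ivt _ F (n_ m) t s ts; first by rewrite mulr_le0_ge0 // ltW.
      by exists m, z.
    have [|z [z1 z2 cz]] := @cross_ivt _ F (n_ m) s t (ltW ts); first by rewrite mulr_ge0_le0 // ltW.
    by exists m, z.
  have sg := geo_sheet F s.
  have [m cm] : exists m, cross F (n_ m) s.
    have [p|np] := boolP (pos q).
      by have [_ /(_ cq)[l e]] := chamber_pos wq p sg ch'; exists l; rewrite -e.
    have p : pos (- q) by rewrite posN //; exact: wall_latt.
    have [_] := chamber_pos (wallN wq) p sg ch'; rewrite minkNl cq oppr0 => /(_ erefl)[l e].
    by exists l; rewrite -e; exact/crossN.
  by apply: no; exists m, s; rewrite ge_min le_max lexx.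
have [i [ti [ci ti1 _]]] := exit _ _ cr' (ltac:(by rewrite gt_eqF)).
have [j [tj [cj _ tj1]]] := exit _ _ cr (ltac:(by rewrite lt_eqF)).
rewrite (min_r (ltW tD)) in ti1; rewrite (max_r (ltW t0)) in tj1.
have nt m : ~ cross F (n_ m) t by move=> e; have := neg m; rewrite e ltxx.
have {}ti1 : t < ti by rewrite lt_neqAle ti1 andbT; apply/eqP => e; apply: (nt i); rewrite e.
have {}tj1 : tj < t by rewrite lt_neqAle tj1 andbT; apply/eqP => e; apply: (nt j); rewrite -e.
have lt : tj < ti by lra.
have ij : i != j.
  by apply/eqP => e; have := crosses_uniq (trans _ _ ci); rewrite e => /(_ _ cj); lra.
have ni := perp _ _ (trans _ _ ci); have nj := perp _ _ (trans _ _ cj).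
have Ti : 0 < mink (n_ i) (gdir F ti).
  by have := neg i; rewrite (cross_val _ ci) nmulr_rlt0 // -opprB shN oppr_lt0; apply: sh_gt0; lra.
have Tj : mink (n_ j) (gdir F tj) < 0.
  by have := neg j; rewrite (cross_val _ cj) pmulr_rlt0 //; apply: sh_gt0; lra.
have TT : mink (n_ i) (gdir F ti) * mink (n_ j) (gdir F tj) < 0 by rewrite pmulr_rlt0.
have adj m p tp : cross F (n_ p) tp -> mink (n_ m) (n_ p) = 0 -> mink (n_ m) (gdir F tp) = 0.
  move=> cp; have np := perp _ _ (trans _ _ cp).
  rewrite (perp_gdir np cp) minkZr => /eqP; rewrite mulf_eq0 => /orP[/eqP e|/eqP //].
  by have := perp_dir_sqr (side_normal_unit R p) np cp; rewrite e expr0n => /eqP; rewrite eq_sym oner_eq0.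
have titj : ti <> tj by move=> e; lra.
have mid m : mink (n_ m) (n_ i) = 0 -> mink (n_ m) (n_ j) = 0 -> False.
  move=> /(adj _ _ _ ci) e1 /(adj _ _ _ cj) e2.
  exact: (nc (n_ m) (wall_normal R m)) (contains_gdir e1 e2 titj).
(* If [i] and [j] were two apart, their common neighbour would contain the axis by [mid]; if
   adjacent, their product would be 0, while [cross_mink] makes it nonzero. *)
have e3 : i = j + 3.
  have [[_ //]|[_ [e|e]]|[e _]] := normal_table ij.
  - case: (mid (j + 1)); last by rewrite minkC normal_perp.
    by rewrite e -z6_add11 normal_perp.
  - case: (mid (i + 1)); first by rewrite minkC normal_perp.
    by rewrite e -z6_add11 normal_perp.
  - exfalso; have := cross_mink ci cj; rewrite e ni mul0r add0r => /esym/eqP.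
    rewrite mulf_eq0 => /orP[/eqP h|/eqP h]; first by rewrite h ltxx in TT.
    by have := ch_ge1 (tj - ti); rewrite h; lra.
(* Each remaining side is adjacent to [i] or [j], thus orthogonal to it; two perpendiculars to one
   axis have nonzero product. *)
have oth m : m != i -> m != j -> contains F (n_ m) \/ forall s, ~ cross F (n_ m) s.
  move=> mi mj; right=> s cs.
  have nm := perp _ _ (trans _ _ cs).
  have Tm := perp_dir_sqr (side_normal_unit R m) nm cs.
  have no p tp : cross F (n_ p) tp -> mink (n_ m) (n_ p) = 0 -> False.
    move=> cp e; have := adj _ _ _ cs (etrans (minkC _ _) e).
    have np := perp _ _ (trans _ _ cp); have Tp := perp_dir_sqr (side_normal_unit R p) np cp.
    have := cross_mink cs cp; rewrite e nm mul0r add0r => /esym/eqP.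
    rewrite mulf_eq0 mulf_eq0 => /orP[/orP[]|] /eqP h.
    - by move: Tm; rewrite h expr0n => /eqP; rewrite eq_sym oner_eq0.
    - by move: Tp; rewrite h expr0n => /eqP; rewrite eq_sym oner_eq0.
    - by have := ch_ge1 (tp - s); rewrite h; lra.
  have [] : mink (n_ m) (n_ i) = 0 \/ mink (n_ m) (n_ j) = 0; last 2 first.
  - exact: no ci.
  - exact: no cj.
  have [[_ mi3]|[_ [m2|m2]]|[-> _]] := normal_table mi; last by left.
  - by move: mj; rewrite mi3 e3 z6_add33 eqxx.
  - by right; rewrite -(z6_add321 j) -e3 -m2 normal_perp.
  - by right; rewrite (z6_sub2 (etrans (esym m2) e3)) minkC normal_perp.
have nr := perp _ _ cr; have nr' := perp _ _ cr'.
have [g [w [Ng eg _ h]]] := dihedral_pair sc cr cr' nr nr' ij lt ci cj ni nj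
    (interval_chamber ch ci cj lt TT oth).
by have := opposite_sides_free k_even e3 Ng eg h; lra.
Qed.

(* Minimality forces equality in N_translation_pair, so that every wall crossing
   the common perpendicular is orthogonal to it. *)
Lemma minimal_pair r r' : wall r -> wall r' -> apart r r' -> same_class k r r' ->
  (forall v v', wall v -> wall v' -> apart v v' -> same_class k v v' -> `|mink r r'| <= `|mink v v'|) ->
  ch (k%:R * L) <= `|mink r r'| /\ exists v, [/\ wall v, mink v r = 0 & mink v r' = 0].
Proof.
move=> wr wr' ap sc min; have rr := wall_unit wr; have rr' := wall_unit wr'.
have [F [D [D0 eD c c' [nr nr']]]] := common_perp rr rr' (same_class_ge2 k_even wr wr' ap sc).
have nc v : mink v v = 1 -> ncomp F v = 0 -> ~ contains F v.
  by move=> vv nv /(contains_ncomp vv); rewrite nv expr0n => /eqP; rewrite eq_sym oner_eq0.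
have cr : crosses F r 0 by split=> //; exact: nc.
have cr' : crosses F r' D by split=> //; exact: nc.
have [g Ng eg] := same_class_sym rr rr' sc.
have trans t : wmx g *m geo F t = geo F (t + 2 * D).
  rewrite eg -mulmxA (wallrefl_geo _ rr nr c) (wallrefl_geo _ rr' nr' c').
  by congr geo; ring.
have perp v s : crosses F v s -> ncomp F v = 0.
  move=> cv; have [wv cvs _] := cv.
  have D20 : 0 < 2 * D by lra.
  (* With period [2 * D] and class distance [D] both bounds on the gap equal [D]. *)
  have [|v' [s' [sc' ap' cv' d1 d2]]] := @N_translation_pair _ _ _ _ _ trans D20 D v s Ng D0 _ cv.
    by move=> a b wa wb; rewrite eD; exact: min.
  have [wv' cvs' _] := cv'.
  have eDs : `|s' - s| = D by lra.
  have [||//] := cross_perp (wall_unit wv) (wall_unit wv') cvs cvs'.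
    by move=> e; move: eDs; rewrite e subrr normr0; lra.
  by rewrite -ch_norm eDs eD; exact: min.
have kD : k%:R * L <= D /\ exists2 v, wall v & contains F v.
  have [[v wv cv]|no] := pselect (exists2 v, wall v & contains F v).
    split; last by exists v.
    have [u cu] := tiling (geo_sheet F 0); rewrite -geo_fmap in cu.
    have [l cl] := chamber_contains (wall_word u wv) ((contains_fmap u F v).2 cv) cu.
    apply: (pair_on_wall (same_class_word u sc) ((crosses_fmap u F r 0).2 cr)
      ((crosses_fmap u F r' D).2 cr') _ _ D0 cu cl); exact: ncomp0_fmap.
  exfalso; have [t [t0 tD ge]] := generic_exists F D0.
  have [u cu] := tiling (geo_sheet F t); rewrite -geo_fmap in cu.
  have back v : v = rw u *m (rw (rev u) *m v) by rewrite rw_revVK.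
  apply: (pair_off_walls (same_class_word u sc) ((crosses_fmap u F r 0).2 cr)
      ((crosses_fmap u F r' D).2 cr') t0 tD cu).
  - move=> v wv; rewrite (back v) => /cross_fmap h; apply/contains_fmap; apply: ge => //.
    exact: wall_word.
  - move=> v wv; rewrite (back v) => /contains_fmap h; apply: no.
    by exists (rw (rev u) *m v) => //; exact: wall_word.
  - by move=> v s; rewrite (back v) => /crosses_fmap /perp; exact: ncomp0_fmap.
have [kLD [v wv cv]] := kD; split.
  rewrite -eD; apply: ler_ch; rewrite !ger0_norm ?(ltW D0) //.
  by rewrite mulr_ge0 // ltW // hexlen_gt0.
by exists v; split=> //; apply: (contains_perp 0 cv).
Qed.

(** A minimal pair exists because the products are integers. In the equality case [r], [r'] is
    itself minimal. *)
Lemma same_class_dist r r' : wall r -> wall r' -> apart r r' -> same_class k r r' ->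
  ch (k%:R * L) <= `|mink r r'| /\
  (`|mink r r'| = ch (k%:R * L) -> exists v, [/\ wall v, mink v r = 0 & mink v r' = 0]).
Proof.
move=> wr wr' ap sc.
pose P n := `[< exists r r', [/\ wall r, wall r', apart r r', same_class k r r' &
  `|mink r r'| = n%:R :> R] >].
have Pint v v' : wall v -> wall v' -> apart v v' -> same_class k v v' ->
    exists2 n, P n & `|mink v v'| = n%:R.
  move=> wv wv' a s; have [z e] := wall_int wv wv'.
  have e' : `|mink v v'| = (`|z|%N)%:R by rewrite e -intr_norm -abszE.
  by exists `|z|%N => //; apply/asboolP; exists v, v'.
have [n0 Pn0 e0] := Pint _ _ wr wr' ap sc.
have [n /asboolP[v [v' [wv wv' a s en]]] min] := ex_minnP (ex_intro P n0 Pn0).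
have lb (a1 b1 : 'cV[R]_3) : wall a1 -> wall b1 -> apart a1 b1 -> same_class k a1 b1 -> n%:R <= `|mink a1 b1|.
  by move=> w1 w2 a2 s2; have [m Pm ->] := Pint _ _ w1 w2 a2 s2; rewrite ler_nat min.
have [h _] : ch (k%:R * L) <= `|mink v v'| /\ exists q, [/\ wall q, mink q v = 0 & mink q v' = 0].
  by apply: minimal_pair => // a1 b1; rewrite en; exact: lb.
split; first by apply: le_trans h _; rewrite en; exact: lb.
move=> e; have [|] // := minimal_pair wr wr' ap sc.
by move=> a1 b1 w1 w2 a2 s2; rewrite e; apply: le_trans h _; rewrite en; exact: lb.
Qed.

End ClassDistance.

(** * Translation lengths *)

Section Displacement.
Variable R : realType.
Implicit Types (v x y r : 'cV[R]_3) (s t : R) (u w : seq 'Z_6) (F : frame R).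

Local Notation rw u := (refl_word R u).
Local Notation n_ i := (side_normal R i).
Local Notation L := (hexlen R).

Lemma sheet_orth_null v x : on_sheet x -> mink v v = 0 -> mink v x = 0 -> v = 0.
Proof.
move=> sx vv vx; have [v0|v0|v0] := ltrgtP (v 0 0) 0.
- have : mink (- v) x < 0.
    by apply: causal_lt0 => //; rewrite ?minkNl ?minkNr ?vv ?oppr0 // [(- v) 0 0]mxE oppr_gt0.
  by rewrite minkNl vx oppr0 ltxx.
- have : mink v x < 0 by apply: causal_lt0 => //; rewrite vv.
  by rewrite vx ltxx.
move: vv; rewrite minkE v0 mul0r oppr0 add0r -!expr2 => /eqP.
rewrite paddr_eq0 ?sqr_ge0 // !sqrf_eq0 => /andP[/eqP v1 /eqP v2].
by apply: cV3_ext; rewrite ?v0 ?v1 ?v2 mxE.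
Qed.

Lemma sheet_eq x y : on_sheet x -> on_sheet y -> mink x y = -1 -> x = y.
Proof.
move=> sx sy e; apply/eqP; rewrite -subr_eq0; apply/eqP; apply: (sheet_orth_null sx).
  by rewrite !mink_bilE (minkC y x) e (sheet_norm sx) (sheet_norm sy); ring.
by rewrite !mink_bilE (minkC y x) e (sheet_norm sx); ring.
Qed.

Lemma frame_through x y (a b : R) : on_sheet x -> on_sheet y -> a <> b -> mink x y = - ch (b - a) ->
  exists F, geo F a = x /\ geo F b = y.
Proof.
move=> sx sy ab e; have xx := sheet_norm sx; have yy := sheet_norm sy.
have S0 : sh (b - a) != 0 by apply: sh_neq0; rewrite subr_eq0; apply/eqP => h; exact: ab.
have cs := ch2_sh2 (b - a); have ca := ch2_sh2 a.
pose d := (sh (b - a))^-1 *: (y - ch (b - a) *: x).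
have dd : mink d d = 1.
  rewrite /d !mink_bilE xx yy (minkC y x) e.
  transitivity ((sh (b - a))^-1 ^+ 2 * (ch (b - a) ^+ 2 - 1)); first by ring.
  have -> : ch (b - a) ^+ 2 - 1 = sh (b - a) ^+ 2 by lra.
  by rewrite -exprMn mulVf ?expr1n.
have xd : mink x d = 0 by rewrite /d !mink_bilE xx e; ring.
have ey : y = ch (b - a) *: x + sh (b - a) *: d.
  by rewrite /d scalerA mulfV // scale1r addrC subrK.
move: d dd xd ey => d dd xd ey.
pose p := ch a *: x - sh a *: d; pose q := ch a *: d - sh a *: x.
have pp : mink p p = -1.
  by rewrite /p !mink_bilE xx dd (minkC d x) xd; lra.
have qq : mink q q = 1.
  by rewrite /q !mink_bilE xx dd (minkC d x) xd; lra.
have pq : mink p q = 0.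
  by rewrite /p /q !mink_bilE xx dd (minkC d x) xd; ring.
have sp : on_sheet p.
  apply: same_sheet sx pp _; rewrite /p !mink_bilE xx (minkC d x) xd.
  by have := ch_ge1 a; lra.
exists (Frame (And3 sp qq pq)); rewrite /geo /= /p /q.
have h (A B : R) : A *: (ch a *: x - sh a *: d) + B *: (ch a *: d - sh a *: x)
    = (A * ch a - B * sh a) *: x + (B * ch a - A * sh a) *: d.
  by apply: cV3_ext; rewrite !mxE; ring.
by rewrite !h ey -!chB -!shB subrr ch0 sh0 scale0r addr0 scale1r.
Qed.

(** Both lines meet the segment from [x] to [y], so [cross_le] applies; when [x = y] they meet at
    that point. *)
Lemma separation_le x y r r' : on_sheet x -> on_sheet y -> mink r r = 1 -> mink r' r' = 1 ->
  mink r x <= 0 -> 0 <= mink r y -> mink r' x <= 0 -> 0 <= mink r' y ->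
  `|mink r r'| <= - mink x y.
Proof.
move=> sx sy rr rr' rx ry r'x r'y; have xy := sheet_mink_le sx sy.
have [e|ne] := eqVneq (mink x y) (-1).
  have exy := sheet_eq sx sy e; rewrite -exy in ry r'y; rewrite e opprK.
  by apply: meet_mink_le1 sx rr rr' _ _; apply/eqP; rewrite eq_le; apply/andP.
pose D := arcosh (- mink x y); have eD : ch D = - mink x y by apply: ch_arcosh; lra.
have D0 : 0 < D.
  rewrite lt_neqAle arcosh_ge0 ?andbT; last by lra.
  by apply/eqP => e; move: eD; rewrite -e ch0 => h; move: ne; rewrite h opprK eqxx.
have [||F [F0 FD]] := @frame_through x y 0 D sx sy.
- by move=> e; rewrite -e ltxx in D0.
- by rewrite subr0 eD opprK.
rewrite -F0 in rx r'x; rewrite -FD in ry r'y.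
have [s [s0 sD cs]] := cross_ivt (ltW D0) (mulr_le0_ge0 rx ry).
have [t [t0 tD ct]] := cross_ivt (ltW D0) (mulr_le0_ge0 r'x r'y).
rewrite -eD; apply: le_trans (cross_le rr rr' cs ct) _; apply: ler_ch.
rewrite [`|D|]gtr0_norm // ler_norml; apply/andP; split; lra.
Qed.

Lemma contains_eq F v v' : wall v -> wall v' -> contains F v -> contains F v' -> ~ apart v v'.
Proof.
move=> wv wv' c c' ap; have := three_apart wv wv' wv ap.
have cv := (containsE _ _).1 c 0; have cv' := (containsE _ _).1 c' 0.
have := parseval F 0 v v'; have [e1 e2] := (containsP F 0 _).1 c.
have [e1' e2'] := (containsP F 0 _).1 c'; rewrite e1 e2 mul0r mul0r addr0 subr0 => e.
have n1 := contains_ncomp (wall_unit wv) c; have n2 := contains_ncomp (wall_unit wv') c'.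
have sq : mink v v' ^+ 2 = 1 by rewrite e exprMn n1 n2 mulr1.
move=> _; have [h|h] := wall_apart wv wv' ap.
  by move: sq; rewrite h expr0n => /eqP; rewrite eq_sym oner_eq0.
have := sqr_ge0 (`|mink v v'| - 2); have : `|mink v v'| ^+ 2 = 1 by rewrite real_normK ?num_real.
nra.
Qed.

Lemma crossing_list_exists F (a b : R) (s : seq 'cV[R]_3) : a <= b -> uniq s ->
  (forall v, v \in s -> [/\ wall v, mink v (geo F a) <= 0 & 0 <= mink v (geo F b)]) ->
  (forall v v', v \in s -> v' \in s -> v <> v' -> apart v v') ->
  (forall v, v \in s -> ~ contains F v) ->
  exists l, [/\ crossing_list F l, size l = size s & forall p, p \in l -> a <= p.2 <= b].
Proof.
move=> ab us ws as_ nc.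
have h v : exists t, v \in s -> [/\ a <= t, t <= b & cross F v t].
  have [vs|] := boolP (v \in s); last by exists 0.
  have [_ v1 v2] := ws v vs; have [t ht] := cross_ivt ab (mulr_le0_ge0 v1 v2).
  by exists t.
have [tm htm] := choice h.
pose leT (p q : 'cV[R]_3 * R) := p.2 <= q.2.
exists (sort leT [seq (v, tm v) | v <- s]); split.
- split.
  + by rewrite sort_uniq map_inj_uniq // => v v' [].
  + by apply: sort_sorted => p q; exact: le_total.
  + move=> p; rewrite mem_sort => /mapP[v vs ->] /=; have [_ _ c] := htm v vs.
    by have [wv _ _] := ws v vs; split=> //; exact: nc.
  + move=> p q; rewrite !mem_sort => /mapP[v vs ->] /mapP[v' vs' ->] /= ne.
    by apply: as_ => // e; apply: ne; rewrite e.
- by rewrite size_sort size_map.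
- move=> p; rewrite mem_sort => /mapP[v vs ->] /=.
  by have [-> -> _] := htm v vs.
Qed.

Lemma size_crossings u : size (crossings R u) = size u.
Proof. by elim: u => //= i u IH; rewrite size_map IH. Qed.

Lemma det_word u : \det (rw u) = (-1) ^+ size u.
Proof.
elim: u => [|i u IH]; first by rewrite refl_word_nil det1.
by rewrite refl_word_cons det_mulmx det_refl IH /= exprS.
Qed.

End Displacement.

Section SurfaceGroup.
Variables (R : realType) (k : nat) (H : subgroup (Wk R k)).
Hypotheses (k_ge4 : (4 <= k)%N) (k_even : ~~ odd k) (H_plus : H `<=` Wplus R k)
  (H_ball : forall w : Wk R k,
     [set (w * h * w^-1)%g | h in H] `&` wball (4 * k) = [set 1%g]).
Implicit Types (v x y r : 'cV[R]_3) (s t : R) (u w : seq 'Z_6) (F : frame R) (g : Winf R).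

Local Notation rw u := (refl_word R u).
Local Notation n_ i := (side_normal R i).
Local Notation L := (hexlen R).
Local Notation N := (sg_set (Nk R k)).

(* The fundamental group of the surface H(k)/H, acting on the hyperbolic plane. *)
Definition deck g : Prop := sg_set H (coset (Nk R k) g).

Lemma deck_det g : deck g -> \det (wmx g) = 1.
Proof. by move=> /H_plus; rewrite /Wplus /= eps_coset. Qed.

Lemma wordlen_le (c : Wk R k) u : c = (\prod_(i <- u) sgen R k i)%g -> (wordlen c <= size u)%N.
Proof.
move=> e; rewrite /wordlen; case: ex_minnP => m _; apply.
by apply/asboolP; exists u.
Qed.

(** The determinant gives the parity. A word of length at most [4 k] puts a conjugate of an element
    of [H] into the ball, so this element is 1 and [g] is in [N]. *)
Lemma deck_conj g u w : rw w = rw (rev u) * wmx g * rw u -> deck g ->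
  ~~ odd (size w) /\ (N g \/ (4 * k < size w)%N).
Proof.
move=> ew Gg; split.
  have : \det (rw w) = 1.
    rewrite ew !det_mulmx deck_det // mulr1 -det_mulmx.
    by rewrite (_ : rw (rev u) *m rw u = 1) ?det1 //; exact: refl_word_rev.
  rewrite det_word -signr_odd; case: (odd _) => //=; rewrite expr1; lra.
have [lt|le] := ltnP (4 * k) (size w); [by right | left].
pose c := coset (Nk R k) (winf_word R u)^-1%g.
have : (c * coset (Nk R k) g * c^-1)%g \in [set 1%g : Wk R k].
  rewrite -(H_ball c) inE; split; first by exists (coset (Nk R k) g).
  rewrite /wball /=; apply: leq_trans le; apply: wordlen_le.
  rewrite -coset_winf_word.
  have -> : (c^-1)%g = coset (Nk R k) (winf_word R u).
    by apply: mulg1_eq; rewrite /c -cosetM mulVg.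
  rewrite /c -!cosetM; congr coset; apply: wmx_inj.
  by rewrite !wmxM -winf_word_rev !wmx_word ew.
rewrite inE /= => e; apply/coset_eq1.
have : (c * coset (Nk R k) g)%g = c by rewrite -[RHS]mul1g -e mulgVK.
by move=> h; apply: (mulgI c); rewrite mulg1.
Qed.

(** The length of [w] is even; 0 would give [g = 1], and 2 would put a product of two generators
    into [N], which types forbid unless the generators are equal. *)
Lemma crossings_three g x : on_sheet x -> deck g -> g <> 1%g ->
  exists v1 v2 v3, [/\ apart v1 v2, apart v1 v3, apart v2 v3 &
    forall v, [\/ v = v1, v = v2 | v = v3] ->
      [/\ wall v, mink v x <= 0 & 0 <= mink v (wmx g *m x)] ].
Proof.
move=> sx Gg g1; have [u [w [rdw ew wk _]]] := sep_walls g sx.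
have [ev big] := deck_conj ew Gg; have us := reduced_uniq rdw.
have sz : (2 < size w)%N.
  case: big => [Ng|]; last by move=> h; apply: leq_trans h; lia.
  case: w rdw ew ev us {wk} => [|a [|b [|c w]]] //= rdw ew _ _.
    case: g1; apply: wmx_inj; rewrite wmx1.
    have := congr1 (fun M => rw u * M * rw (rev u)) ew.
    rewrite refl_word_nil mulr1 rwVK -!mulrA rwVK mulr1 mulrA rwVK mul1r; by [].
  have ab : a = b.
    apply: (@same_class_type R k k_even [::] [::]).
    rewrite !refl_word_nil !mul1mx; exists ((winf_word R u)^-1 * g * (winf_word R u)^-1^-1)%g; first exact: ns_conj.
    by rewrite invgK -winf_word_rev !wmxM !wmx_word -ew !refl_word_cons refl_word_nil mulr1.
  by move: rdw; rewrite ab mem_head.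
have : (2 < size (crossings R w))%N by rewrite size_crossings.
case e : (crossings R w) us wk => [|v1 [|v2 [|v3 s]]] //= us wk _.
have ap v v' : v \in crossings R w -> v' \in crossings R w -> v != v' -> apart (rw u *m v) (rw u *m v').
  move=> vw v'w ne; apply: apart_word.
  have [p _] := reduced_pos rdw vw; have [p' _] := reduced_pos rdw v'w.
  by apply: pos_apart => //; [exact/wall_latt/(crossings_wall vw) | exact/eqP].
move: us; rewrite !inE !negb_or => /and4P[/and3P[n12 n13 _] /andP[n23 _] _ _].
exists (rw u *m v1), (rw u *m v2), (rw u *m v3); split; try by apply: ap; rewrite // e !inE eqxx ?orbT.
by move=> v [] ->; apply: wk; rewrite !inE eqxx ?orbT.
Qed.

(** As [2 = ch L], every point is moved by at least [L]: two of the three separating walls are that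
    far apart. *)
Lemma deck_displacement g x : on_sheet x -> deck g -> g <> 1%g -> mink x (wmx g *m x) <= -2.
Proof.
move=> sx Gg g1; have [v1 [v2 [v3 [a12 a13 a23 h]]]] := crossings_three sx Gg g1.
have [w1 b1 c1] := h v1 (Or31 _ _ erefl).
have [w2 b2 c2] := h v2 (Or32 _ _ erefl).
have [w3 b3 c3] := h v3 (Or33 _ _ erefl).
have sg : on_sheet (wmx g *m x) by have [u ->] := wmxP g; exact: on_sheet_word.
have sep v v' := @separation_le R x (wmx g *m x) v v' sx sg.
have [k12|k13|k23] := three_apart w1 w2 w3 a12 a13 a23.
- by have := sep _ _ (wall_unit w1) (wall_unit w2) b1 c1 b2 c2; lra.
- by have := sep _ _ (wall_unit w1) (wall_unit w3) b1 c1 b3 c3; lra.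
- by have := sep _ _ (wall_unit w2) (wall_unit w3) b2 c2 b3 c3; lra.
Qed.

(** Two walls of one class are [k L] apart both ways round the period. Equality makes them
    perpendicular to the axis and at minimal class distance, so the wall [q] orthogonal to both
    contains the axis. *)
Lemma translation_N F g l : N g -> 0 < l -> deck g -> (forall t, wmx g *m geo F t = geo F (t + l)) ->
  (2 * k)%:R * L <= l /\ (l = (2 * k)%:R * L -> exists2 v, wall v & contains F v).
Proof.
move=> Ng l0 Gg trans; have k0 : 0 < k%:R * L.
  by rewrite mulr_gt0 ?hexlen_gt0 // ltr0n; lia.
have g1 : g <> 1%g.
  by move=> e; have := trans 0; rewrite e wmx1 mul1mx => /geo_inj; lra.
have [v1 [v2 [v3 [a12 _ _ h]]]] := crossings_three (geo_sheet F 0) Gg g1.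
have [w1 b1 c1] := h v1 (Or31 _ _ erefl).
have [w2 b2 c2] := h v2 (Or32 _ _ erefl).
have [v [[wv b c] ncv]] : exists v, [/\ wall v, mink v (geo F 0) <= 0 & 0 <= mink v (wmx g *m geo F 0)] /\ ~ contains F v.
  have [k1|] := pselect (contains F v1); last by exists v1.
  by exists v2; split=> // k2; exact: contains_eq w1 w2 k1 k2 a12.
rewrite trans add0r in c; have [s [_ _ cs]] := cross_ivt (ltW l0) (mulr_le0_ge0 b c).
have cv : crosses F v s by [].
have k1 : (1 < k)%N by lia.
have dist a a' wa wa' ap sc := (@same_class_dist R k k_even k1 a a' wa wa' ap sc).1.
have [v' [s' [sc ap cv' d1 d2]]] := N_translation_pair trans l0 Ng k0 dist cv.
have e2k : (2 * k)%:R * L = k%:R * L + k%:R * L by rewrite natrM; ring.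
split; first by lra.
move=> el; have eds : `|s' - s| = k%:R * L by lra.
have [wv' cs' _] := cv'; have uv := wall_unit wv; have uv' := wall_unit wv'.
have ss : s <> s' by move=> e; move: eds; rewrite e subrr normr0; lra.
have le1 := cross_le uv uv' cs cs'; rewrite -ch_norm eds in le1.
have [ge1 eqc] := same_class_dist k_even k1 wv wv' ap sc.
have [|q [wq q1 q2]] := eqc; first by apply/eqP; rewrite eq_le le1 ge1.
have [|n n'] := cross_perp uv uv' cs cs' ss; first by rewrite -ch_norm eds.
exists q => //.
have dir a p : mink a a = 1 -> ncomp F a = 0 -> cross F a p -> mink q a = 0 -> mink q (gdir F p) = 0.
  move=> aa na ca; rewrite (perp_gdir na ca) minkZr => /eqP; rewrite mulf_eq0 => /orP[/eqP e|/eqP //].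
  by have := perp_dir_sqr aa na ca; rewrite e expr0n => /eqP; rewrite eq_sym oner_eq0.
exact: contains_gdir (dir _ _ uv n cs q1) (dir _ _ uv' n' cs' q2) ss.
Qed.

Lemma translation_ge F g l : 0 < l -> deck g -> (forall t, wmx g *m geo F t = geo F (t + l)) ->
  (2 * k)%:R * L <= l /\ (l = (2 * k)%:R * L -> exists2 v, wall v & contains F v).
Proof.
move=> l0 Gg trans; have [Ng|nN] := pselect (N g); first exact: translation_N Ng l0 Gg trans.
have [u [w [rdw ew wk _]]] := sep_walls g (geo_sheet F 0).
have [ev [//|sz]] := deck_conj ew Gg; have us := reduced_uniq rdw.
have inj : injective (mulmx (rw u) : 'cV[R]_3 -> 'cV[R]_3).
  by move=> a b /(congr1 (mulmx (rw (rev u)))); rewrite !rw_revK.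
pose s := [seq rw u *m v | v <- crossings R w].
have uniq_s : uniq s by rewrite map_inj_uniq.
have size_s : size s = size w by rewrite size_map size_crossings.
have ws v : v \in s -> [/\ wall v, mink v (geo F 0) <= 0 & 0 <= mink v (geo F l)].
  by move=> /mapP[v' v'w ->]; have := wk v' v'w; rewrite trans add0r.
have ap v v' : v \in s -> v' \in s -> v <> v' -> apart v v'.
  move=> /mapP[a aw ->] /mapP[b bw ->] ne; apply: apart_word.
  have [p _] := reduced_pos rdw aw; have [p' _] := reduced_pos rdw bw.
  apply: pos_apart => //; first exact/wall_latt/(crossings_wall aw).
  by move=> e; apply: ne; rewrite e.
(* By parity there are at least [4 k + 2] separating walls. At most one contains the axis; without
   it [4 k + 1] crossings remain, and if there is none the strict bound applies. *)
have [[v0 v0s c0]|no] := pselect (exists2 v, v \in s & contains F v).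
  split; last by exists v0 => //; have [] := ws _ v0s.
  have sub v : v \in rem v0 s -> v \in s /\ v <> v0.
    by rewrite mem_rem_uniq // inE => /andP[/eqP].
  have [||||l' [cl sl bl]] := @crossing_list_exists R F 0 l (rem v0 s) (ltW l0).
  - exact: rem_uniq.
  - by move=> v /sub[/ws].
  - by move=> v v' /sub[a _] /sub[b _]; exact: ap.
  - move=> v /sub[a ne] c; have [wa _ _] := ws _ a; have [wb _ _] := ws _ v0s.
    exact: contains_eq wa wb c c0 (ap _ _ a v0s ne).
  have := crossing_list_len (j := 2 * k) cl bl; rewrite add0r; apply.
  by rewrite sl size_rem // size_s; lia.
have [|l' [cl sl bl]] := @crossing_list_exists R F 0 l s (ltW l0) uniq_s ws ap.
  by move=> v vs c; apply: no; exists v.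
have ek : (2 * k)%N = (2 * k).-1.+1 by lia.
have := crossing_list_len_strict (j := (2 * k).-1) cl bl; rewrite -ek add0r => h.
have {}h : (2 * k)%:R * L < l by apply: h; rewrite sl size_s; move: ev; lia.
by split; lra.
Qed.

End SurfaceGroup.

(** * The quotient surface *)

Section ContinuousInduction.
Variable R : realType.
Implicit Types (I A : R -> Prop) (s t u v e : R).

Let induction_up I A t0 : is_interval I -> I t0 -> A t0 ->
  (forall t, I t -> exists2 e, 0 < e & forall u v, I u -> I v -> `|u - t| < e -> `|v - t| < e ->
    A u -> A v) ->
  forall t, I t -> t0 <= t -> A t.
Proof.
move=> itv I0 A0 loc t It t0t.
pose S : set R := [set s | t0 <= s <= t /\ A s].
have S0 : S t0 by split; rewrite ?lexx.
have ubt : ubound S t by move=> s [/andP[]].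
have hs : has_sup S by split; [exists t0 | exists t].
have st : sup S <= t by apply: ge_sup => //; exists t0.
have ts : t0 <= sup S by apply: ub_le_sup => //; case: hs.
have Is : I (sup S) by apply: (itv t0 t) => //; rewrite ts st.
have [e e0 he] := loc _ Is.
have [s [/andP[s0 sT] As] sS] := sup_adherent e0 hs.
have sup_s : s <= sup S by apply: ub_le_sup => //; [case: hs | split; rewrite ?s0].
have near_s : `|s - sup S| < e by rewrite ltr_norml; apply/andP; split; lra.
have Iss : I s by apply: (itv t0 t) => //; rewrite s0 sT.
have [e_t|lt] := eqVneq (sup S) t.
  by apply: (he s t) => //; rewrite e_t subrr normr0.
pose v := Num.min (sup S + e / 2) t.
have vS : sup S < v.
  by rewrite lt_min ltrDl divr_gt0 //= lt_neqAle lt st.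
have [vt ve] : v <= t /\ v <= sup S + e / 2 by rewrite !ge_min !lexx orbT.
have : S v.
  split; first by rewrite vt andbT; lra.
  apply: (he s v) => //; first by apply: (itv t0 t) => //; rewrite vt andbT; lra.
  by rewrite ltr_norml; apply/andP; split; lra.
move=> /(ub_le_sup (proj2 hs)); lra.
Qed.

(** Connectedness of an interval as an induction principle: a property that propagates between all
    points near any given point holds throughout. *)
Lemma interval_induction I A t0 : is_interval I -> I t0 -> A t0 ->
  (forall t, I t -> exists2 e, 0 < e & forall u v, I u -> I v -> `|u - t| < e -> `|v - t| < e ->
    A u -> A v) ->
  forall t, I t -> A t.
Proof.
move=> itv I0 A0 loc t It; have [|lt] := lerP t0 t; first exact: induction_up loc t It.
have := @induction_up (fun x => I (- x)) (fun x => A (- x)) (- t0) _ _ _ _ (- t).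
rewrite !opprK; apply => //; last by rewrite lerN2 ltW.
  by move=> x y Ix Iy z /andP[xz zy]; apply: (itv (- y) (- x)) => //; rewrite !lerN2 zy xz.
move=> s Is; have [e e0 he] := loc _ Is; exists e => // u v Iu Iv us vs.
by apply: he => //; rewrite -opprD normrN.
Qed.

End ContinuousInduction.

Section QuotientDistance.
Variables (R : realType) (T S : Type) (d : T -> T -> R) (pr : T -> S).
Hypotheses (d0 : forall x y, 0 <= d x y) (pr_surj : forall p, exists x, pr x = p).

Let D p q : set R := [set d x y | x in pr @^-1` [set p] & y in pr @^-1` [set q]].

Let D_nonempty p q : D p q !=set0.
Proof.
have [x xp] := pr_surj p; have [y yq] := pr_surj q.
by exists (d x y), x => //; exists y.
Qed.

Let D_lb p q : lbound (D p q) 0.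
Proof. by move=> _ [x _ [y _ <-]]. Qed.

Lemma quotient_dist_ge0 p q : 0 <= quotient_dist d pr p q.
Proof. by apply: lb_le_inf; [exact: D_nonempty | exact: D_lb]. Qed.

Lemma quotient_dist_le x y : quotient_dist d pr (pr x) (pr y) <= d x y.
Proof. by apply: ge_inf; [exists 0; exact: D_lb | exists x => //; exists y]. Qed.

Lemma quotient_dist_lt p q e : quotient_dist d pr p q < e ->
  exists x y, [/\ pr x = p, pr y = q & d x y < e].
Proof.
move=> /(inf_lt (D_nonempty p q))[_ [x xp [y yq <-]] lt].
by exists x, y.
Qed.

End QuotientDistance.

(** * Metric and geodesics of the hyperbolic plane *)

Section HyperbolicMetric.
Variable R : realType.
Implicit Types (x y z : hplane R) (s t : R) (F : frame R).

Local Notation L := (hexlen R).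

Lemma hplane_sheet x : on_sheet (hcoord x). Proof. by case: x. Qed.

Lemma hplane_eq x y : hcoord x = hcoord y -> x = y. Proof. exact: val_inj. Qed.

Lemma ch_hdist x y : ch (hdist x y) = - mink x y.
Proof.
by apply: ch_arcosh; have := sheet_mink_le (hplane_sheet x) (hplane_sheet y); lra.
Qed.

Lemma hdist_ge0 x y : 0 <= hdist x y.
Proof. by apply: arcosh_ge0; have := sheet_mink_le (hplane_sheet x) (hplane_sheet y); lra. Qed.

Lemma hdistC x y : hdist x y = hdist y x.
Proof. by rewrite /hdist minkC. Qed.

Lemma hdistxx x : hdist x x = 0.
Proof. by rewrite /hdist (sheet_norm (hplane_sheet x)) opprK -ch0 arcosh_ch normr0. Qed.

(** The Gram inequality bounds the difference of [ch (hdist x z)] and the product of the other two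
    [ch] by the product of the [sh]; then the addition formula applies. *)
Lemma hdist_triangle x y z : hdist x z <= hdist x y + hdist y z.
Proof.
suff /ch_le_norm : ch (hdist x z) <= ch (hdist x y + hdist y z).
  by rewrite !ger0_norm ?addr_ge0 ?hdist_ge0.
have := gram_le0 (hcoord x) y z; rewrite !(sheet_norm (hplane_sheet _)).
rewrite chD; have := ch2_sh2 (hdist x y); have := ch2_sh2 (hdist y z).
have := sh_ge0 (hdist_ge0 x y); have := sh_ge0 (hdist_ge0 y z).
rewrite !ch_hdist; move: (mink x y) (mink y z) (mink x z) (sh _) (sh _) => a b c p q p0 q0 ep eq h.
have sq : (- c - (- a * - b)) ^+ 2 <= (p * q) ^+ 2.
  have -> : (p * q) ^+ 2 = (a ^+ 2 - 1) * (b ^+ 2 - 1).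
    by rewrite exprMn; congr (_ * _); rewrite !expr2 in ep eq *; lra.
  by rewrite -subr_ge0 in h *; lra.
have : `|- c - (- a * - b)| <= p * q.
  by rewrite -(@ler_pXn2r _ 2) ?nnegrE ?mulr_ge0 // real_normK ?num_real.
rewrite ler_norml => /andP[_ h2]; lra.
Qed.

Lemma hdist_act g x y : hdist (winf_act g x) (winf_act g y) = hdist x y.
Proof. by rewrite /hdist /= mink_wmx. Qed.

Definition hgeo F t : hplane R := HPlane (geo_sheet F t).

Lemma hdist_geo F s t : hdist (hgeo F s) (hgeo F t) = `|t - s|.
Proof. by rewrite /hdist /= mink_geo opprK arcosh_ch. Qed.

Lemma geo_interp F r s t : sh (t - s) *: geo F r = sh (t - r) *: geo F s + sh (r - s) *: geo F t.
Proof.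
have c := ch2_sh2 s; have c' := ch2_sh2 t.
rewrite /geo !shB; apply: cV3_ext; rewrite !mxE; ring.
Qed.

Lemma frame_eq F F' s t : s <> t -> geo F s = geo F' s -> geo F t = geo F' t ->
  forall r, geo F r = geo F' r.
Proof.
move=> st es et r; have h0 : sh (t - s) != 0.
  by apply: sh_neq0; rewrite subr_eq0; apply/eqP => e; apply: st.
by apply: (scalerI h0); rewrite (geo_interp F r s t) (geo_interp F' r s t) es et.
Qed.

(** [geo F r] is a linear combination of [geo F s] and [geo F t], so the two distances determine
    [mink y (geo F r) = -1]. *)
Lemma geodesic_point F y r s t : s <> t -> hdist y (hgeo F s) = `|r - s| ->
  hdist y (hgeo F t) = `|r - t| -> y = hgeo F r.
Proof.
move=> st es et; have h0 : sh (t - s) != 0.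
  by apply: sh_neq0; rewrite subr_eq0; apply/eqP => e; apply: st.
apply: hplane_eq; apply: sheet_eq (hplane_sheet y) (geo_sheet F r) _.
have ms : mink y (geo F s) = - ch (r - s) by rewrite -ch_norm -es ch_hdist opprK.
have mt : mink y (geo F t) = - ch (r - t) by rewrite -ch_norm -et ch_hdist opprK.
apply: (mulfI h0); rewrite -minkZr (geo_interp F r s t) minkDr !minkZr ms mt.
have -> : t - s = (t - r) + (r - s) by ring.
by rewrite (shD (t - r) (r - s)) -(opprB t r) chN; ring.
Qed.

Lemma hframe_through x y s t : s <> t -> hdist x y = `|t - s| ->
  exists F, hgeo F s = x /\ hgeo F t = y.
Proof.
move=> st e; have [|F [e1 e2]] := @frame_through R x y s t (hplane_sheet x) (hplane_sheet y) st.
  by rewrite -ch_norm -e ch_hdist opprK.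
by exists F; split; exact: hplane_eq.
Qed.

Lemma fshift_subproof F l : [/\ on_sheet (geo F l), mink (gdir F l) (gdir F l) = 1
  & mink (geo F l) (gdir F l) = 0].
Proof. by rewrite mink_gdir mink_geo_gdir subrr ch0 sh0; split=> //; exact: geo_sheet. Qed.

Definition fshift F l := Frame (fshift_subproof F l).

Lemma geo_fshift F l t : geo (fshift F l) t = geo F (t + l).
Proof. by rewrite [RHS](geoE F (t + l) l) addrK. Qed.

Lemma frame_act g F : exists F', forall t, geo F' t = wmx g *m geo F t.
Proof. by have [u ->] := wmxP g; exists (fmap u F) => t; rewrite geo_fmap. Qed.

End HyperbolicMetric.

(** * The covering and lifts of geodesics *)

Section Covering.
Variables (R : realType) (k : nat) (H : subgroup (Wk R k)).
Hypotheses (k_ge4 : (4 <= k)%N) (k_even : ~~ odd k) (H_plus : H `<=` Wplus R k)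
  (H_ball : forall w : Wk R k,
     [set (w * h * w^-1)%g | h in H] `&` wball (4 * k) = [set 1%g]).
Implicit Types (x y z : hplane R) (s t u v e : R) (F : frame R) (g : Winf R).

Local Notation L := (hexlen R).
Local Notation S := (HkH H).
Local Notation dS := (HkH_dist H).

Lemma deckM g h : deck H g -> deck H h -> deck H (g * h)%g.
Proof. by rewrite /deck cosetM; exact: sg_mul. Qed.

Lemma N_deck g : sg_set (Nk R k) g -> deck H g.
Proof. by move=> /coset_eq1 e; rewrite /deck e; exact: sg_1. Qed.

Definition proj x : S := Defs.orbit (Hk_action R k) H (Defs.orbit (winf_action R) (Nk R k) x).

Lemma projP x y : proj x = proj y <-> exists2 g, deck H g & winf_act g x = y.
Proof.
split=> [/orbitP[h Hh]|[g Gg <-]]; last first.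
  apply/orbitP; exists (coset (Nk R k) g) => //.
  exact: (qactE (Nk R k) (winf_action R) g x).
rewrite -(coset_repr h) => e.
have /orbitP[n Nn en] : Defs.orbit (winf_action R) (Nk R k) (winf_action R (repr h) x)
    = Defs.orbit (winf_action R) (Nk R k) y.
  by rewrite -e; symmetry; exact: (qactE (Nk R k) (winf_action R) (repr h) x).
exists (n * repr h)%g; last by rewrite winf_act_M; exact: en.
apply: deckM; first exact: N_deck.
by rewrite /deck coset_repr.
Qed.

Lemma proj_surj p : exists x, proj x = p.
Proof.
by exists (repr (repr p)); rewrite /proj !orbit_repr.
Qed.

Lemma proj_act g x : deck H g -> proj (winf_act g x) = proj x.
Proof. by move=> Gg; symmetry; apply/projP; exists g. Qed.

Lemma Hk_dist_ge0 (X Y : Hk R k) : 0 <= Hk_dist X Y.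
Proof.
apply: quotient_dist_ge0; first exact: hdist_ge0.
by move=> p; exists (repr p); exact: orbit_repr.
Qed.

Lemma dS_le x y : dS (proj x) (proj y) <= hdist x y.
Proof.
have h := quotient_dist_le (Defs.orbit (Hk_action R k) H) Hk_dist_ge0.
apply: le_trans (h _ _) _; apply: quotient_dist_le; exact: hdist_ge0.
Qed.

(** The lift [x] can be prescribed because deck transformations are isometries; this collapses the
    two nested infima. *)
Lemma dS_lt p q e x : dS p q < e -> proj x = p -> exists y, proj y = q /\ hdist x y < e.
Proof.
move=> lt xp.
have h1 : forall p : S, exists X, Defs.orbit (Hk_action R k) H X = p.
  by move=> P; exists (repr P); exact: orbit_repr.
have [X [Y [eX eY]]] := quotient_dist_lt h1 lt.
have h2 : forall p : Hk R k, exists X, Defs.orbit (winf_action R) (Nk R k) X = p.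
  by move=> P; exists (repr P); exact: orbit_repr.
move=> /(quotient_dist_lt h2)[x' [y' [ex' ey' lt']]].
have ep : proj x' = proj x by rewrite xp -eX -ex'.
have /projP[g Gg eg] := ep.
exists (winf_act g y'); rewrite proj_act // -eg hdist_act; split=> //.
by rewrite -eY -ey'.
Qed.

Lemma dS_triangle p q r : dS p r <= dS p q + dS q r.
Proof.
apply/ler_addgt0Pr => e e0; have e2 : 0 < e / 2 by rewrite divr_gt0.
have [x xp] := proj_surj p.
have [|y [yq dy]] := @dS_lt p q (dS p q + e / 2) x _ xp; first by lra.
have [|z [zr dz]] := @dS_lt q r (dS q r + e / 2) y _ yq; first by lra.
rewrite -xp -zr; apply: le_trans (dS_le x z) _.
by have := hdist_triangle x y z; rewrite xp zr; lra.
Qed.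

Lemma deck_hdist g x : deck H g -> g <> 1%g -> L <= hdist x (winf_act g x).
Proof.
move=> Gg g1; have := deck_displacement k_ge4 k_even H_plus H_ball (hplane_sheet x) Gg g1 => h.
have /ch_le_norm : ch L <= ch (hdist x (winf_act g x)).
  by rewrite ch_hexlen ch_hdist /=; lra.
by rewrite !ger0_norm ?hdist_ge0 // ltW // hexlen_gt0.
Qed.

Lemma proj_inj_near x y : proj x = proj y -> hdist x y < L -> x = y.
Proof.
move=> /projP[g Gg <-] lt; have [->|g1] := eqVneq g 1%g; first by rewrite winf_act_1.
by have := deck_hdist x Gg (elimN eqP g1); rewrite leNgt lt.
Qed.

Lemma dS_local x y : hdist x y < L / 2 -> dS (proj x) (proj y) = hdist x y.
Proof.
move=> lt; apply/eqP; rewrite eq_le dS_le /= leNgt; apply/negP => h.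
have [y' [ey' ly']] := dS_lt h erefl.
have : y' = y.
  apply: proj_inj_near => //; apply: le_lt_trans (hdist_triangle y' x y) _.
  by rewrite hdistC; lra.
by move=> e; move: ly'; rewrite e ltxx.
Qed.

Lemma deck_frame g F : exists F', forall t, hgeo F' t = winf_act g (hgeo F t).
Proof. by have [F' e] := frame_act g F; exists F' => t; apply: hplane_eq; exact: e. Qed.

Lemma hgeo_eq F F' s t : s <> t -> hgeo F s = hgeo F' s -> hgeo F t = hgeo F' t ->
  forall r, hgeo F r = hgeo F' r.
Proof.
move=> st /(congr1 (@hcoord R)) es /(congr1 (@hcoord R)) et r.
by apply: hplane_eq; exact: frame_eq st es et r.
Qed.

Lemma proj_geodesic F (I : set R) : is_interval I -> (exists a b, [/\ I a, I b & a < b]) ->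
  geodesic dS I (fun t => proj (hgeo F t)).
Proof.
move=> itv nd; split=> // t It; exists (L / 4).
  by have := hexlen_gt0 R; lra.
move=> s u Is Iu ds du; have h : `|s - u| < L / 2.
  apply: le_lt_trans (ler_distD t s u) _; rewrite (distrC t u); lra.
by rewrite dS_local hdist_geo distrC.
Qed.

Lemma second_point (I : set R) t e : is_interval I -> (exists a b, [/\ I a, I b & a < b]) -> I t ->
  0 < e -> exists2 u, I u & u <> t /\ `|u - t| < e.
Proof.
move=> itv [a [b [Ia Ib ab]]] It e0.
have [tb|bt] := ltrP t b.
  exists (Num.min b (t + e / 2)).
    apply: (itv t b) => //; rewrite ge_min lexx /= andbT le_min (ltW tb) /=; lra.
  have h1 : t < Num.min b (t + e / 2) by rewrite lt_min tb /=; lra.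
  have h2 : Num.min b (t + e / 2) <= t + e / 2 by rewrite ge_min lexx orbT.
  by split; [move=> h; lra | rewrite gtr0_norm; lra].
exists (Num.max a (t - e / 2)).
  apply: (itv a t) => //; rewrite le_max lexx /= ge_max; apply/andP; split; lra.
have h1 : Num.max a (t - e / 2) < t by rewrite gt_max; apply/andP; split; lra.
have h2 : t - e / 2 <= Num.max a (t - e / 2) by rewrite le_max lexx orbT.
by split; [move=> h; lra | rewrite ltr0_norm; lra].
Qed.

(** A lift of [c t] and a nearby lift of a second point fix a geodesic; every other nearby point is
    located on it by its distances to these two. The radius [L / 8] keeps all of them where the
    projection is isometric. *)
Lemma local_lift (I : set R) c t : geodesic dS I c -> I t ->
  exists2 e, 0 < e & exists F, forall u, I u -> `|u - t| < e -> c u = proj (hgeo F u).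
Proof.
move=> [itv nd loc] It; have [e e0 he] := loc t It; have L0 := hexlen_gt0 R.
pose e' := Num.min e (L / 8).
have e'0 : 0 < e' by rewrite lt_min e0 /=; lra.
have [e'e e'L] : e' <= e /\ e' <= L / 8 by rewrite !ge_min !lexx orbT.
have [x xt] := proj_surj (c t).
have tt : `|t - t| < e by rewrite subrr normr0.
have lift u : I u -> `|u - t| < e' -> exists y, proj y = c u /\ hdist x y = `|u - t|.
  move=> Iu ut; have ute : `|u - t| < e by lra.
  have dtu := he t u It Iu tt ute; rewrite distrC in dtu.
  have [|y [yu dy]] := @dS_lt (c t) (c u) (L / 8) x _ xt; first by rewrite dtu; lra.
  by exists y; split=> //; rewrite -dS_local ?xt ?yu ?dtu //; lra.
have [u1 Iu1 [u1t u1e]] := second_point itv nd It e'0.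
have [y1 [py1 dy1]] := lift u1 Iu1 u1e.
have [|F [Ft Fu1]] := @hframe_through R x y1 t u1 _ dy1; first by move=> h; exact: u1t.
exists e' => //; exists F => u Iu ue.
have [y [py dy]] := lift u Iu ue; rewrite -py; congr proj.
apply: (geodesic_point (s := t) (t := u1)).
- by move=> h; exact: u1t.
- by rewrite Ft hdistC dy.
- rewrite Fu1 -dS_local ?py ?py1.
    by apply: he => //; lra.
  apply: le_lt_trans (hdist_triangle y x y1) _; rewrite hdistC dy dy1; lra.
Qed.

Lemma lift_unique F F' s t : s <> t -> `|t - s| < L / 2 ->
  proj (hgeo F s) = proj (hgeo F' s) -> proj (hgeo F t) = proj (hgeo F' t) ->
  exists2 g, deck H g & forall r, winf_act g (hgeo F r) = hgeo F' r.
Proof.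
move=> st lt /projP[g Gg eg] et; exists g => //.
have [F1 eF1] := deck_frame g F.
suff h : forall r, hgeo F1 r = hgeo F' r by move=> r; rewrite -eF1 h.
have es : hgeo F1 s = hgeo F' s by rewrite eF1.
apply: (hgeo_eq st) => //.
apply: proj_inj_near; first by rewrite eF1 proj_act.
apply: le_lt_trans (hdist_triangle _ (hgeo F1 s) _) _.
by rewrite {2}es !hdist_geo (distrC s); lra.
Qed.

Lemma geodesic_lift (I : set R) c : geodesic dS I c ->
  exists F, forall t, I t -> c t = proj (hgeo F t).
Proof.
move=> geo_c; have [itv nd _] := geo_c; have [a [b [Ia Ib ab]]] := nd.
have [e0 e00 [F hF]] := local_lift geo_c Ia; exists F.
have L0 := hexlen_gt0 R.
(* Agreement near [u], not only at [u]: two distinct times are needed to identify two lifts. *)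
pose A u := exists2 e, 0 < e & forall v, I v -> `|v - u| < e -> c v = proj (hgeo F v).
suff hA : forall t, I t -> A t.
  by move=> t It; have [e e1 he] := hA t It; apply: he => //; rewrite subrr normr0.
apply: (interval_induction itv Ia); first by exists e0.
move=> t It; have [e e1 [F' hF']] := local_lift geo_c It; exists e => //.
move=> u v Iu Iv ut vt [d d0 hd].
pose m := Num.min d (Num.min (e - `|u - t|) (L / 2)).
have m0 : 0 < m by rewrite !lt_min d0 /=; apply/andP; split; lra.
have [m1 m2 m3] : [/\ m <= d, m <= e - `|u - t| & m <= L / 2].
  by rewrite !ge_min !lexx !orbT.
have [u' Iu' [u'u du']] := second_point itv nd Iu m0.
have u't : `|u' - t| < e by apply: le_lt_trans (ler_distD u u' t) _; lra.
have [||||g Gg eg] := @lift_unique F' F u u'.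
- by move=> h; exact: u'u.
- by lra.
- by rewrite -hF' // -hd // subrr normr0.
- by rewrite -hF' // -hd //; lra.
exists (e - `|v - t|) => [|w Iw wv]; first by lra.
have wt : `|w - t| < e by apply: le_lt_trans (ler_distD v w t) _; lra.
by rewrite hF' // -(eg w) proj_act.
Qed.

Lemma closed_geodesic_lift c l : closed_geodesic dS c l -> exists F g,
  [/\ forall t, c t = proj (hgeo F t), deck H g & forall t, winf_act g (hgeo F t) = hgeo F (t + l)].
Proof.
move=> [l0 geo_c per]; have [F hF] := geodesic_lift geo_c.
have L0 := hexlen_gt0 R.
have {}hF t : c t = proj (hgeo F t) by exact: hF.
have sF t : hgeo (fshift F l) t = hgeo F (t + l) by apply: hplane_eq; exact: geo_fshift.
have [||||g Gg eg] := @lift_unique F (fshift F l) 0 (L / 4).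
- by move=> h; lra.
- by rewrite subr0 gtr0_norm; lra.
- by rewrite sF -!hF per.
- by rewrite sF -!hF per.
by exists F, g; split=> // t; rewrite eg sF.
Qed.

Lemma hgeo_translation g F l : (forall t, winf_act g (hgeo F t) = hgeo F (t + l)) ->
  forall t, wmx g *m geo F t = geo F (t + l).
Proof. by move=> h t; exact: (congr1 (@hcoord R) (h t)). Qed.

Lemma H_acts_freely : acts_freely (Hk_action R k) H.
Proof.
move=> h Hh X; rewrite -(orbit_repr X) -(coset_repr h) => e.
have /orbitP[n Nn en] : Defs.orbit (winf_action R) (Nk R k) (winf_action R (repr h) (repr X))
    = Defs.orbit (winf_action R) (Nk R k) (repr X).
  by rewrite -[RHS]e; symmetry; exact: (qactE (Nk R k) (winf_action R) (repr h) (repr X)).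
have Gn : deck H (n * repr h)%g.
  by apply: deckM; [exact: N_deck | rewrite /deck coset_repr].
have e1 : (n * repr h)%g = 1%g.
  apply: contrapT => n1; have := deck_hdist (repr X) Gn n1.
  have -> : winf_act (n * repr h)%g (repr X) = repr X by rewrite winf_act_M; exact: en.
  by rewrite hdistxx; have := hexlen_gt0 R; lra.
have -> : repr h = n^-1%g by rewrite -(mulKg n (repr h)) e1 mulg1.
by apply/coset_eq1; exact: sg_inv.
Qed.

End Covering.

(** Compactness of a segment, for a property that survives shrinking the radius. *)
Lemma uniform_radius (R : realType) (Q : R -> R -> Prop) (a b : R) : a <= b ->
  (forall r r' x, r' <= r -> Q r x -> Q r' x) ->
  (forall x, a <= x <= b -> exists2 r, 0 < r & forall y, a <= y <= b -> `|y - x| < r -> Q r y) ->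
  exists2 r, 0 < r & forall x, a <= x <= b -> Q r x.
Proof.
move=> ab mono loc.
pose A t := exists2 r, 0 < r & forall x, a <= x <= t -> Q r x.
suff [r r0 h] : A b by exists r.
have itv : is_interval [set t | a <= t <= b].
  by move=> x y /andP[ax xb] /andP[ay yb] z /andP[xz zy] /=; apply/andP; split; lra.
apply: (@interval_induction R [set t | a <= t <= b] A a itv); rewrite /= ?lexx ?ab //.
  have [|r r0 h] := loc a; first by rewrite lexx ab.
  exists r => // x; rewrite -eq_le => /eqP <-; apply: h; rewrite ?lexx ?ab //.
  by rewrite subrr normr0.
move=> t tab; have [r r0 h] := loc t tab; exists r => // u v /andP[au ub] /andP[av vb] ut vt [d d0 hd].
exists (Num.min d r); first by rewrite lt_min d0.
move=> x /andP[ax xv]; have [xu|ux] := lerP x u.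
  by apply: mono (hd x _); rewrite ?ge_min ?lexx ?ax.
apply: mono (h x _ _); rewrite ?ge_min ?lexx ?orbT //; first by apply/andP; split; lra.
by move: ut vt; rewrite !ltr_norml => /andP[u1 u2] /andP[v1 v2]; apply/andP; split; lra.
Qed.

(** * Closed geodesics are essential *)

Section Homotopy.
Variables (R : realType) (k : nat) (H : subgroup (Wk R k)).
Hypotheses (k_ge4 : (4 <= k)%N) (k_even : ~~ odd k) (H_plus : H `<=` Wplus R k)
  (H_ball : forall w : Wk R k,
     [set (w * h * w^-1)%g | h in H] `&` wball (4 * k) = [set 1%g]).
Implicit Types (x y z : hplane R) (s t e l : R).

Local Notation L := (hexlen R).
Local Notation S := (HkH H).
Local Notation dS := (HkH_dist H).
Local Notation near1 := (proj_inj_near k_ge4 k_even H_plus H_ball).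
Local Notation dSloc := (dS_local k_ge4 k_even H_plus H_ball).

Lemma dS_sym (p q : S) : dS p q <= dS q p.
Proof.
apply/ler_addgt0Pr => e e0; have [x xq] := proj_surj q.
have [|y [yp d]] := @dS_lt R k H q p (dS q p + e) x _ xq; first by lra.
by rewrite -{1}yp -{1}xq; apply: le_trans (dS_le H y x) _; rewrite hdistC ltW.
Qed.

Section UniformContinuity.
Variables (f : R -> R -> S) (l : R).
Hypotheses (l0 : 0 <= l) (cont : forall s t, 0 <= s <= 1 -> forall e, 0 < e -> exists2 r, 0 < r &
  forall s' t', 0 <= s' <= 1 -> `|s' - s| < r -> `|t' - t| < r -> dS (f s t) (f s' t') < e).

Let close r e s t := forall s' t', 0 <= s' <= 1 -> `|s' - s| < r -> `|t' - t| < r ->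
  dS (f s t) (f s' t') < e.

(** Compactness is used twice: in [t] for a fixed [s], giving a tube, then in [s]. *)
Lemma homotopy_uniform e : 0 < e -> exists2 r, 0 < r &
  forall s t, 0 <= s <= 1 -> 0 <= t <= l -> close r e s t.
Proof.
move=> e0; have mono r r' d s t : r' <= r -> close r d s t -> close r' d s t.
  by move=> rr h s' t' hs ss tt; apply: h => //; lra.
have tube s : 0 <= s <= 1 -> exists2 r, 0 < r & forall t, 0 <= t <= l -> close r (e / 2) s t.
  move=> s01; apply: uniform_radius => //.
    by move=> r r' x; exact: mono.
  move=> x _; have e4 : 0 < e / 4 by rewrite divr_gt0.
  have [r r0 h] := @cont s x s01 _ e4; exists (r / 2); first by rewrite divr_gt0.
  move=> y _ yx s' t' hs ss tt.
  have ss0 : `|s - s| < r by rewrite subrr normr0.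
  have d1 : dS (f s x) (f s y) < e / 4 by apply: h => //; lra.
  have d2 : dS (f s x) (f s' t') < e / 4.
    by apply: h => //; first lra; apply: le_lt_trans (ler_distD y t' x) _; lra.
  have := dS_triangle (f s y) (f s x) (f s' t'); have := dS_sym (f s y) (f s x); lra.
have [|s s01|r r0 h] := @uniform_radius R (fun r s => forall t, 0 <= t <= l -> close r e s t) 0 1 ler01.
- by move=> r r' s rr h t tl; apply: mono rr _; exact: h.
- have [r r0 h] := tube s s01; exists (r / 2); first by rewrite divr_gt0.
  move=> y y01 ys t tl s' t' hs ss tt.
  have tt0 : `|t - t| < r by rewrite subrr normr0.
  have d1 : dS (f s t) (f y t) < e / 2 by apply: h => //; lra.
  have d2 : dS (f s t) (f s' t') < e / 2.
    by apply: h => //; [apply: le_lt_trans (ler_distD y s' s) _; lra | lra].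
  have := dS_triangle (f y t) (f s t) (f s' t'); have := dS_sym (f y t) (f s t); lra.
by exists r => // s t s01 tl; exact: h.
Qed.

End UniformContinuity.

(* The homotopy is sampled on a fine grid; a row of the grid lifts to a chain
   of points of the hyperbolic plane, and consecutive rows have the same
   holonomy, which is trivial for a constant row. *)
Lemma closed_geodesic_essential c l : closed_geodesic dS c l -> ~ null_homotopic dS c l.
Proof.
move=> cg [f [f0 [p f1] fper fcont]]; have [l0 _ _] := cg.
have [F [g [cF Gg eg]]] := closed_geodesic_lift k_ge4 k_even H_plus H_ball cg.
have L0 := hexlen_gt0 R; have L8 : 0 < L / 8 by rewrite divr_gt0.
have [r r0 unif] := homotopy_uniform (ltW l0) fcont L8.
pose m := Num.min r (L / 8); have m0 : 0 < m by rewrite lt_min r0.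
have [mr mL] : m <= r /\ m <= L / 8 by rewrite !ge_min !lexx orbT.
pose n := (Num.truncn ((1 + l) / m)).+1.
have n0 : 0 < n%:R :> R by rewrite ltr0n.
have nm : (1 + l) / n%:R < m.
  by rewrite ltr_pdivrMr // mulrC -ltr_pdivrMr //; exact: truncnS_gt.
have [n1 nl] : 1 / n%:R < m /\ l / n%:R < m.
  by split; apply: le_lt_trans nm; rewrite ler_pM2r ?invr_gt0 //; lra.
pose sg (a : nat) : R := a%:R / n%:R; pose tg (b : nat) : R := l * (b%:R / n%:R).
have s01 a : (a <= n)%N -> 0 <= sg a <= 1.
  by move=> an; rewrite divr_ge0 //= ler_pdivrMr // mul1r ler_nat.
have t0l b : (b <= n)%N -> 0 <= tg b <= l.
  by move=> bn; have /andP[h1 h2] := s01 b bn; rewrite mulr_ge0 ?(ltW l0) //= ler_piMr ?(ltW l0).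
have sS a : `|sg a.+1 - sg a| < r.
  rewrite (_ : _ - _ = 1 / n%:R); last by rewrite /sg -natr1; ring.
  rewrite gtr0_norm ?divr_gt0 //; lra.
have tS b : `|tg b.+1 - tg b| < m.
  rewrite (_ : _ - _ = l / n%:R); last by rewrite /tg -natr1; ring.
  rewrite gtr0_norm ?divr_gt0 //; lra.
have tg0 : tg 0%N = 0 by rewrite /tg mul0r mulr0.
have tgn : tg n = l by rewrite /tg divff ?mulr1 // gt_eqF.
(* A lift of row [a] of the grid with short steps, whose end points differ by the same [g] for all
   rows. *)
pose row a (y : nat -> hplane R) := [/\ forall b, (b <= n)%N -> proj H (y b) = f (sg a) (tg b),
  forall b, (b < n)%N -> hdist (y b) (y b.+1) < L / 8 & winf_act g (y 0%N) = y n].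
have rows a : (a <= n)%N -> exists y : nat -> hplane R, row a y.
  elim: a => [_|a IH an].
    exists (fun b => hgeo F (tg b)); split=> [b _|b _|].
    - by rewrite /sg mul0r f0 cF.
    - by rewrite hdist_geo; have := tS b; lra.
    - by rewrite eg tg0 add0r tgn.
  have [y [y1 y2 y3]] := IH (ltnW an).
  have near_row b : exists z, (b <= n)%N -> proj H z = f (sg a.+1) (tg b) /\ hdist (y b) z < L / 8.
    have [bn|_] := boolP (b <= n)%N; last by exists (y b).
    have d : dS (f (sg a) (tg b)) (f (sg a.+1) (tg b)) < L / 8.
      by apply: unif; rewrite ?s01 ?t0l ?sS ?subrr ?normr0 // ltnW.
    by have [z [z1 z2]] := dS_lt d (y1 b bn); exists z.
  have [z hz] := choice near_row; exists z.
  have z1 b bn := (hz b bn).1; have z2 b bn := (hz b bn).2.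
  split=> // [b bn|].
    have h : hdist (z b) (z b.+1) < L / 2.
      apply: le_lt_trans (hdist_triangle _ (y b) _) _.
      have := hdist_triangle (y b) (y b.+1) (z b.+1).
      have := z2 b (ltnW bn); have := z2 b.+1 bn; have := y2 b bn; rewrite (hdistC (z b)); lra.
    rewrite -(dSloc h) z1 ?(ltnW bn) // z1 //; apply: unif; rewrite ?s01 ?t0l ?(ltnW bn) //.
      by rewrite subrr normr0.
    by have := tS b; lra.
  (* [winf_act g (z 0)] and [z n] lie over the same point and are each within [L / 8] of [y n],
     hence coincide. *)
  apply: near1.
    rewrite proj_act // !z1 // tg0 tgn -[X in _ = f _ X]add0r; symmetry; apply: fper.
    exact: s01.
  apply: le_lt_trans (hdist_triangle _ (winf_act g (y 0%N)) _) _.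
  rewrite hdist_act y3 (hdistC (z 0%N)).
  have := z2 0%N (leq0n _); have := z2 n (leqnn _); lra.
have [y [y1 y2 y3]] := rows n (leqnn _).
have yc b : (b <= n)%N -> y b = y 0%N.
  elim: b => // b IH bn; rewrite -IH; last exact: ltnW.
  symmetry; apply: near1; last by have := y2 b bn; lra.
  by rewrite !y1 ?(ltnW bn) // /sg divff ?f1 // gt_eqF.
have g1 : g = 1%g.
  apply: contrapT => g1; have := deck_hdist k_ge4 k_even H_plus H_ball (y 0%N) Gg g1.
  by rewrite y3 yc // hdistxx; lra.
have := congr1 (hdist (hgeo F 0)) (eg 0).
rewrite g1 winf_act_1 hdistxx hdist_geo add0r subr0 => /esym/eqP.
by rewrite normr_eq0 gt_eqF.
Qed.

End Homotopy.

(** * Curves and systoles *)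

Section Curves.
Variables (R : realType) (k : nat) (H : subgroup (Wk R k)).
Hypotheses (k_ge4 : (4 <= k)%N) (k_even : ~~ odd k) (H_plus : H `<=` Wplus R k)
  (H_ball : forall w : Wk R k,
     [set (w * h * w^-1)%g | h in H] `&` wball (4 * k) = [set 1%g]).
Implicit Types (x y z : hplane R) (s t e l : R) (F : frame R).

Local Notation L := (hexlen R).
Local Notation S := (HkH H).
Local Notation dS := (HkH_dist H).
Local Notation n_ i := (side_normal R i).
Local Notation rw u := (refl_word R u).

(** The relator [(s_j s_(j+2)) ^ k] is this translation: both reflecting lines are perpendicular to
    side [j + 1], at distance [L]. An inverse corrects the direction. *)
Lemma wall_translation F v : wall v -> contains F v -> exists2 g,
  sg_set (Nk R k) g & forall t, winf_act g (hgeo F t) = hgeo F (t + (2 * k)%:R * L).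
Proof.
move=> wv cv; have [u cu] := tiling (geo_sheet F 0); rewrite -geo_fmap in cu.
have [l cl] := chamber_contains (wall_word u wv) ((contains_fmap u F v).2 cv) cu.
pose j := l - 1; have lj : l = j + 1 by rewrite /j subrK.
rewrite lj in cl; have [ti [tj [ci cj [ni nj] _ EL]]] := wall_sides cl.
pose q := (sinf R j * sinf R (j + 2))%g.
have Nq : sg_set (Nk R k) (q ^+ k)%g.
  by move=> A [_]; apply; exists j, 1%g; rewrite mul1g invg1 mulg1.
have q1 t : wmx q *m geo (fmap u F) t = geo (fmap u F) (t + 2 * (tj - ti)).
  rewrite wmxM -mulmxA -[wmx (sinf R (j + 2))]wallrefl_normal -[wmx (sinf R j)]wallrefl_normal.
  rewrite (wallrefl_geo _ (side_normal_unit R _) ni ci) (wallrefl_geo _ (side_normal_unit R _) nj cj).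
  by congr geo; ring.
have qn n t : wmx (q ^+ n)%g *m geo (fmap u F) t = geo (fmap u F) (t + n%:R * (2 * (tj - ti))).
  elim: n t => [|n IH] t; first by rewrite expg0 wmx1 mul1mx mul0r addr0.
  by rewrite expgS wmxM -mulmxA IH q1 -natr1; congr geo; ring.
have [g Ng hg] : exists2 g, sg_set (Nk R k) g &
    forall t, wmx g *m geo (fmap u F) t = geo (fmap u F) (t + (2 * k)%:R * L).
  have e2 : (2 * k)%:R = k%:R * 2 :> R by rewrite natrM mulrC.
  have [h|h] := lerP ti tj.
    exists (q ^+ k)%g => // t; rewrite qn e2 -EL; congr geo.
    by rewrite distrC ger0_norm ?subr_ge0 //; ring.
  exists ((q ^+ k)^-1)%g => [|t]; first exact: sg_inv.
  have -> : geo (fmap u F) t = wmx (q ^+ k)%g *m geo (fmap u F) (t + (2 * k)%:R * L).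
    by rewrite qn e2 -EL; congr geo; rewrite gtr0_norm ?subr_gt0 //; ring.
  by rewrite mulmxA -[_ *m wmx (q ^+ k)%g]/(wmx ((q ^+ k)^-1 * q ^+ k)%g) mulVg mul1mx.
exists ((winf_word R u)^-1 * g * (winf_word R u)^-1^-1)%g; first exact: ns_conj.
move=> t; apply: hplane_eq.
rewrite -[hcoord (winf_act _ _)]/(wmx _ *m geo F t) invgK -winf_word_rev !wmxM !wmx_word.
by rewrite -!mulmxA -geo_fmap hg geo_fmap rw_revK.
Qed.

(** For the converse a point on a wall is moved into the base tile, where the equality case of
    [chamber_pos] turns the wall into a side. *)
Lemma skeletonP (p : S) :
  skeleton (tau_H H) p <-> exists2 x, proj H x = p & exists2 v, wall v & mink v x = 0.
Proof.
split.
  move=> [_ [_ [_ [w _ <-] <-] <-] [i _]] /= [_ [_ [y [_ yi] <-] <-] <-].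
  exists (winf_act w y); first reflexivity.
  exists (wmx w *m n_ i); first by apply: wall_wmx; exact: wall_normal.
  by rewrite /= mink_wmx.
move=> [x <- [v wv vx]]; have [u cu] := tiling (hplane_sheet x).
have su := on_sheet_word u (hplane_sheet x); have wuv := wall_word u wv.
have vu : mink (rw u *m v) (rw u *m x) = 0 by rewrite mink_word.
have [i ni] : exists i, mink (n_ i) (rw u *m x) = 0.
  have [pv|np] := boolP (pos (rw u *m v)).
    by have [_ /(_ vu)[i e]] := chamber_pos wuv pv su cu; exists i; rewrite -e.
  have pv : pos (- (rw u *m v)) by rewrite posN //; exact: wall_latt.
  have [_] := chamber_pos (wallN wuv) pv su cu; rewrite minkNl vu oppr0 => /(_ erefl)[i e].
  by exists i; rewrite -e minkNl vu oppr0.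
pose y := winf_act (winf_word R u) x.
have ey : hcoord y = rw u *m x by rewrite /= wmx_word.
pose w := winf_word R (rev u).
have exy : x = winf_act w y by apply: hplane_eq; rewrite /= !wmx_word rw_revK.
exists (map_tile (Defs.orbit (Hk_action R k) H) true (map_tile (Defs.orbit (winf_action R) (Nk R k)) true
  (map_tile (winf_act w) (\det (wmx w) == 1) (Tile (@hexagon R) (@hexagon_side R) true)))).
  eexists; last reflexivity; eexists; last reflexivity; by exists w.
exists i => //=; exists (Defs.orbit (winf_action R) (Nk R k) x); last by [].
exists x; last by [].
exists y; last by rewrite -exy.
by split; [move=> m; rewrite ey; exact: cu | rewrite ey].
Qed.

Lemma geodesic_on_wall F v : wall v -> contains F v ->
  curve dS (tau_H H) setT (fun t => proj H (hgeo F t)).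
Proof.
move=> wv cv; split.
- by apply: proj_geodesic => //; exists 0, 1; split.
- move=> _ [t _ <-]; apply/skeletonP; exists (hgeo F t) => //; exists v => //.
  exact: (containsE _ _).1 cv t.
- by move=> J c' _ _ _ _ t _.
Qed.

(** At a generic time the lift still lies on some wall, which must then contain it; maximality
    extends the curve to the whole line. *)
Lemma curve_on_wall (I : set R) c : curve dS (tau_H H) I c -> I = setT /\
  exists F, (forall t, c t = proj H (hgeo F t)) /\ exists2 v, wall v & contains F v.
Proof.
move=> [geo_c sk max]; have [itv [a [b [Ia Ib ab]]] _] := geo_c.
have [F hF] := geodesic_lift k_ge4 k_even H_plus H_ball geo_c.
have [v wv cv] : exists2 v, wall v & contains F v.
  have [t [at_ tb gen]] := generic_exists F ab.
  have It : I t by apply: (itv a b) => //; rewrite !ltW.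
  have : skeleton (tau_H H) (c t) by apply: sk; exists t.
  move=> /skeletonP[x xc [v wv vx]]; rewrite hF // in xc.
  have /projP[g _ eg] := xc; have wgv := wall_wmx g wv.
  exists (wmx g *m v) => //; apply: gen => //.
  by rewrite /cross -[geo F t]/(hcoord (hgeo F t)) -eg /= mink_wmx.
have [geo' sk' _] := geodesic_on_wall wv cv.
have IT : setT `<=` I.
  apply: (max setT (fun t => proj H (hgeo F t))) => // t It.
  by rewrite -hF //; exact: set_mem.
have eI : I = setT by apply/seteqP; split.
by split=> //; exists F; split; [move=> t; apply: hF; rewrite eI | exists v].
Qed.

Lemma wall_closed_geodesic F v : wall v -> contains F v ->
  closed_geodesic dS (fun t => proj H (hgeo F t)) ((2 * k)%:R * L).
Proof.
move=> wv cv; have [geo_c _ _] := geodesic_on_wall wv cv; split=> //.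
  by rewrite mulr_gt0 ?hexlen_gt0 // ltr0n; lia.
move=> t; have [g Ng hg] := wall_translation wv cv.
by rewrite -hg proj_act //; exact: N_deck.
Qed.

Lemma closed_geodesic_length c l : closed_geodesic dS c l -> (2 * k)%:R * L <= l /\
  (l = (2 * k)%:R * L -> exists F, (forall t, c t = proj H (hgeo F t)) /\
    exists2 v, wall v & contains F v).
Proof.
move=> cg; have [l0 _ _] := cg.
have [F [g [cF Gg eg]]] := closed_geodesic_lift k_ge4 k_even H_plus H_ball cg.
have [h1 h2] := translation_ge k_ge4 k_even H_plus H_ball l0 Gg (hgeo_translation eg).
by split=> // /h2 h; exists F.
Qed.

(** Shows that length [2 k L] is attained. The line of side 0 has the normal of the adjacent side as
    tangent where the two meet. *)
Lemma wall_frame_exists : exists F v, wall v /\ contains F v.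
Proof.
have e : mink (n_ 0) (n_ (0 + 1)) = 0 := normal_perp R 0.
have [z [sz z0 z1]] := meeting_point (side_normal_unit R 0) (side_normal_unit R (0 + 1)) e.
rewrite minkC in z1.
exists (Frame (And3 sz (side_normal_unit R (0 + 1)) z1)), (n_ 0); split; first exact: wall_normal.
by split.
Qed.

Lemma tau_regular : regular dS (tau_H H) (2 * k).
Proof.
move=> I c cc; have [eI [F [cF [v wv cv]]]] := curve_on_wall cc.
have -> : c = (fun t => proj H (hgeo F t)) by apply/funext.
split=> //; first exact: wall_closed_geodesic wv cv.
by move=> l /closed_geodesic_length[].
Qed.

Lemma systoles_curves : systoles dS = curves dS (tau_H H).
Proof.
have [F0 [v0 [w0 c0]]] := wall_frame_exists.
have cg0 := wall_closed_geodesic w0 c0.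
have ess c l : closed_geodesic dS c l -> essential_closed_geodesic dS c l.
  by move=> cg; split=> //; exact: closed_geodesic_essential cg.
apply/seteqP; split=> [C [c [l [[cg _] min ->]]]|C [I [c [cc ->]]]].
  have [ge eq] := closed_geodesic_length cg.
  have le := min _ _ (ess _ _ cg0).
  have [|F [cF [v wv cv]]] := eq; first by apply/eqP; rewrite eq_le le ge.
  have -> : c = (fun t => proj H (hgeo F t)) by apply/funext.
  exists setT, (fun t => proj H (hgeo F t)); split=> //.
  exact: geodesic_on_wall wv cv.
have [-> [F [cF [v wv cv]]]] := curve_on_wall cc.
have -> : c = (fun t => proj H (hgeo F t)) by apply/funext.
exists (fun t => proj H (hgeo F t)), ((2 * k)%:R * L); split=> //.
  exact/ess/(wall_closed_geodesic wv cv).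
by move=> c' l' [/closed_geodesic_length[]].
Qed.

End Curves.

Close Scope ring_scope.

Theorem mainTheorem3 (R : realType) (k : nat) (k_ge4 : (4 <= k)%N)
  (k_even : ~~ odd k) (H : subgroup (Wk R k))
  (H_plus : H `<=` Wplus R k)
  (H_ball : forall w : Wk R k,
     [set (w * h * w^-1)%g | h in H] `&` wball (4 * k) = [set 1%g]) :
  [/\ acts_freely (Hk_action R k) H,
      regular (HkH_dist H) (tau_H H) (2 * k) &
      systoles (HkH_dist H) = curves (HkH_dist H) (tau_H H)].
Proof.
split; first exact: H_acts_freely k_ge4 k_even H_plus H_ball.
  exact: tau_regular k_ge4 k_even H_plus H_ball.
exact: systoles_curves k_ge4 k_even H_plus H_ball.
Qed.
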